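(* Let $\Omega_1\subset\mathbb{R}^N$ be a region of finite measure. 1. Suppose that for some $q>2$ and $c_{13}>0$, $\|f\|_{L^q(\Omega_1)}\le c_{13}\|f\|_{W^{1,2}(\Omega_1)}$ for all $f\in W^{1,2}(\Omega_1)$. Then for every integer $n\ge1$ there exist $b_{n,1}=b_{n,1}(\Omega_1)>0$ and $\varepsilon_{n,1}=\varepsilon_{n,1}(\Omega_1)>0$ such that for all regions $\Omega_2\subset\Omega_1$ with $|\Omega_1\setminus\Omega_2|\le\varepsilon_{n,1}$, $$\mu_{n,2}\le(1+b_{n,1}|\Omega_1\setminus\Omega_2|)\lambda_{n,1}.$$ 2. If, in addition, $M(\partial\Omega_1)<N$, then for every $\sigma\in(0,N-M(\partial\Omega_1))$ and every integer $n\ge1$ there exist $b_{n,2}=b_{n,2}(\Omega_1)>0$ and $\varepsilon_{n,2}=\varepsilon_{n,2}(\Omega_1)>0$ such that for all $0<\varepsilon\le\varepsilon_{n,2}$ and all regions $\Omega_2$ with $\Omega_1\setminus\partial_\varepsilon\Omega_1\subset\Omega_2\subset\Omega_1$, $$\mu_{n,2}\le(1+b_{n,2}\varepsilon^\sigma)\lambda_{n,1}.$$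
   Context: A region is an open connected subset of $\mathbb{R}^N$; $|\cdot|$ denotes Lebesgue measure. For a region $\Omega_i$, let $Q_i(f)=\int_{\Omega_i}|\nabla f|^2\,d^Nx$ for $f\in W^{1,2}(\Omega_i)$ and $Q_i(f)=+\infty$ otherwise; the Neumann Laplacian $H_i$ is the self-adjoint operator in $L^2(\Omega_i)$ associated with $Q_i$. For every finite-dimensional subspace $L\subset L^2(\Omega_i)$ let $\mu(L)=\sup\{Q_i(f)/\|f\|^2_{L^2(\Omega_i)}: 0\ne f\in L\}$, and for integers $n\ge0$ let $\mu_{n,i}=\inf\{\mu(L):\dim L=n+1\}$. Write $\lambda_{n,1}=\mu_{n,1}$; when $H_1$ has compact resolvent these are its eigenvalues in increasing order repeated according to multiplicity. For $x\in\Omega_1$, $d(x)=\operatorname{dist}(x,\partial\Omega_1)$, $\partial_\varepsilon\Omega_1=\{x\in\Omega_1:d(x)\le\varepsilon\}$, and the Minkowski dimension is $M(\partial\Omega_1)=\inf\{\lambda>0:\limsup_{\varepsilon\to0+}|\partial_\varepsilon\Omega_1|/\varepsilon^{N-\lambda}<\infty\}$. *)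

(* Defs.v *)
From HB Require Import structures.
From mathcomp Require Import all_boot all_order all_algebra.
From mathcomp Require Import all_classical all_reals all_analysis.
Set Implicit Arguments. Unset Strict Implicit. Unset Printing Implicit Defensive.
Import Order.TTheory GRing.Theory Num.Theory.
Import numFieldNormedType.Exports.
Local Open Scope classical_set_scope.
Local Open Scope ring_scope.

Section NeumannDefs.
Variable R : realType.

(* Iterated integral w.r.t. Lebesgue measure on R; by Tonelli this is the
   Lebesgue integral on R^N for nonnegative Borel functions, which is the only
   way it is used below. *)
Fixpoint iint (N : nat) : ('rV[R]_N -> \bar R) -> \bar R :=
  match N return ('rV[R]_N -> \bar R) -> \bar R with
  | 0 => fun f => f 0
  | n.+1 => fun f =>
      (\int[@lebesgue_measure R]_(x in setT)
          iint (fun v : 'rV[R]_n => f (row_mx (\row_(j < 1) x) v)))%E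
  end.

Definition borelN (N : nat) (A : set 'rV[R]_N) : Prop :=
  smallest (sigma_algebra setT) [set U : set 'rV[R]_N | open U] A.

Definition borel_fun (N : nat) (f : 'rV[R]_N -> R) : Prop :=
  forall U : set R, open U -> borelN (f @^-1` U).

Definition lmeas (N : nat) (A : set 'rV[R]_N) : \bar R :=
  iint (fun x => (\1_A x)%:E).

Definition intOn (N : nat) (Om : set 'rV[R]_N) (g : 'rV[R]_N -> \bar R) : \bar R :=
  iint (fun x => if `[< Om x >] then g x else 0%E).

Definition integrableOn (N : nat) (Om : set 'rV[R]_N) (h : 'rV[R]_N -> R) : Prop :=
  (intOn Om (fun x => `|h x|%:E) < +oo)%E.

Definition sintOn (N : nat) (Om : set 'rV[R]_N) (h : 'rV[R]_N -> R) : \bar R :=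
  (intOn Om (fun x => (Num.max (h x) 0)%:E)
   - intOn Om (fun x => (Num.max (- h x) 0)%:E))%E.

Definition evec (N : nat) (i : 'I_N) : 'rV[R]_N := delta_mx 0 i.

Definition partial (N : nat) (i : 'I_N) (phi : 'rV[R]_N -> R) : 'rV[R]_N -> R :=
  fun x => derive phi x (evec i).

Definition iter_partial (N : nat) (s : seq 'I_N) (phi : 'rV[R]_N -> R) :=
  foldr (@partial N) phi s.

Definition smooth (N : nat) (phi : 'rV[R]_N -> R) : Prop :=
  forall s : seq 'I_N,
    continuous (iter_partial s phi) /\
    forall (i : 'I_N) (x : 'rV[R]_N), derivable (iter_partial s phi) x (evec i).

Definition test_fun (N : nat) (Om : set 'rV[R]_N) (phi : 'rV[R]_N -> R) : Prop :=
  smooth phi /\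
  exists K : set 'rV[R]_N, [/\ compact K, K `<=` Om & forall x, ~ K x -> phi x = 0].

Definition sqnorm2 (N : nat) (Om : set 'rV[R]_N) (f : 'rV[R]_N -> R) : \bar R :=
  intOn Om (fun x => (f x ^+ 2)%:E).

(* f is (a Borel representative of) an element of L^2(Om) *)
Definition L2 (N : nat) (Om : set 'rV[R]_N) (f : 'rV[R]_N -> R) : Prop :=
  borel_fun f /\ (sqnorm2 Om f < +oo)%E.

Definition weak_grad (N : nat) (Om : set 'rV[R]_N) (f : 'rV[R]_N -> R)
    (g : 'I_N -> 'rV[R]_N -> R) : Prop :=
  (forall i, borel_fun (g i)) /\
  forall (i : 'I_N) (phi : 'rV[R]_N -> R), test_fun Om phi ->
    [/\ integrableOn Om (fun x => f x * partial i phi x),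
        integrableOn Om (fun x => g i x * phi x) &
        sintOn Om (fun x => f x * partial i phi x)
        = (- sintOn Om (fun x => (g i x * phi x)%R))%E].

Definition W12 (N : nat) (Om : set 'rV[R]_N) (f : 'rV[R]_N -> R) : Prop :=
  L2 Om f /\ exists g, weak_grad Om f g /\ forall i, L2 Om (g i).

(* Q(f) = int_Om |grad f|^2 if f in W^{1,2}(Om), +oo otherwise *)
Definition Qform (N : nat) (Om : set 'rV[R]_N) (f : 'rV[R]_N -> R) : \bar R :=
  if `[< L2 Om f >] then
    ereal_inf [set intOn Om (fun x => (\sum_i g i x ^+ 2)%:E) | g in weak_grad Om f]
  else +oo%E.

Definition W12norm (N : nat) (Om : set 'rV[R]_N) (f : 'rV[R]_N -> R) : \bar R :=
  ((sqnorm2 Om f + Qform Om f) `^ (2^-1))%E.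

Definition Lqnorm (N : nat) (q : R) (Om : set 'rV[R]_N) (f : 'rV[R]_N -> R) : \bar R :=
  ((intOn Om (fun x => (`|f x| `^ q)%:E)) `^ (q^-1))%E.

Definition lincomb (N n : nat) (c : 'I_n -> R) (F : 'I_n -> 'rV[R]_N -> R) :=
  fun x => \sum_i c i * F i x.

Definition L2_indep (N n : nat) (Om : set 'rV[R]_N) (F : 'I_n -> 'rV[R]_N -> R) :=
  forall c : 'I_n -> R, sqnorm2 Om (lincomb c F) = 0%E -> forall i, c i = 0.

Definition mu_span (N n : nat) (Om : set 'rV[R]_N) (F : 'I_n -> 'rV[R]_N -> R) :=
  ereal_sup [set (Qform Om (lincomb c F) * ((fine (sqnorm2 Om (lincomb c F)))^-1)%:E)%E
            | c in [set c : 'I_n -> R | sqnorm2 Om (lincomb c F) <> 0%E]].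

Definition mu (N : nat) (n : nat) (Om : set 'rV[R]_N) : \bar R :=
  ereal_inf [set mu_span Om F
            | F in [set F : 'I_n.+1 -> 'rV[R]_N -> R |
                      (forall i, L2 Om (F i)) /\ L2_indep Om F]].

Definition region (N : nat) (Om : set 'rV[R]_N) : Prop :=
  [/\ open Om, connected Om & Om !=set0].

Definition boundary (N : nat) (A : set 'rV[R]_N) := closure A `\` interior A.

Definition edist (N : nat) (x y : 'rV[R]_N) : R :=
  Num.sqrt (\sum_i (x 0 i - y 0 i) ^+ 2).

Definition dist_bd (N : nat) (Om : set 'rV[R]_N) (x : 'rV[R]_N) : \bar R :=
  ereal_inf [set (edist x y)%:E | y in boundary Om].

Definition strip (N : nat) (Om : set 'rV[R]_N) (eps : R) : set 'rV[R]_N :=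
  [set x | Om x /\ (dist_bd Om x <= eps%:E)%E].

Definition minkowski_dim (N : nat) (Om : set 'rV[R]_N) : \bar R :=
  ereal_inf [set l%:E | l in [set l : R | 0 < l /\
     (limf_esup (fun e : R => (lmeas (strip Om e) * ((e `^ (N%:R - l))^-1)%:E)%E)
                (0^'+) < +oo)%E]].

End NeumannDefs.

(* Main.v *)
(* Write lambda for mu_n(Om1) and A for the resolvent of H_1 + 1, obtained from
   the Riesz representation theorem.  By Cauchy-Schwarz, A does not increase the
   Rayleigh quotient of a function.  The Sobolev embedding and Hoelder's inequality
   give int_E u^2 <= c |E|^(1-2/q) ||u||_{W^{1,2}}^2 for all E in Om1.  Testing the
   equation of A h against truncations of A h and iterating over levels, as in
   Stampacchia's method, this improves int_E h^2 <= C |E|^s to a similar bound on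
   A h with a larger exponent, so that after j steps A^j maps L^2 to bounded
   functions.  No compactness and no eigenfunctions are needed: if the span L of a
   family is nearly optimal for lambda, then so is A^j L, and each u = A^j h
   satisfies int_E u^2 <= K ||h||^2 |E| <= C |E| int_Om1 u^2.  Restricting A^j L to
   Om2, and taking E = Om1 \ Om2, the numerators of the Rayleigh quotients do not
   grow, while the denominators lose at most the factor 1 - C |E|.
   The second part follows, since Om1 \ Om2 lies in the strip, whose measure is
   O(eps^sigma) by the definition of the Minkowski dimension. *)
Require Import Defs.
From HB Require Import structures.
From mathcomp Require Import all_boot all_order all_algebra.
From mathcomp Require Import all_classical all_reals all_analysis.
From mathcomp Require Import measurable_realfun.
From mathcomp Require Import ring lra.
Set Implicit Arguments. Unset Strict Implicit. Unset Printing Implicit Defensive.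
Import Order.TTheory GRing.Theory Num.Theory.
Import numFieldNormedType.Exports.
Local Open Scope classical_set_scope.
Local Open Scope ring_scope.

(** * Riesz representation for a complete semi-inner product *)

(** Put theta = 1 - 2/q, the gain in the Sobolev bound. The iteration over levels makes A h bounded
    only if int_E h^2 <= C |E|^s with s > 1 - 2 theta: the measures of the superlevel sets must
    satisfy a recursion whose right exponent s + theta exceeds the left one 1 - theta. A general L^2
    function only offers s = 0, and theta is small when q is near 2. Hence the preliminary steps,
    each multiplying the gap 1 - s by (1 - theta)/(1 + theta); how many are needed depends on q
    alone. The other obstacle is that int_E u^2 must be bounded by the norm of u = A^j h and not by
    that of h, while A may shrink norms. On a span whose Rayleigh quotients for H_1 + 1 are at most
    1 + L, one application costs at most the factor (1 + L)^2 in the squared norm, so the constants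
    depend on mu_n(Om1) but not on the span or on Om2. Functions are Borel functions and not
    classes, so all inner products are only semidefinite. *)

Lemma discriminant_le (R : realType) (a c d : R) :
  (forall t, 0 <= c + 2 * t * a + t ^+ 2 * d) -> 0 <= d -> a ^+ 2 <= c * d.
Proof.
move=> H d0.
have [dE|dn0] := eqVneq d 0.
  have [->|an0] := eqVneq a 0; first by rewrite dE mulr0 expr0n.
  (* With [d = 0] the quadratic is affine in [t]; this [t] gives it the value -1, so [a] cannot be
     nonzero. *)
  have := H (- (c + 1) / (2 * a)).
  rewrite dE mulr0 addr0.
  have -> : 2 * (- (c + 1) / (2 * a)) * a = - (c + 1) by field.
  lra.
have dp : 0 < d by rewrite lt_neqAle eq_sym dn0.
have := H (- a / d).
have -> : c + 2 * (- a / d) * a + (- a / d) ^+ 2 * d = c - a ^+ 2 / d by field.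
by rewrite subr_ge0 ler_pdivrMr.
Qed.

Section SemiInnerProduct.
Context {R : realType} {V : lmodType R}.
Variables (S : set V) (b : V -> V -> R).
Hypothesis S0 : S 0.
Hypothesis Slin : forall a u v, S u -> S v -> S (a *: u + v).
Hypothesis bC : forall u v, S u -> S v -> b u v = b v u.
Hypothesis blin : forall a u v w, S u -> S v -> S w ->
  b (a *: u + v) w = a * b u w + b v w.
Hypothesis b_ge0 : forall u, S u -> 0 <= b u u.

Lemma form_linr a u v w : S u -> S v -> S w ->
  b w (a *: u + v) = a * b w u + b w v.
Proof.
move=> Su Sv Sw; rewrite (bC Sw) ?blin ?(bC Su Sw) ?(bC Sv Sw)//.
exact: Slin.
Qed.

Lemma form_quad u v (t : R) : S u -> S v ->
  b (t *: u + v) (t *: u + v) = b v v + 2 * t * b u v + t ^+ 2 * b u u.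
Proof.
move=> Su Sv; have St := Slin t Su Sv.
by rewrite blin// !form_linr// (bC Sv Su); ring.
Qed.

Lemma form_CauchySchwarz u v : S u -> S v -> b u v ^+ 2 <= b u u * b v v.
Proof.
move=> Su Sv; rewrite mulrC; apply: discriminant_le => [t|]; last exact: b_ge0.
by rewrite -form_quad//; apply: b_ge0; exact: Slin.
Qed.

(** Completeness is asked only for sequences with geometrically decaying increments: minimizing
    sequences can be chosen of this kind, and L^2 delivers this form without passing to
    subsequences. *)
Hypothesis complete : forall (w : nat -> V) (C : R), (forall n, S (w n)) ->
  (forall n, b (w n.+1 - w n) (w n.+1 - w n) <= C * 4^-1 ^+ n) ->
  exists2 w', S w' & (fun n => b (w n - w') (w n - w')) @ \oo --> 0.

(** The representer minimizes [J v = b v v - 2 * l v] over [S]. The parallelogram identity turns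
    near-minimality into closeness, so a minimizing sequence converges, and the first-order
    condition survives in the limit. *)
Lemma form_representation (l : V -> R) (K : R) :
  (forall a u v, S u -> S v -> l (a *: u + v) = a * l u + l v) ->
  (forall v, S v -> l v ^+ 2 <= K * b v v) ->
  exists2 w, S w & forall v, S v -> b w v = l v.
Proof.
move=> llin lK.
have Ssub u v : S u -> S v -> S (u - v).
  by move=> Su Sv; rewrite addrC -scaleN1r; exact: Slin.
pose J v := b v v - 2 * l v.
(* A negative [K] forces [b v v = 0] and [l v = 0] on all of [S], so 0 represents [l]. *)
have [K0|K0] := ltP K 0.
  exists 0 => // v Sv.
  have bv0 w : S w -> b w w = 0.
    move=> Sw; have := lK _ Sw; have := sqr_ge0 (l w); have := b_ge0 Sw; nra.
  have -> : l v = 0.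
    by have := lK _ Sv; rewrite bv0// mulr0 => ?; apply/eqP; rewrite -sqrf_eq0 eq_le sqr_ge0 andbT.
  have := form_CauchySchwarz S0 Sv; rewrite (bv0 v)// mulr0 => ?.
  by apply/eqP; rewrite -sqrf_eq0 eq_le sqr_ge0 andbT.
have JK v : S v -> - K <= J v.
  move=> Sv; rewrite /J; have := lK _ Sv; have bv := b_ge0 Sv => lKv.
  rewrite lerNl opprB lerBlDr.
  have [l0|l0] := leP (l v) 0; first by lra.
  have : (2 * l v) ^+ 2 <= (K + b v v) ^+ 2.
    by have := sqr_ge0 (K - b v v); nra.
  by rewrite ler_sqr ?nnegrE; lra.
pose A := [set J v | v in S].
have Ainf : has_inf A.
  split; first by exists (J 0), 0.
  by exists (- K) => _ [v Sv <-]; exact: JK.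
pose I := inf A.
have IJ v : S v -> I <= J v.
  by move=> Sv; apply: ge_inf; [case: Ainf|exists v].
have p4 n : 0 < 4^-1 ^+ n :> R by rewrite exprn_gt0// invr_gt0.
have /choice[w wP] : forall n, exists w, S w /\ J w <= I + 4^-1 ^+ n.
  move=> n; have [_ [v Sv <-] h] := inf_adherent (p4 n) Ainf.
  by exists v; split => //; exact: ltW.
have Sw n : S (w n) by case: (wP n).
have Jq u v : S u -> S v ->
    b (u - v) (u - v) = 2 * J u + 2 * J v - 4 * J (2^-1 *: (u + v)).
  move=> Su Sv; rewrite /J.
  have -> : u - v = (-1) *: v + u by rewrite scaleN1r addrC.
  rewrite form_quad//.
  have Suv : S (u + v) by have := Slin 1 Su Sv; rewrite scale1r.
  have -> : 2^-1 *: (u + v) = 2^-1 *: (u + v) + 0 by rewrite addr0.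
  rewrite form_quad// llin//.
  have E1 : b (u + v) (u + v) = b v v + 2 * b u v + b u u.
    by have := form_quad 1 Su Sv; rewrite scale1r => ->; ring.
  have E2 : b (u + v) 0 = 0.
    by have := form_linr (-1) S0 S0 Suv; rewrite scaler0 addr0; lra.
  have E3 : b 0 0 = 0.
    by have := form_linr (-1) S0 S0 S0; rewrite scaler0 addr0; lra.
  have E4 : l 0 = 0.
    by have := llin (-1) 0 0 S0 S0; rewrite scaler0 addr0; lra.
  have E5 : l (u + v) = l u + l v by have := llin 1 u v Su Sv; rewrite scale1r mul1r.
  by rewrite E1 E2 E3 E4 E5 (bC Sv Su); field.
(* The parallelogram identity bounds the increment by [2 * 4^-1 ^+ n.+1 + 2 * 4^-1 ^+ n], which is
   below 4 times [4^-1 ^+ n]. *)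
have [|w' Sw' cw'] := complete (C := 4) Sw.
  move=> n; rewrite Jq//.
  have Sm : S (2^-1 *: (w n.+1 + w n)).
    rewrite -[X in S X]addr0; apply: Slin => //.
    by have := Slin 1 (Sw n.+1) (Sw n); rewrite scale1r.
  have := IJ _ Sm; have [_ h1] := wP n; have [_ h2] := wP n.+1.
  by have := p4 n; rewrite exprS in h2; lra.
exists w' => // v Sv.
(* [J (t *: v + w n) - I] is nonnegative for every [t], and its constant term is at most
   [4^-1 ^+ n]; the discriminant then bounds the linear coefficient. *)
have bound n : (b (w n) v - l v) ^+ 2 <= 4^-1 ^+ n * b v v.
  apply: discriminant_le => [t|]; last exact: b_ge0.
  have := IJ _ (Slin t Sv (Sw n)); have [_ h] := wP n.
  rewrite /J in h *; rewrite form_quad// llin// (bC Sv (Sw n)); lra.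
have bound' n : (b (w n) v - b w' v) ^+ 2 <=
    b (w n - w') (w n - w') * b v v.
  have -> : b (w n) v - b w' v = b (w n - w') v.
    have -> : w n - w' = (-1) *: w' + w n by rewrite scaleN1r addrC.
    by rewrite blin//; ring.
  by apply: form_CauchySchwarz => //; exact: Ssub.
have tot n : (b w' v - l v) ^+ 2 <=
    2 * (4^-1 ^+ n * b v v) + 2 * (b (w n - w') (w n - w') * b v v).
  apply: (@le_trans _ _ (2 * (b (w n) v - l v) ^+ 2 + 2 * (b (w n) v - b w' v) ^+ 2)).
    have := sqr_ge0 ((b (w n) v - l v) + (b (w n) v - b w' v)); nra.
  by apply: lerD; rewrite ler_pM2l.
have c0 : (fun n => 2 * (4^-1 ^+ n * b v v) +
     2 * (b (w n - w') (w n - w') * b v v)) @ \oo --> (0 : R).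
  rewrite [X in _ --> X](_ : _ = 2 * (0 * b v v) + 2 * (0 * b v v)); last by ring.
  apply: cvgD; (apply: cvgM; [exact: cvg_cst|]); apply: cvgM; try exact: cvg_cst.
    by apply: cvg_expr; rewrite ger0_norm ?invr_ge0// invf_lt1// ltr1n.
  exact: cw'.
have : (b w' v - l v) ^+ 2 <= 0.
  by apply: (cvgr_to_ge c0); exact: nearW.
by rewrite le_eqVlt ltNge sqr_ge0 orbF sqrf_eq0 subr_eq0 => /eqP.
Qed.

End SemiInnerProduct.

(** * Square integrable functions *)

Section SquareIntegrable.
Context {d : measure_display} {T : measurableType d} {R : realType}.
Variable m : {measure set T -> \bar R}.

(** Measurability is on the whole space although the integral is over [D], as in [L2]: the same
    function can then be viewed on any measurable subdomain. *)
Definition sqint (D : set T) (f : T -> R) :=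
  measurable_fun setT f /\ (\int[m]_(x in D) (f x ^+ 2)%:E < +oo)%E.

Definition ip (D : set T) (f g : T -> R) : R := \int[m]_(x in D) (f x * g x).

Variable D : set T.
Hypothesis mD : measurable D.

Lemma sqint_integrable f : sqint D f ->
  m.-integrable D (fun x => (f x ^+ 2)%:E).
Proof.
move=> [mf f2]; apply/integrableP; split.
  by apply/measurable_EFinP; apply: measurable_funX; exact: measurable_funTS.
by under eq_integral do rewrite gee0_abs ?lee_fin ?sqr_ge0//.
Qed.

Lemma sqintM_integrable f g : sqint D f -> sqint D g ->
  m.-integrable D (fun x => (f x * g x)%:E).
Proof.
move=> sf sg; have [[mf f2] [mg g2]] := (sf, sg).
apply: (@le_integrable _ _ _ _ _ mD _ (fun x => (f x ^+ 2)%:E + (g x ^+ 2)%:E)%E).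
- by apply/measurable_EFinP; apply: measurable_funM; exact: measurable_funTS.
- move=> x Dx; rewrite -EFinD !abse_EFin lee_fin.
  rewrite (ger0_norm (addr_ge0 (sqr_ge0 _) (sqr_ge0 _))) ler_norml.
  have := sqr_ge0 (f x + g x); have := sqr_ge0 (f x - g x).
  have := sqr_ge0 (f x); have := sqr_ge0 (g x); nra.
- by apply: integrableD => //; exact: sqint_integrable.
Qed.

Lemma sqint_lin a f g : sqint D f -> sqint D g -> sqint D (a *: f + g).
Proof.
move=> sf sg; have [[mf f2] [mg g2]] := (sf, sg); split.
  apply: measurable_funD => //.
  by apply: measurable_funM => //; exact: measurable_cst.
have I1 := integrableZl mD (2 * a ^+ 2) (sqint_integrable sf).
have I2 := integrableZl mD 2 (sqint_integrable sg).
have /integrableP[_] := integrableD mD I1 I2.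
apply: le_lt_trans; apply: ge0_le_integral => //.
- by move=> x _; rewrite lee_fin sqr_ge0.
- apply/measurable_EFinP; apply: measurable_funX; apply: measurable_funTS.
  apply: measurable_funD => //.
  by apply: measurable_funM => //; exact: measurable_cst.
- apply: measurableT_comp => //.
  by apply: emeasurable_funD; [have /integrableP[] := I1|have /integrableP[] := I2].
- move=> x Dx /=; rewrite lee_fin.
  apply: le_trans (ler_norm _).
  change ((a * f x + g x) ^+ 2 <= 2 * a ^+ 2 * f x ^+ 2 + 2 * g x ^+ 2).
  have := sqr_ge0 (a * f x - g x); nra.
Qed.

Lemma sqint0 : sqint D 0.
Proof.
split; first exact: measurable_cst.
by under eq_integral do rewrite expr0n /=; rewrite integral0.
Qed.

Lemma sqintD f g : sqint D f -> sqint D g -> sqint D (f \+ g).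
Proof. by move=> sf /(sqint_lin 1 sf); rewrite scale1r. Qed.

Lemma sqintZ a f : sqint D f -> sqint D (a *: f).
Proof. by move=> /(sqint_lin a)/(_ sqint0); rewrite addr0. Qed.

Lemma sqintB f g : sqint D f -> sqint D g -> sqint D (f - g).
Proof. by move=> sf sg; rewrite addrC -scaleN1r; exact: sqint_lin. Qed.

Lemma sqint_sum I (r : seq I) (F : I -> T -> R) :
  (forall i, sqint D (F i)) -> sqint D (\sum_(i <- r) F i).
Proof.
move=> sF; elim: r => [|i r IH]; first by rewrite big_nil; exact: sqint0.
by rewrite big_cons; exact: sqintD.
Qed.

Lemma le_sqint (f g : T -> R) : measurable_fun setT f -> sqint D g ->
  (forall x, D x -> `|f x| <= `|g x|) -> sqint D f.
Proof.
move=> mf [mg g2] fg; split => //; apply: le_lt_trans g2.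
apply: ge0_le_integral => //.
- by move=> x _; rewrite lee_fin sqr_ge0.
- by apply/measurable_EFinP; apply: measurable_funX; exact: measurable_funTS.
- by apply/measurable_EFinP; apply: measurable_funX; exact: measurable_funTS.
- move=> x Dx; rewrite lee_fin -(real_normK (num_real (f x))) -(real_normK (num_real (g x))).
  by rewrite ler_sqr ?nnegrE//; exact: fg.
Qed.

Lemma sqint_bounded (f : T -> R) M : (m D < +oo)%E -> measurable_fun setT f ->
  (forall x, `|f x| <= M) -> sqint D f.
Proof.
move=> Dfin mf fM; apply: (@le_sqint _ (cst M)) => //; last first.
  by move=> x _ /=; rewrite (le_trans (fM x))// ler_norm.
split; first exact: measurable_cst.
by rewrite (integral_cst m mD (M ^+ 2)%:E)// lte_mul_pinfty// lee_fin sqr_ge0.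
Qed.

Lemma ipC f g : ip D f g = ip D g f.
Proof. by apply: eq_Rintegral => x _; rewrite mulrC. Qed.

Lemma ip_linl a f g h : sqint D f -> sqint D g -> sqint D h ->
  ip D (a *: f + g) h = a * ip D f h + ip D g h.
Proof.
move=> sf sg sh; rewrite /ip -RintegralZl//; last exact: sqintM_integrable.
rewrite -RintegralD//.
- by apply: eq_Rintegral => x _; rewrite mulrA -mulrDl.
- exact: (integrableZl mD a (sqintM_integrable sf sh)).
- exact: sqintM_integrable.
Qed.

Lemma ip_ge0 f : 0 <= ip D f f.
Proof. by apply: Rintegral_ge0 => x _; rewrite -expr2 sqr_ge0. Qed.

Lemma EFin_ip f g : sqint D f -> sqint D g ->
  (ip D f g)%:E = (\int[m]_(x in D) (f x * g x)%:E)%E.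
Proof.
by move=> sf sg; rewrite fineK//; apply: integrable_fin_num => //; exact: sqintM_integrable.
Qed.

Lemma EFin_ip_sqr f : sqint D f ->
  (ip D f f)%:E = (\int[m]_(x in D) (f x ^+ 2)%:E)%E.
Proof. by move=> sf; rewrite EFin_ip. Qed.

Lemma ip_CauchySchwarz f g : sqint D f -> sqint D g ->
  ip D f g ^+ 2 <= ip D f f * ip D g g.
Proof.
apply: (@form_CauchySchwarz R (T -> R : lmodType R) (sqint D) (ip D)) => //.
- by move=> *; exact: sqint_lin.
- by move=> *; exact: ipC.
- by move=> *; exact: ip_linl.
- by move=> *; exact: ip_ge0.
Qed.

End SquareIntegrable.

(** Cauchy-Schwarz with weights [2 ^+ k], whose reciprocals sum to at most [2 * 2^-1 ^+ n] from
    index [n] on. It controls the distance of two terms of a sequence by a weighted sum of squared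
    increments, with a rate in [n]. *)
Lemma sum_sqr_dyadic (R : realType) (a : nat -> R) n p :
  (\sum_(n <= k < n + p) a k) ^+ 2 <=
  2 * 2^-1 ^+ n * \sum_(n <= k < n + p) 2 ^+ k * a k ^+ 2.
Proof.
elim: p n => [|p IH] n; first by rewrite addn0 !big_geq// expr0n/= mulr0.
have np : (n < n + p.+1)%N by rewrite -addSnnS leq_addr.
rewrite !(big_ltn np) -addSnnS.
have := IH n.+1; set S := \sum_(_ <= _ < _) _; set S' := \sum_(_ <= _ < _) _.
rewrite (exprS 2^-1 n) => h.
have {}h : S ^+ 2 <= 2^-1 ^+ n * S' by apply: (le_trans h); rewrite mulrA divff// mul1r.
have -> : 2 * 2^-1 ^+ n * (2 ^+ n * a n ^+ 2 + S') =
    2 * a n ^+ 2 + 2 * (2^-1 ^+ n * S').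
  have : 2^-1 ^+ n * 2 ^+ n = 1 :> R by rewrite -exprMn mulVf// expr1n.
  by move=> e; transitivity (2 * (2^-1 ^+ n * 2 ^+ n) * a n ^+ 2 + 2 * (2^-1 ^+ n * S'));
    [ring|rewrite e; ring].
move: h; set Z := _ * S' => h.
have := sqr_ge0 (a n - S); nra.
Qed.

Section L2Complete.
Context {d : measure_display} {T : measurableType d} {R : realType}.
Variable m : {measure set T -> \bar R}.
Variable D : set T.
Hypothesis mD : measurable D.

(** The weighted series [G] of squared increments has integral at most [2 * C], so it is finite
    almost everywhere, and there the sequence is Cauchy with squared error [2 * 2^-1 ^+ n * G].
    Integrating this pointwise estimate gives the convergence. *)
Lemma sqint_complete (f : nat -> T -> R) (C : R) :
  (forall n, sqint m D (f n)) ->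
  (forall n, ip m D (f n.+1 - f n) (f n.+1 - f n) <= C * 4^-1 ^+ n) ->
  exists2 g, sqint m D g & (fun n => ip m D (f n - g) (f n - g)) @ \oo --> 0.
Proof.
move=> sf fC.
have mf n : measurable_fun setT (f n) by case: (sf n).
(* The weight leaves the integrals summable: [4^-1 ^+ k] becomes [2^-1 ^+ k]. *)
pose u k x : R := 2 ^+ k * ((f k.+1 - f k) x) ^+ 2.
have u0 k x : 0 <= u k x by rewrite mulr_ge0 ?sqr_ge0// exprn_ge0.
have mu_ k : measurable_fun setT (u k).
  apply: measurable_funM => //; apply: measurable_funX.
  exact: measurable_funB.
pose G x : \bar R := (\sum_(0 <= k <oo) (u k x)%:E)%E.
have G0 x : (0 <= G x)%E by apply: nneseries_ge0 => k _ _; rewrite lee_fin.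
have mG : measurable_fun setT G.
  apply: ge0_emeasurable_sum => [k x _ _|k _]; first by rewrite lee_fin.
  exact/measurable_EFinP.
have C0 : 0 <= C.
  by have := fC 0%N; rewrite expr0 mulr1; apply: le_trans; exact: ip_ge0.
have intu k : (\int[m]_(x in D) (u k x)%:E <= (C * 2^-1 ^+ k)%:E)%E.
  rewrite /u; under eq_integral do rewrite EFinM.
  rewrite ge0_integralZl_EFin//; last 2 first.
    by move=> x _; rewrite lee_fin sqr_ge0.
    apply/measurable_EFinP/measurable_funX/measurable_funTS.
    exact: measurable_funB.
  rewrite -EFin_ip_sqr//; last exact: sqintB.
  rewrite -EFinM lee_fin.
  apply: le_trans (ler_wpM2l _ (fC k)) _; first by rewrite exprn_ge0.
  rewrite mulrCA -exprMn.
  by have -> : 2 / 4 = 2^-1 :> R by lra.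
have intG : (\int[m]_(x in D) G x <= (2 * C)%:E)%E.
  rewrite integral_nneseries//; last 2 first.
    by move=> k; apply/measurable_EFinP; exact: measurable_funTS.
    by move=> k x _; rewrite lee_fin.
  apply: lime_le.
    by apply: is_cvg_nneseries => k _ _; apply: integral_ge0 => x _; rewrite lee_fin.
  apply: nearW => n.
  apply: (@le_trans _ _ (\sum_(0 <= k < n) (C * 2^-1 ^+ k)%:E)%E).
    by apply: lee_sum => k _.
  rewrite sumEFin lee_fin -mulr_sumr mulrC ler_wpM2r//.
  have -> : \sum_(0 <= k < n) 2^-1 ^+ k = 2 - 2 * 2^-1 ^+ n :> R.
    elim: n => [|n IH]; first by rewrite big_geq// expr0 mulr1 subrr.
    by rewrite big_nat_recr//= IH exprS; lra.
  by rewrite lerBlDr lerDl mulr_ge0// exprn_ge0// invr_ge0.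
pose D0 : set T := [set x | (G x < +oo)%E].
have mD0 : measurable D0.
  by rewrite /D0 -[X in measurable X]setTI; exact: emeasurable_fun_infty_o.
have GE x : D0 x -> G x = (fine (G x))%:E.
  by move=> Dx; rewrite fineK// ge0_fin_numE.
have key x n p : D0 x -> (f (n + p)%N x - f n x) ^+ 2 <=
    2 * 2^-1 ^+ n * fine (G x).
  move=> Dx; have -> : f (n + p)%N x - f n x =
      \sum_(n <= k < n + p) (f k.+1 x - f k x).
    by rewrite telescope_sumr// leq_addr.
  apply: (le_trans (sum_sqr_dyadic _ _ _)).
  apply: ler_wpM2l; first by rewrite mulr_ge0// exprn_ge0// invr_ge0.
  rewrite -lee_fin -GE// -sumEFin.
  apply: (@le_trans _ _ (\sum_(0 <= k < n + p) (u k x)%:E)%E).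
    rewrite (@big_cat_nat _ _ _ n 0 (n + p))//= ?leq_addr//.
    by rewrite leeDr// sume_ge0// => k _; rewrite lee_fin.
  by apply: nneseries_lim_ge => k _ _; rewrite lee_fin.
(* Cutting off where [G] is infinite makes the sequence converge at every point, so that the limit
   is measurable on the whole space, as [sqint] requires. *)
pose h n x := f n x * \1_D0 x.
have hcvg x : cvgn (h ^~ x).
  have [Dx|nDx] := pselect (D0 x); last first.
    rewrite (_ : h ^~ x = cst 0); first exact: is_cvg_cst.
    by apply/funext => n; rewrite /h indicE memNset//= mulr0.
  rewrite (_ : h ^~ x = f ^~ x); last first.
    by apply/funext => n; rewrite /h indicE mem_set//= mulr1.
  apply: cauchy_cvg; apply: cauchy_exP => e e0.
  have : (fun n => 2 * 2^-1 ^+ n * fine (G x)) @ \oo --> (0 : R).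
    rewrite [X in _ --> X](_ : _ = 2 * 0 * fine (G x)); last by rewrite mulr0 mul0r.
    apply: cvgM; last exact: cvg_cst.
    apply: cvgM; first exact: cvg_cst.
    by apply: cvg_expr; rewrite ger0_norm ?invr_ge0// invf_lt1// ltr1n.
  move=> /cvgrPdist_lt/(_ (e ^+ 2)); rewrite exprn_gt0// => /(_ isT) [n _ hn].
  exists (f n x), n => // p /= np.
  rewrite -ball_normE/= -(@ltr_pXn2r _ 2%N)// ?nnegrE ?(ltW e0)//.
  rewrite real_normK ?num_real//.
  rewrite -sqrrN opprB -(subnKC np).
  apply: (le_lt_trans (key x n (p - n)%N Dx)).
  have := hn n (leqnn n); rewrite sub0r normrN; apply: le_lt_trans; exact: ler_norm.
pose g x := limn (h ^~ x).
have mg : measurable_fun setT g.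
  apply: (@measurable_fun_cvg _ _ _ _ h) => [n|x _]; last exact: hcvg.
  by apply: measurable_funM => //; exact: measurable_indic.
have gle n x : D0 x -> ((f n - g) x) ^+ 2 <= 2 * 2^-1 ^+ n * fine (G x).
  move=> Dx.
  have : (fun p => (f p x - f n x) ^+ 2) @ \oo --> (g x - f n x) ^+ 2.
    have hg : f ^~ x @ \oo --> g x.
      rewrite (_ : f ^~ x = h ^~ x); first exact: hcvg.
      by apply/funext => k; rewrite /h indicE mem_set//= mulr1.
    by rewrite expr2; apply: cvgM; apply: cvgB => //; exact: cvg_cst.
  move=> /cvgr_to_le gl.
  rewrite -[X in X ^+ 2]/(f n x - g x) -sqrrN opprB; apply: gl.
  by exists n => // p /= np; rewrite -(subnKC np); exact: key.
have aeD : {ae m, forall x, D x -> D0 x}.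
  have : m.-integrable D G.
    apply/integrableP; split; first exact: measurable_funTS.
    under eq_integral do rewrite gee0_abs//.
    by apply: le_lt_trans intG _; rewrite ltry.
  move=> /(integrable_ae mD); apply: filterS => x /[apply].
  by rewrite ge0_fin_numE.
have main n : (\int[m]_(x in D) (((f n - g) x) ^+ 2)%:E <=
    (4 * C * 2^-1 ^+ n)%:E)%E.
  apply: (@le_trans _ _ (\int[m]_(x in D) ((2 * 2^-1 ^+ n)%:E * G x))%E).
    apply: ae_ge0_le_integral => //.
    - by move=> x _; rewrite lee_fin sqr_ge0.
    - apply/measurable_EFinP/measurable_funX/measurable_funTS.
      exact: measurable_funB.
    - by move=> x _; rewrite mule_ge0// lee_fin mulr_ge0// exprn_ge0// invr_ge0.
    - by apply: measurable_funTS; exact: measurable_funeM.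
    - move: aeD; apply: filterS => x /[apply] D0x.
      by rewrite GE// -EFinM lee_fin; exact: gle.
  rewrite ge0_integralZl_EFin//; last exact: measurable_funTS.
  apply: le_trans (lee_wpmul2l _ intG) _.
    by rewrite lee_fin mulr_ge0// exprn_ge0// invr_ge0.
  by rewrite -EFinM lee_fin; lra.
have sfg n : sqint m D (f n - g).
  split; first exact: measurable_funB.
  by apply: le_lt_trans (main n) _; rewrite ltry.
have sg : sqint m D g.
  have := sqintB mD (sf 0%N) (sfg 0%N).
  by rewrite opprB addrC subrK.
exists g => //.
apply: (@squeeze_cvgr _ _ _ _ (cst 0) (fun n => 4 * C * 2^-1 ^+ n)).
- by apply: nearW => n; rewrite ip_ge0/= -lee_fin EFin_ip_sqr.
- exact: cvg_cst.
- rewrite [X in _ --> X](_ : _ = 4 * C * 0); last by rewrite mulr0.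
  apply: cvgM; first exact: cvg_cst.
  by apply: cvg_expr; rewrite ger0_norm ?invr_ge0// invf_lt1// ltr1n.
Qed.

End L2Complete.

(** * Smooth truncations and the Stampacchia iteration *)

Section SmoothTruncation.
Context {R : realType}.
Implicit Types k e s : R.

Definition pospart k s : R := Num.max (s - k) 0.
(* C^1 substitute for [pospart k], recovered as [e] tends to 0; [dstrunc] is its
   derivative.  A C^1 function with Lipschitz derivative keeps the chain rule in
   W^{1,2} elementary. *)
Definition strunc k e s : R := Num.sqrt (pospart k s ^+ 2 + e ^+ 2) - e.
Definition dstrunc k e s : R :=
  pospart k s / Num.sqrt (pospart k s ^+ 2 + e ^+ 2).

Lemma pospart_ge0 k s : 0 <= pospart k s.
Proof. by rewrite le_max lexx orbT. Qed.

Lemma pospart_eq0 k s : s <= k -> pospart k s = 0.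
Proof. by move=> sk; apply/max_idPr; rewrite subr_le0. Qed.

Lemma pospart_ge k s : s - k <= pospart k s.
Proof. by rewrite le_max lexx. Qed.

Lemma pospart_le_sqrt k e s :
  pospart k s <= Num.sqrt (pospart k s ^+ 2 + e ^+ 2).
Proof.
rewrite -[leLHS]ger0_norm ?pospart_ge0// -sqrtr_sqr ler_sqrt.
  by rewrite lerDl sqr_ge0.
by rewrite addr_ge0 ?sqr_ge0.
Qed.

Section positive.
Variables (k e : R).
Hypothesis e0 : 0 < e.

Lemma le_sqrt_strunc s : e <= Num.sqrt (pospart k s ^+ 2 + e ^+ 2).
Proof.
rewrite -[leLHS]gtr0_norm// -sqrtr_sqr ler_sqrt ?lerDr ?sqr_ge0//.
by rewrite addr_ge0 ?sqr_ge0.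
Qed.

Lemma sqrt_strunc_gt0 s : 0 < Num.sqrt (pospart k s ^+ 2 + e ^+ 2).
Proof. exact: lt_le_trans e0 (le_sqrt_strunc s). Qed.

Lemma strunc_ge0 s : 0 <= strunc k e s.
Proof. by rewrite subr_ge0 le_sqrt_strunc. Qed.

Lemma strunc_le_pospart s : strunc k e s <= pospart k s.
Proof.
have p0 := pospart_ge0 k s.
rewrite lerBlDr -[leRHS]ger0_norm ?addr_ge0 ?(ltW e0)// -sqrtr_sqr.
rewrite ler_sqrt ?sqr_ge0//; have := mulr_ge0 p0 (ltW e0); nra.
Qed.

Lemma pospart_le_strunc s : pospart k s <= strunc k e s + e.
Proof. by rewrite subrK pospart_le_sqrt. Qed.

Lemma strunc_eq0 s : s <= k -> strunc k e s = 0.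
Proof.
move=> sk; rewrite /strunc pospart_eq0// expr0n add0r sqrtr_sqr.
by rewrite gtr0_norm// subrr.
Qed.

(** At [s - k = e] the truncation equals [e] times sqrt 2 - 1; the fraction 1/3 comes from (4/3)^2
    <= 2. *)
Lemma strunc_gt s : e <= s - k -> e / 3 <= strunc k e s.
Proof.
move=> es; rewrite lerBrDr.
have -> : e / 3 + e = 4 / 3 * e by field.
rewrite -[leLHS]ger0_norm ?mulr_ge0 ?divr_ge0 ?(ltW e0)// -sqrtr_sqr ler_sqrt.
  have es' := le_trans es (pospart_ge k s); have := ler_pM (ltW e0) (ltW e0) es' es'; nra.
by rewrite addr_ge0 ?sqr_ge0.
Qed.

Lemma dstrunc_ge0 s : 0 <= dstrunc k e s.
Proof. by rewrite divr_ge0 ?pospart_ge0 ?sqrtr_ge0. Qed.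

Lemma dstrunc_le1 s : dstrunc k e s <= 1.
Proof. by rewrite ler_pdivrMr ?sqrt_strunc_gt0// mul1r pospart_le_sqrt. Qed.

End positive.
End SmoothTruncation.

(** Along the levels [dl * (1 - 2^-1 ^+ j)] the values of [a] are at most [A0 * rho ^+ j]. Halving
    the distance of levels costs a factor 4 at each step, and the surplus exponent [r - p] pays for
    it because rho^(r - p) = 1/4. Monotonicity of [a] carries the limit 0 to the terminal level
    [dl]. *)
Lemma stampacchia_iteration (R : realType) (a : R -> R) (A0 K p r : R) :
  0 < A0 -> 0 < K -> 0 < p -> p < r ->
  (forall k, 0 <= a k) -> {homo a : x y /~ x <= y} -> a 0 <= A0 ->
  (forall k l, 0 <= k -> k < l ->
     a l `^ p <= K / (l - k) ^+ 2 * a k `^ r) ->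
  let rho := 4^-1 `^ (r - p)^-1 in
  a (Num.sqrt (4 * K * A0 `^ (r - p) / rho `^ p)) = 0.
Proof.
move=> A00 K0 p0 pr a0 adec aA0 rec rho.
have rp : 0 < r - p by rewrite subr_gt0.
have rho0 : 0 < rho by rewrite powR_gt0// invr_gt0.
have rhorp : rho `^ (r - p) = 4^-1.
  by rewrite /rho -powRrM mulVf ?gt_eqF// powRr1// invr_ge0.
have rho1 : rho < 1.
  rewrite ltNge; apply/negP => r1.
  have := ge0_ler_powR (ltW rp) ler01 (ltW rho0) r1.
  by rewrite powR1 rhorp; lra.
set dd := 4 * K * _ / _; pose dl := Num.sqrt dd.
have dd0 : 0 < dd by rewrite divr_gt0 ?mulr_gt0 ?powR_gt0.
have dl0 : 0 < dl by rewrite sqrtr_gt0.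
have dlE : dl ^+ 2 = dd by rewrite sqr_sqrtr// ltW.
pose kk j := dl * (1 - 2^-1 ^+ j).
have h0 j : 0 < 2^-1 ^+ j :> R by rewrite exprn_gt0// invr_gt0.
have h1 j : 2^-1 ^+ j <= 1 :> R by rewrite exprn_ile1// invf_le1// ler1n.
have step j : a (kk j) <= A0 * rho ^+ j.
  elim: j => [|j IH]; first by rewrite /kk expr0 subrr mulr0 mulr1.
  have kj : kk j < kk j.+1.
    by rewrite /kk ltr_pM2l// exprS; have := h0 j; lra.
  have kj0 : 0 <= kk j.
    by rewrite /kk mulr_ge0 ?(ltW dl0)// subr_ge0.
  have := rec _ _ kj0 kj.
  have -> : kk j.+1 - kk j = dl * 2^-1 ^+ j.+1.
    by rewrite /kk exprS; field.
  move=> H.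
  have rj0 : 0 <= A0 * rho ^+ j by rewrite mulr_ge0 ?exprn_ge0 ?ltW.
  have H2 : a (kk j.+1) `^ p <=
      K / (dl * 2^-1 ^+ j.+1) ^+ 2 * (A0 * rho ^+ j) `^ r.
    apply: le_trans H _; apply: ler_wpM2l.
      by rewrite divr_ge0 ?sqr_ge0 ?ltW.
    by apply: ge0_ler_powR; rewrite ?nnegrE// ltW// (lt_trans p0).
  (* [dl] is chosen so that the induction closes with equality: its square cancels [K] and the
     surplus power of [A0], and supplies the factor rho^p of the next term. *)
  have E : K / (dl * 2^-1 ^+ j.+1) ^+ 2 * (A0 * rho ^+ j) `^ r =
      (A0 * rho ^+ j.+1) `^ p.
    have rr : r = (r - p) + p by rewrite subrK.
    have e1 : (A0 * rho ^+ j) `^ r = (A0 * rho ^+ j) `^ (r - p) * (A0 * rho ^+ j) `^ p.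
      rewrite {1}rr powRD//; apply/implyP => _.
      by rewrite mulf_neq0 ?gt_eqF ?exprn_gt0.
    have e2 : (A0 * rho ^+ j) `^ (r - p) = A0 `^ (r - p) * 4^-1 ^+ j.
      rewrite powRM ?exprn_ge0 ?(ltW A00) ?(ltW rho0)//; congr (_ * _).
      by rewrite -powR_mulrn ?(ltW rho0)// powRAC rhorp powR_mulrn// invr_ge0.
    have e3 : (A0 * rho ^+ j.+1) `^ p = (A0 * rho ^+ j) `^ p * rho `^ p.
      by rewrite exprSr mulrA powRM ?mulr_ge0 ?exprn_ge0 ?ltW.
    rewrite e1 e2 e3 exprMn dlE /dd.
    have rp0 : rho `^ p != 0 by rewrite gt_eqF ?powR_gt0.
    have Ap0 : A0 `^ (r - p) != 0 by rewrite gt_eqF ?powR_gt0.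
    rewrite -[(2^-1 ^+ j.+1) ^+ 2]exprM mulnC exprM exprS.
    have -> : 2^-1 ^+ 2 = 4^-1 :> R by field.
    have qn : 4^-1 ^+ j != 0 :> R by rewrite expf_neq0.
    by field; rewrite rp0 Ap0 qn gt_eqF.
  rewrite E in H2.
  rewrite leNgt; apply/negP => lt.
  have rj1 : 0 <= A0 * rho ^+ j.+1 by rewrite mulr_ge0 ?exprn_ge0 ?ltW.
  by have := gt0_ltr_powR p0 rj1 (a0 _) lt; rewrite ltNge H2.
have cv : (fun j => A0 * rho ^+ j) @ \oo --> (0 : R).
  rewrite [X in _ --> X](_ : _ = A0 * 0); last by rewrite mulr0.
  apply: cvgM; first exact: cvg_cst.
  by apply: cvg_expr; rewrite ger0_norm// ltW.
apply/eqP; rewrite eq_le a0 andbT.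
apply: (cvgr_to_ge cv); apply: nearW => j.
apply: le_trans (step j); apply: adec.
by rewrite /kk -/dl ler_piMr ?(ltW dl0)// lerBlDr lerDl ltW.
Qed.

(** * Dirichlet spaces and their resolvent *)

Lemma cvgn_sum (R : realType) (I : Type) (r : seq I) (f : I -> nat -> R)
    (l : I -> R) : (forall i, f i @ \oo --> l i) ->
  (fun n => \sum_(i <- r) f i n) @ \oo --> \sum_(i <- r) l i.
Proof.
move=> fl; elim: r => [|i r IH].
  by rewrite big_nil; under eq_fun do rewrite big_nil; exact: cvg_cst.
by rewrite big_cons; under eq_fun do rewrite big_cons; exact: cvgD.
Qed.

Section DirichletForm.
Context {d : measure_display} {T : measurableType d} {R : realType}.
Variables (m : {measure set T -> \bar R}) (D : set T) (N : nat).
Hypothesis mD : measurable D.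
Notation vfield := ('I_N.+1 -> T -> R).
Implicit Types (u v w : vfield) (h : T -> R).

(** The component [ord0] is included, so this is the inner product of W^{1,2}, the form of H + 1
    rather than of H. This is the origin of the bounds [1 + L] further on. *)
Definition energy v w : R := \sum_i ip m D (v i) (w i).

Definition truncate (k e : R) w : vfield := fun i =>
  if i == ord0 then strunc k e \o w ord0
  else fun x => dstrunc k e (w ord0 x) * w i x.

(* [W] plays the role of W^{1,2}: the component [ord0] of a field is the function,
   the others are its weak partial derivatives; [ds_truncate] is the chain rule. *)
Record dirichlet_space (W : set vfield) : Prop := DirichletSpace {
  ds_0 : W 0 ;
  ds_lin : forall a v w, W v -> W w -> W (a *: v + w) ;
  ds_sqint : forall w, W w -> forall i, sqint m D (w i) ;
  ds_closed : forall (w : nat -> vfield) w',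
    (forall n, W (w n)) -> (forall i, sqint m D (w' i)) ->
    (forall i,
      (fun n => ip m D (w n i - w' i) (w n i - w' i)) @ \oo --> 0) -> W w' ;
  ds_truncate : forall w k e, W w -> 0 <= k -> 0 < e -> W (truncate k e w) }.

Variable W : set vfield.
Hypothesis HW : dirichlet_space W.
Let W0 := ds_0 HW.
Let Wlin := ds_lin HW.
Let Wsq := ds_sqint HW.
Let Wclosed := ds_closed HW.

Lemma energyC v w : energy v w = energy w v.
Proof. by apply: eq_bigr => i _; exact: ipC. Qed.

Lemma energy_linl a u v w : W u -> W v -> W w ->
  energy (a *: u + v) w = a * energy u w + energy v w.
Proof.
move=> Wu Wv Ww; rewrite /energy mulr_sumr -big_split/=.
by apply: eq_bigr => i _; rewrite ip_linl//; exact: Wsq.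
Qed.

Lemma energy_ge0 u : 0 <= energy u u.
Proof. by apply: sumr_ge0 => i _; exact: ip_ge0. Qed.

Lemma ip_le_energy u i : ip m D (u i) (u i) <= energy u u.
Proof.
by rewrite /energy (bigD1 i)//= lerDl sumr_ge0// => j _; exact: ip_ge0.
Qed.

Lemma energy_CauchySchwarz v w : W v -> W w ->
  energy v w ^+ 2 <= energy v v * energy w w.
Proof.
apply: (@form_CauchySchwarz R (vfield : lmodType R) W energy) => //.
- by move=> *; exact: energyC.
- by move=> *; exact: energy_linl.
- by move=> *; exact: energy_ge0.
Qed.

(** Weak form of (H + 1) u = h for u = [w ord0]. It is a relation because fields are functions and
    not classes: [w] is determined on [D] only up to null sets. *)
Definition resolvent h w :=
  W w /\ forall v, W v -> energy w v = ip m D h (v ord0).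

Lemma resolvent_exists h : sqint m D h -> exists w, resolvent h w.
Proof.
move=> sh.
suff [w Ww ww] : exists2 w, W w & forall v, W v -> energy w v = ip m D h (v ord0).
  by exists w.
apply: (@form_representation R (vfield : lmodType R) W energy
  W0 Wlin _ _ _ _ (fun v => ip m D h (v ord0)) (ip m D h h)).
- by move=> *; exact: energyC.
- by move=> *; exact: energy_linl.
- by move=> *; exact: energy_ge0.
- move=> w C Ww wC.
  have wiC i n : ip m D (w n.+1 i - w n i) (w n.+1 i - w n i) <= C * 4^-1 ^+ n.
    by apply: le_trans (wC n); exact: (ip_le_energy (w n.+1 - w n) i).
  have /choice[w' w'P] : forall i, exists g, sqint m D g /\
      (fun n => ip m D (w n i - g) (w n i - g)) @ \oo --> 0.
    move=> i; have [|g sg cg] := sqint_complete mD _ (wiC i).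
      by move=> n; apply: Wsq.
    by exists g.
  exists w'.
    by apply: (Wclosed Ww) => i; case: (w'P i).
  have := @cvgn_sum R _ (index_enum 'I_N.+1)
    (fun i n => ip m D (w n i - w' i) (w n i - w' i)) (fun=> 0).
  by rewrite big1//; apply => i; case: (w'P i).
- move=> a u v Wu Wv; rewrite !(ipC _ _ h).
  by rewrite -[X in ip _ _ X _]/(a *: u ord0 + v ord0) ip_linl//; exact: Wsq.
- move=> v Wv; apply: le_trans (ip_CauchySchwarz mD sh (Wsq Wv _)) _.
  by rewrite ler_wpM2l ?ip_ge0// ip_le_energy.
Qed.

Lemma resolvent_lin a h1 h2 w1 w2 : sqint m D h1 -> sqint m D h2 ->
  resolvent h1 w1 -> resolvent h2 w2 ->
  resolvent (a *: h1 + h2) (a *: w1 + w2).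
Proof.
move=> s1 s2 [W1 r1] [W2 r2]; split; first exact: Wlin.
by move=> v Wv; rewrite energy_linl// r1// r2// ip_linl//; exact: Wsq.
Qed.

Lemma resolvent0 : resolvent 0 0.
Proof.
split => // v Wv; have := energy_linl (-1) W0 W0 Wv.
rewrite scaler0 addr0 => e.
have := ip_linl mD (-1) (@sqint0 _ _ _ m D) (@sqint0 _ _ _ m D) (Wsq Wv ord0).
by rewrite scaler0 addr0 => f; lra.
Qed.

Lemma resolventN h w : sqint m D h -> resolvent h w -> resolvent (- h) (- w).
Proof.
move=> sh r; have := resolvent_lin (-1) sh (@sqint0 _ _ _ m D) r resolvent0.
by rewrite !scaleN1r !addr0.
Qed.

Lemma resolvent_sum n (c : 'I_n -> R) (h : 'I_n -> T -> R)
    (w : 'I_n -> vfield) :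
  (forall i, sqint m D (h i)) -> (forall i, resolvent (h i) (w i)) ->
  resolvent (\sum_i c i *: h i) (\sum_i c i *: w i).
Proof.
move=> sh r.
suff : sqint m D (\sum_i c i *: h i) /\
  resolvent (\sum_i c i *: h i) (\sum_i c i *: w i) by case.
elim/big_rec2: _ => [|i h' w' _ [sh' r']].
  by split; [exact: sqint0|exact: resolvent0].
by split; [exact: sqint_lin|exact: resolvent_lin].
Qed.

(** Testing the equation with [w] itself gives ||u||^2 <= energy = (h, u) <= ||h|| ||u|| for u =
    [w ord0]. *)
Lemma resolvent_contraction h w : sqint m D h -> resolvent h w ->
  ip m D (w ord0) (w ord0) <= ip m D h h.
Proof.
move=> sh [Ww r].
have := ip_CauchySchwarz mD sh (Wsq Ww ord0).
have := ip_le_energy w ord0; rewrite (r _ Ww).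
have := ip_ge0 m D (w ord0); have := ip_ge0 m D h.
set a := ip _ _ h h; set b := ip _ _ _ _; set c := ip _ _ h _.
move=> a0 b0 bc cab.
have [->//|bn0] := eqVneq b 0.
have bp : 0 < b by rewrite lt_neqAle eq_sym bn0.
rewrite -(ler_pM2r bp); apply: le_trans cab; rewrite -expr2.
by rewrite ler_sqr ?nnegrE// (le_trans b0).
Qed.

(* Cauchy-Schwarz between [w] and [v] in the energy space shows that the
   resolvent never increases the Rayleigh quotient. *)
Lemma resolvent_rayleigh h v w (L : R) : sqint m D h -> resolvent h w ->
  W v -> v ord0 = h -> 0 <= L -> energy v v <= L * ip m D h h ->
  energy w w <= L * ip m D (w ord0) (w ord0) /\
  ip m D h h <= L ^+ 2 * ip m D (w ord0) (w ord0).
Proof.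
move=> sh [Ww r] Wv vh L0 vL.
have a2 := energy_CauchySchwarz Ww Wv.
rewrite (r _ Wv) vh in a2.
have e2 := ip_CauchySchwarz mD sh (Wsq Ww ord0).
rewrite -(r _ Ww) in e2.
have e0 := energy_ge0 w; have a0 := ip_ge0 m D h.
have b0 := ip_ge0 m D (w ord0).
move: vL a2 e2 e0 a0 b0.
set a := ip _ _ h h; set b := ip _ _ _ _; set e := energy w w.
set f := energy v v => fL a2 e2 e0 a0 b0.
(* The energy pairing of [w] with [v] is [a], so [a ^+ 2 <= e * f <= e * (L * a)]. Next, [e] is the
   L^2 pairing of [h] with the solution, so [e ^+ 2 <= a * b <= L * e * b]. Chained, they say that
   the resolvent shrinks the norm of such a function at most by the factor [L]. *)
have aLe : a <= L * e.
  have [->|an0] := eqVneq a 0; first by rewrite mulr_ge0.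
  have ap : 0 < a by rewrite lt_neqAle eq_sym an0.
  rewrite -(ler_pM2r ap) -expr2; apply: (le_trans a2).
  by rewrite mulrAC mulrC; apply: ler_wpM2r.
have eLb : e <= L * b.
  have [->|en0] := eqVneq e 0; first by rewrite mulr_ge0.
  have ep : 0 < e by rewrite lt_neqAle eq_sym en0.
  rewrite -(ler_pM2r ep) -expr2; apply: (le_trans e2).
  by rewrite mulrAC; apply: ler_wpM2r.
split => //; apply: (le_trans aLe).
by rewrite expr2 -mulrA ler_wpM2l.
Qed.

End DirichletForm.

(** * Boundedness of iterated resolvents *)

Section Regularity.
Context {d : measure_display} {T : measurableType d} {R : realType}.
Variables (m : {measure set T -> \bar R}) (D : set T) (N : nat).
Hypothesis mD : measurable D.
Hypothesis Dfin : (m D < +oo)%E.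
Notation vfield := ('I_N.+1 -> T -> R).
Implicit Types (E : set T) (w : vfield) (h u : T -> R).

Let msr E : R := fine (m E).

Lemma sub_measure_lty E : measurable E -> E `<=` D -> (m E < +oo)%E.
Proof.
by move=> mE ED; apply: le_lt_trans Dfin; apply: le_measure; rewrite ?inE.
Qed.

Let msrE E : measurable E -> E `<=` D -> (msr E)%:E = m E.
Proof.
by move=> mE ED; rewrite /msr fineK// ge0_fin_numE// sub_measure_lty.
Qed.

Let msr_ge0 E : 0 <= msr E. Proof. exact: fine_ge0. Qed.

Lemma sub_sqint E h : measurable E -> E `<=` D -> sqint m D h -> sqint m E h.
Proof.
move=> mE ED [mh h2]; split => //; apply: le_lt_trans h2.
apply: ge0_subset_integral => //.
  by apply/measurable_EFinP/measurable_funX/measurable_funTS.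
by move=> x _; rewrite lee_fin sqr_ge0.
Qed.

Lemma ip_restrict A h u : measurable A -> A `<=` D ->
  (forall x, D x -> ~ A x -> u x = 0) -> ip m D h u = ip m A h u.
Proof.
move=> mA AD u0; rewrite /ip [LHS]Rintegral_mkcond [RHS]Rintegral_mkcond.
apply: eq_Rintegral => x _; rewrite !patchE.
have [Ax|nAx] := pselect (A x); first by rewrite !mem_set//; exact: AD.
rewrite (memNset nAx); case: ifPn => // /set_mem Dx.
by rewrite u0// mulr0.
Qed.

Lemma sub_ip_le E h : measurable E -> E `<=` D -> sqint m D h ->
  ip m E h h <= ip m D h h.
Proof.
move=> mE ED sh; rewrite -lee_fin !EFin_ip_sqr//; last exact: sub_sqint.
apply: ge0_subset_integral => //.
  by apply/measurable_EFinP/measurable_funX/measurable_funTS; case: sh.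
by move=> x _; rewrite lee_fin sqr_ge0.
Qed.

Definition superlevel k u : set T := D `&` [set x | k < u x].

Lemma measurable_superlevel k u : measurable_fun setT u ->
  measurable (superlevel k u).
Proof.
move=> mu_; apply: measurableI => //.
rewrite -[X in measurable X]setTI.
exact: (measurable_fun_ltr (@measurable_cst _ _ _ _ setT k) mu_ measurableT).
Qed.

Lemma chebyshev_sqr A k u : measurable A -> A `<=` D -> 0 <= k ->
  sqint m D u -> (forall x, A x -> k <= u x) ->
  k ^+ 2 * msr A <= ip m A u u.
Proof.
move=> mA AD k0 su ku; have mu_ : measurable_fun setT u by case: su.
have sA := sub_sqint mA AD su.
rewrite -lee_fin EFinM msrE// EFin_ip_sqr//.
rewrite -(integral_cst m mA (k ^+ 2)%:E).
apply: ge0_le_integral => //.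
- by move=> x _; rewrite lee_fin sqr_ge0.
- by apply/measurable_EFinP/measurable_funX/measurable_funTS.
- move=> x Ax; rewrite lee_fin.
  by rewrite ler_sqr ?nnegrE ?(le_trans k0 (ku _ Ax))// ku.
Qed.

Variable W : set vfield.
Hypothesis HW : dirichlet_space m D W.
Variables (c th : R).
Hypotheses (c0 : 0 < c) (th0 : 0 < th) (th1 : th < 1).
Hypothesis sobolev : forall w, W w -> forall E, measurable E -> E `<=` D ->
  ip m E (w ord0) (w ord0) <= c * msr E `^ th * energy m D w w.

Notation resolvent := (resolvent m D W).
Notation energy := (energy m D).

(** The pairing of [w] with its truncation dominates the energy of the truncation componentwise: the
    truncation of a number above [k >= 0] lies between 0 and that number, and [dstrunc] lies in
    [0, 1], so it is at least its square. *)
Lemma energy_truncate h w k e : sqint m D h -> resolvent h w -> 0 <= k ->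
  0 < e -> energy (truncate k e w) (truncate k e w) <=
           ip m D h (truncate k e w ord0).
Proof.
move=> sh [Ww r] k0 e0; have Wt := ds_truncate HW Ww k0 e0.
rewrite -(r _ Wt); apply: ler_sum => i _.
have si := ds_sqint HW Wt i; have si' := ds_sqint HW Ww i.
apply: le_Rintegral => //; try exact: sqintM_integrable.
move=> x Dx; rewrite /truncate; case: ifPn => [/eqP ->|_] /=.
  have v0 := strunc_ge0 k e0 (w ord0 x).
  have [uk|uk] := leP (w ord0 x) k; first by rewrite strunc_eq0// !mulr0.
  apply: ler_wpM2r => //; apply: le_trans (strunc_le_pospart _ e0 _) _.
  by rewrite ge_max lerBlDr lerDl k0/= (le_trans k0)// ltW.
have d0 := dstrunc_ge0 k e (w ord0 x).
have d1 := dstrunc_le1 k e0 (w ord0 x).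
have d1' : 0 <= 1 - dstrunc k e (w ord0 x) by rewrite subr_ge0.
by have := mulr_ge0 (mulr_ge0 d0 (sqr_ge0 (w i x))) d1'; nra.
Qed.

(* For [s = 1] this says that [h ^+ 2 <= C] almost everywhere. *)
Definition locbound (C s : R) h := forall E, measurable E -> E `<=` D ->
  ip m E h h <= C * msr E `^ s.

Lemma locboundN C s h : locbound C s h -> locbound C s (- h).
Proof.
move=> H E mE ED; apply: le_trans (H E mE ED).
by rewrite /ip (@eq_Rintegral _ _ _ _ _ (fun x => h x * h x))// => x _; exact: mulrNN.
Qed.

(** The truncation vanishes off the superlevel set [A], so it is paired with [h] on [A] only. There
    Cauchy-Schwarz, the bound on [h] and the Sobolev bound on the truncation give e'^2 <= (C |A|^s)
    (c |A|^th) e', and one factor e' cancels. *)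
Lemma energy_truncate_locbound h w k e C s : sqint m D h -> resolvent h w ->
  0 <= k -> 0 < e -> 0 <= C -> 0 <= s -> locbound C s h ->
  energy (truncate k e w) (truncate k e w) <=
    c * C * msr (superlevel k (w ord0)) `^ (s + th).
Proof.
move=> sh r k0 e0 C0 s0 Hh; have := energy_truncate sh r k0 e0.
have [Ww _] := r; have Wt := ds_truncate HW Ww k0 e0.
have sw := ds_sqint HW Ww ord0; have st := ds_sqint HW Wt ord0.
set A := superlevel k (w ord0).
have mA : measurable A by apply: measurable_superlevel; case: sw.
have AD : A `<=` D by move=> x [].
set v := truncate k e w in Wt st *.
rewrite (ip_restrict h mA AD); last first.
  move=> x Dx nA; rewrite /v /truncate eqxx /=; apply: strunc_eq0 => //.
  by rewrite leNgt; apply/negP => kx; apply: nA.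
have := ip_CauchySchwarz mA (sub_sqint mA AD sh) (sub_sqint mA AD st).
have := Hh A mA AD; have := sobolev Wt mA AD.
have := energy_ge0 m D v; have := ip_ge0 m A h; have := ip_ge0 m A (v ord0).
have P : msr A `^ s * msr A `^ th = msr A `^ (s + th).
  by rewrite powRD//; apply/implyP; rewrite gt_eqF// ltr_wpDl.
have Ps := powR_ge0 (msr A) s; have Pt := powR_ge0 (msr A) th.
rewrite -P.
set e' := energy v v; set a := ip _ _ h h; set b := ip _ _ _ _.
set f := ip _ _ h _.
move=> b0 a0 e'0 be ae fab ef.
have [->|en0] := eqVneq e' 0; first by rewrite !mulr_ge0// ltW.
have ep : 0 < e' by rewrite lt_neqAle eq_sym en0.
rewrite -(ler_pM2r ep) -expr2.
apply: (@le_trans _ _ (f ^+ 2)).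
  by rewrite ler_sqr ?nnegrE// (le_trans e'0).
apply: (le_trans fab); apply: le_trans (ler_pM a0 b0 ae be) _.
by rewrite le_eqVlt; apply/orP; left; apply/eqP; ring.
Qed.

(** The level is adapted to [E]. Chebyshev and the bound on [w ord0] itself give k^2 |A| <= C |A|^s
    on the superlevel set [A], and this [k] turns it into |A| <= |E|^g with g = (1 - th)/(1 + th).
    The Sobolev bound on [E] then produces the exponent th + g (s + th). The choice of g makes it
    equal to 1 - (1 - s) g, the exponent of k^2 |E|: the parts above and below the level balance. *)
Lemma truncate_locbound h w C s E k : sqint m D h -> resolvent h w ->
  0 < C -> 0 <= s -> s < 1 -> locbound C s h -> locbound C s (w ord0) ->
  measurable E -> E `<=` D -> 0 < msr E ->
  k = Num.sqrt (C * msr E `^ (- ((1 - s) * ((1 - th) / (1 + th))))) ->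
  ip m E (truncate k k w ord0) (truncate k k w ord0) <=
    c ^+ 2 * C * msr E `^ (1 - (1 - s) * ((1 - th) / (1 + th))).
Proof.
move=> sh r C0 s0 s1 Hh Hu mE ED e0; set g := (1 - th) / (1 + th) => kE.
have [Ww _] := r.
have sw := ds_sqint HW Ww ord0.
set a := (1 - s) * g in kE *.
have k2 : k ^+ 2 = C * msr E `^ (- a).
  by rewrite kE sqr_sqrtr// mulr_ge0 ?powR_ge0// ltW.
have k0 : 0 < k by rewrite kE sqrtr_gt0 mulr_gt0 ?powR_gt0.
have Wt := ds_truncate HW Ww (ltW k0) k0.
set A := superlevel k (w ord0).
have mA : measurable A by apply: measurable_superlevel; case: sw.
have AD : A `<=` D by move=> x [].
have s1' : 0 < 1 - s by rewrite subr_gt0.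
have g0 : 0 < g by rewrite divr_gt0 ?subr_gt0// addr_gt0.
have sth : 0 < s + th by rewrite ltr_wpDl.
have Ale : msr A <= msr E `^ g.
  have [->|An0] := eqVneq (msr A) 0; first exact: powR_ge0.
  have A0 : 0 < msr A by rewrite lt_neqAle eq_sym An0 msr_ge0.
  have H : msr A `^ (1 - s) <= msr E `^ a.
    rewrite powRB ?An0 ?implybT// powRr1// ler_pdivrMr ?powR_gt0//.
    have Ak x : A x -> k <= w ord0 x by move=> [_ /ltW].
    have := le_trans (chebyshev_sqr mA AD (ltW k0) sw Ak) (Hu A mA AD).
    rewrite k2 -mulrA ler_pM2l// powRN mulrC -ler_pdivlMr ?invr_gt0 ?powR_gt0//.
    by rewrite invrK mulrC.
  have i0 : 0 <= (1 - s)^-1 by rewrite invr_ge0 ltW.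
  have := ge0_ler_powR i0 (powR_ge0 _ _) (powR_ge0 _ _) H.
  rewrite -!powRrM divff ?gt_eqF// powRr1//.
  by rewrite /a mulrC mulKf// gt_eqF.
apply: (le_trans (sobolev Wt mE ED)).
apply: (@le_trans _ _ (c * msr E `^ th * (c * C * msr E `^ (g * (s + th))))).
  apply: ler_wpM2l; first by rewrite mulr_ge0 ?powR_ge0// ltW.
  apply: le_trans (energy_truncate_locbound sh r (ltW k0) k0 (ltW C0) s0 Hh) _.
  apply: ler_wpM2l; first by rewrite mulr_ge0// ltW.
  rewrite powRrM; apply: ge0_ler_powR; rewrite ?nnegrE ?powR_ge0//.
  exact: ltW.
have -> : msr E `^ (1 - a) = msr E `^ th * msr E `^ (g * (s + th)).
  rewrite -powRD ?(gt_eqF e0) ?implybT//; congr (_ `^ _).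
  by rewrite /a /g; field; rewrite gt_eqF// addr_gt0.
by rewrite le_eqVlt; apply/orP; left; apply/eqP; ring.
Qed.

Lemma ip_null E h : measurable E -> m E = 0%E -> sqint m E h -> ip m E h h = 0.
Proof.
move=> mE E0 sh; apply: EFin_inj; rewrite EFin_ip_sqr//.
rewrite null_set_integral//; apply/measurable_EFinP/measurable_funX/measurable_funTS.
by case: sh.
Qed.

(** Up to [2 * k] the function contributes a multiple of k^2 |E|; the excess is controlled by the
    truncations of [w ord0] and of its negative. The distance of the exponent to 1 is multiplied by
    (1 - th)/(1 + th) < 1. *)
Lemma locbound_improve h w C s : sqint m D h -> resolvent h w ->
  0 < C -> 0 <= s -> s < 1 -> locbound C s h -> locbound C s (w ord0) ->
  locbound ((12 + 6 * c ^+ 2) * C)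
    (1 - (1 - s) * ((1 - th) / (1 + th))) (w ord0).
Proof.
move=> sh r C0 s0 s1 Hh Hu E mE ED.
have [Ww _] := r; have sw := ds_sqint HW Ww ord0.
(* A null [E] is treated apart because the level involves a negative power of its measure. *)
have [E0|En0] := eqVneq (msr E) 0.
  rewrite ip_null//; last exact: sub_sqint.
    by rewrite mulr_ge0 ?powR_ge0// mulr_ge0 ?(ltW C0)// addr_ge0// mulr_ge0 ?sqr_ge0.
  by rewrite -msrE// E0.
have e0 : 0 < msr E by rewrite lt_neqAle eq_sym En0 msr_ge0.
set s' := 1 - _.
pose k := Num.sqrt (C * msr E `^ (- ((1 - s) * ((1 - th) / (1 + th))))).
have k0 : 0 < k by rewrite sqrtr_gt0 mulr_gt0 ?powR_gt0.
have k2 : k ^+ 2 * msr E = C * msr E `^ s'.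
  rewrite sqr_sqrtr ?mulr_ge0 ?powR_ge0 ?(ltW C0)// -mulrA; congr (_ * _).
  by rewrite /s' powRD ?(gt_eqF e0) ?implybT// powRr1 ?(ltW e0)// mulrC.
have B1 := truncate_locbound sh r C0 s0 s1 Hh Hu mE ED e0 (erefl k).
have rN := resolventN mD HW sh r.
have shN : sqint m D (- h) by rewrite -scaleN1r; exact: sqintZ.
have B2 := truncate_locbound shN rN C0 s0 s1 (locboundN Hh) (locboundN Hu) mE ED e0 (erefl k).
rewrite -/s' in B1 B2.
have S1 := sub_sqint mE ED (ds_sqint HW (ds_truncate HW Ww (ltW k0) k0) ord0).
have [WwN _] := rN.
have S2 := sub_sqint mE ED (ds_sqint HW (ds_truncate HW WwN (ltW k0) k0) ord0).
move: B1 B2 S1 S2; set v1 := truncate k k w ord0.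
set v2 := truncate k k (- w) ord0 => B1 B2 S1 S2.
have I1 := integrableZl mE 3 (sqintM_integrable mE S1 S1).
have I2 := integrableZl mE 3 (sqintM_integrable mE S2 S2).
have I3 := integrableD mE I1 I2.
have I0 : m.-integrable E (fun=> (12 * k ^+ 2)%:E).
  apply: (@measurable_bounded_integrable _ _ _ m (cst (12 * k ^+ 2)) E mE).
  - exact: sub_measure_lty.
  - exact: measurable_cst.
  - exact: bounded_cst.
have S := sub_sqint mE ED sw.
(* With the smoothing parameter equal to the level, |u| <= v1 + v2 + 2 k. The square of three
   summands is at most three times the sum of their squares: hence 12 k^2 and, after integration, 6
   c^2. *)
have : ip m E (w ord0) (w ord0) <= \int[m]_(x in E)
    (12 * k ^+ 2 + (3 * (v1 x * v1 x) + 3 * (v2 x * v2 x))).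
  apply: le_Rintegral => //.
  - exact: sqintM_integrable.
  - exact: (integrableD mE I0 I3).
  - move=> x Ex; set u := w ord0 x.
    have p1 := pospart_le_strunc k k u; have p1' := pospart_ge k u.
    have p2 := pospart_le_strunc k k (- u); have p2' := pospart_ge k (- u).
    have q1 := strunc_ge0 k k0 u; have q2 := strunc_ge0 k k0 (- u).
    rewrite -[v1 x]/(strunc k k u) -[v2 x]/(strunc k k (- u)).
    move: p1 p2 q1 q2; set a := strunc k k u; set b := strunc k k (- u).
    move=> p1 p2 q1 q2.
    have u1 : u <= a + b + 2 * k by lra.
    have u2 : - u <= a + b + 2 * k by lra.
    have : u ^+ 2 <= (a + b + 2 * k) ^+ 2.
      have n0 : 0 <= a + b + 2 * k by lra.
      have un : `|u| <= a + b + 2 * k by rewrite ler_norml; lra.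
      by rewrite -(real_normK (num_real u)) ler_sqr ?nnegrE.
    have := sqr_ge0 (a - b); have := sqr_ge0 (a - 2 * k).
    have := sqr_ge0 (b - 2 * k); nra.
rewrite RintegralD// RintegralD//.
rewrite RintegralZl//; last exact: sqintM_integrable.
rewrite RintegralZl//; last exact: sqintM_integrable.
rewrite Rintegral_cst// -/(msr E) -/(ip m E v1 v1) -/(ip m E v2 v2).
move=> /le_trans; apply.
have -> : (12 + 6 * c ^+ 2) * C * msr E `^ s' = 12 * (k ^+ 2 * msr E) +
   (3 * (c ^+ 2 * C * msr E `^ s') + 3 * (c ^+ 2 * C * msr E `^ s')).
  by rewrite k2; ring.
apply: lerD; first by rewrite mulrA.
by apply: lerD; rewrite ler_pM2l.
Qed.

End Regularity.

(** * Vanishing superlevel sets and essential bounds *)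

Section Boundedness.
Context {d : measure_display} {T : measurableType d} {R : realType}.
Variables (m : {measure set T -> \bar R}) (D : set T) (N : nat).
Hypothesis mD : measurable D.
Hypothesis Dfin : (m D < +oo)%E.
Notation vfield := ('I_N.+1 -> T -> R).
Implicit Types (E : set T) (w : vfield) (h u : T -> R).
Notation msr E := (fine (m E)).

Variable W : set vfield.
Hypothesis HW : dirichlet_space m D W.
Variables (c th : R).
Hypotheses (c0 : 0 < c) (th0 : 0 < th) (th1 : th < 1).
Hypothesis sobolev : forall w, W w -> forall E, measurable E -> E `<=` D ->
  ip m E (w ord0) (w ord0) <= c * msr E `^ th * energy m D w w.

Notation resolvent := (resolvent m D W).
Notation energy := (energy m D).
Notation locbound := (locbound m D).

(** Smoothing with [e = l - k] keeps the truncation at level [k] above (l - k)/3 on the superlevel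
    set of [l]. Chebyshev from below, Sobolev and [energy_truncate_locbound] from above leave a
    factor a^th on the right; dividing by it gives the exponent 1 - th. *)
Lemma msr_superlevel_rec h w C s k l : sqint m D h -> resolvent h w ->
  0 < C -> 0 <= s -> locbound C s h -> 0 <= k -> k < l ->
  msr (superlevel D l (w ord0)) `^ (1 - th) <=
    9 * c ^+ 2 * C / (l - k) ^+ 2 * msr (superlevel D k (w ord0)) `^ (s + th).
Proof.
move=> sh r C0 s0 Hh k0 kl; have [Ww _] := r.
have e0 : 0 < l - k by rewrite subr_gt0.
have Wt := ds_truncate HW Ww k0 e0.
have sw := ds_sqint HW Ww ord0; have st := ds_sqint HW Wt ord0.
set A := superlevel D l (w ord0).
have mA : measurable A by apply: measurable_superlevel => //; case: sw.
have AD : A `<=` D by move=> x [].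
have Av x : A x -> (l - k) / 3 <= truncate k (l - k) w ord0 x.
  by move=> [_ lu]; apply: strunc_gt => //; rewrite lerD2r ltW.
have := chebyshev_sqr mD Dfin mA AD (divr_ge0 (ltW e0) (ler0n _ 3)) st Av.
move=> /le_trans/(_ (sobolev Wt mA AD)).
have := energy_truncate_locbound mD HW c0 th0 sobolev sh r k0 e0 (ltW C0) s0 Hh.
set a := msr A; set b := msr (superlevel D k _) `^ _; set e' := energy _ _.
move=> He H.
have p0 : 0 < 1 - th by rewrite subr_gt0.
have b0 : 0 <= b by exact: powR_ge0.
have K0 : 0 <= 9 * c ^+ 2 * C / (l - k) ^+ 2.
  by rewrite divr_ge0 ?sqr_ge0// !mulr_ge0 ?sqr_ge0// ltW.
have [a0|an0] := eqVneq a 0.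
  by rewrite a0 powR0 ?gt_eqF// mulr_ge0.
have a0 : 0 < a by rewrite lt_neqAle eq_sym an0 fine_ge0.
have at0 := powR_gt0 th a0.
rewrite powRB ?an0 ?implybT// powRr1 ?(ltW a0)// ler_pdivrMr//.
have {}H : ((l - k) / 3) ^+ 2 * a <= c * a `^ th * (c * C * b).
  by apply: (le_trans H); rewrite ler_pM2l// mulr_gt0.
have e2 : 0 < (l - k) ^+ 2 by rewrite exprn_gt0.
rewrite -(ler_pM2l e2).
have -> : (l - k) ^+ 2 * (9 * c ^+ 2 * C / (l - k) ^+ 2 * b * a `^ th) =
   9 * (c * a `^ th * (c * C * b)).
  by field; rewrite gt_eqF.
have -> : (l - k) ^+ 2 * a = 9 * (((l - k) / 3) ^+ 2 * a) by field.
by rewrite ler_pM2l.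
Qed.

(** The squared terminal level of [stampacchia_iteration] for this recursion, divided by [C]; 36 is
    4 times 9. The measure is enlarged by 1 so that the starting bound is positive even for a null
    [D]. *)
Definition sup_const (s : R) : R :=
  36 * c ^+ 2 * (msr D + 1) `^ (s + th - (1 - th)) /
    (4^-1 `^ (s + th - (1 - th))^-1) `^ (1 - th).

Lemma sup_const_gt0 s : 0 < sup_const s.
Proof.
by rewrite divr_gt0 ?mulr_gt0 ?exprn_gt0 ?powR_gt0 ?invr_gt0// ltr_wpDl// fine_ge0.
Qed.

(** [stampacchia_iteration] with [p = 1 - th] and [r = s + th]; its requirement [p < r] is the
    condition [1 - 2 * th < s]. *)
Lemma msr_superlevel_eq0 h w C s : sqint m D h -> resolvent h w ->
  0 < C -> 0 <= s -> 1 - 2 * th < s -> locbound C s h ->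
  m (superlevel D (Num.sqrt (sup_const s * C)) (w ord0)) = 0%E.
Proof.
move=> sh r C0 s0 sth Hh; have [Ww _] := r.
have sw := ds_sqint HW Ww ord0.
have mS k : measurable (superlevel D k (w ord0)).
  by apply: measurable_superlevel => //; case: sw.
have SD k : superlevel D k (w ord0) `<=` D by move=> x [].
have mfin k : m (superlevel D k (w ord0)) \is a fin_num.
  by rewrite ge0_fin_numE// (sub_measure_lty mD Dfin).
have D0 : 0 <= msr D by exact: fine_ge0.
have := @stampacchia_iteration R (fun k => msr (superlevel D k (w ord0)))
  (msr D + 1) (9 * c ^+ 2 * C) (1 - th) (s + th).
rewrite /= (_ : 4 * (9 * c ^+ 2 * C) * _ / _ = sup_const s * C); last first.
  by rewrite /sup_const; ring.
move=> H; apply/eqP; rewrite -fine_eq0//; apply/eqP; apply: H.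
- by rewrite ltr_wpDl.
- by rewrite !mulr_gt0 ?exprn_gt0.
- by rewrite subr_gt0.
- by lra.
- by move=> k; exact: fine_ge0.
- move=> k l kl; apply: fine_le => //; apply: le_measure; rewrite ?inE//.
  by move=> x [Dx /= lx]; split => //; exact: le_lt_trans lx.
- apply: (@le_trans _ _ (msr D)); last by rewrite lerDl.
  apply: fine_le => //; first by rewrite ge0_fin_numE.
  by apply: le_measure; rewrite ?inE.
- by move=> k l k0 kl; exact: (msr_superlevel_rec sh r).
Qed.

(** The vanishing of a superlevel set, used for [h] and for [- h], bounds the absolute value of
    [w ord0] almost everywhere. *)
Lemma locbound_one h w C s : sqint m D h -> resolvent h w ->
  0 < C -> 0 <= s -> 1 - 2 * th < s -> locbound C s h ->
  locbound (sup_const s * C) 1 (w ord0).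
Proof.
move=> sh r C0 s0 sth Hh E mE ED; have [Ww _] := r.
have sw := ds_sqint HW Ww ord0.
have shN : sqint m D (- h) by rewrite -scaleN1r; exact: sqintZ.
have mfw : measurable_fun setT (w ord0) by case: sw.
have Z1 := msr_superlevel_eq0 sh r C0 s0 sth Hh.
have Z2 := msr_superlevel_eq0 shN (resolventN mD HW sh r) C0 s0 sth (locboundN Hh).
set l := Num.sqrt _ in Z1 Z2.
have mS1 := measurable_superlevel mD l mfw.
have mS2 := measurable_superlevel mD l (measurable_funN mfw).
have l0 : 0 <= l by exact: sqrtr_ge0.
have l2 : l ^+ 2 = sup_const s * C.
  by rewrite sqr_sqrtr// mulr_ge0 ?(ltW C0)// ltW// sup_const_gt0.
rewrite powRr1 ?fine_ge0// -l2.
rewrite -lee_fin EFin_ip_sqr//; last exact: sub_sqint sw.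
rewrite EFinM fineK; last by rewrite ge0_fin_numE// (sub_measure_lty mD Dfin).
rewrite -(integral_cst m mE (l ^+ 2)%:E).
apply: ae_ge0_le_integral => //.
- by move=> x _; rewrite lee_fin sqr_ge0.
- by apply/measurable_EFinP/measurable_funX/measurable_funTS.
- by move=> x _; rewrite lee_fin sqr_ge0.
- have N1 := (negligibleP m mS1).2 Z1.
  have N2 := (negligibleP m mS2).2 Z2.
  have := negligibleU N1 N2; apply: negligibleS => x /= nx.
  apply: contrapT => nS; apply: nx => Ex; rewrite lee_fin.
  have u1 : w ord0 x <= l.
    by rewrite leNgt; apply/negP => lu; apply: nS; left; split => //; exact: ED.
  have u2 : - w ord0 x <= l.
    by rewrite leNgt; apply/negP => lu; apply: nS; right; split => //; exact: ED.
  rewrite -(real_normK (num_real (w ord0 x))) ler_sqr ?nnegrE//.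
  by rewrite ler_norml lerNl u2 u1.
Qed.

(** Represents the iterates A^j h. Only the component [ord0] of [w 0] enters, so a chain can start
    from any square integrable function. *)
Definition resolvent_chain (w : nat -> vfield) :=
  forall j, resolvent (w j ord0) (w j.+1).

Lemma resolvent_chain_sqint (w : nat -> vfield) : resolvent_chain w ->
  sqint m D (w 0%N ord0) -> forall j, sqint m D (w j ord0).
Proof. by move=> wc s0 [//|j]; have [Ww _] := wc j; exact: ds_sqint HW _ Ww _. Qed.

(** [K] is uniform over all chains and the bound is linear in [r], so that it can serve a whole
    span. At [j = 0] the exponent is 0 and the claim is the plain L^2 bound. *)
Lemma chain_locbound j : exists2 K, 0 < K & forall w : nat -> vfield, resolvent_chain w ->
  sqint m D (w 0%N ord0) -> forall r, 0 < r ->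
  ip m D (w 0%N ord0) (w 0%N ord0) <= r ->
  locbound (K * r) (1 - ((1 - th) / (1 + th)) ^+ j) (w j ord0).
Proof.
have g0 : 0 < (1 - th) / (1 + th) by rewrite divr_gt0 ?subr_gt0// addr_gt0.
have g1 : (1 - th) / (1 + th) < 1.
  by rewrite ltr_pdivrMr ?addr_gt0// mul1r ltrD2l gtrN.
set g := (1 - th) / (1 + th) in g0 g1 *.
elim: j => [|j [K K0 IH]].
  exists 1 => // w wc s0 r r0 wr E mE ED.
  rewrite expr0 subrr powRr0 mulr1 mul1r; apply: le_trans wr.
  exact: sub_ip_le.
exists ((12 + 6 * c ^+ 2) * K).
  by rewrite mulr_gt0// addr_gt0// mulr_gt0// exprn_gt0.
move=> w wc s0 r r0 wr.
have B1 := IH w wc s0 r r0 wr.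
(* The improvement needs the old bound for the datum and for the solution. The latter is the
   induction hypothesis for the shifted chain, whose start is no larger by
   [resolvent_contraction]. *)
have B2 : locbound (K * r) (1 - g ^+ j) (w j.+1 ord0).
  apply: (IH (fun i => w i.+1)) => //.
  - exact: (resolvent_chain_sqint wc s0 1).
  - by apply: le_trans wr; apply: (resolvent_contraction mD HW) => //; exact: wc.
have gj0 : 0 < g ^+ j by rewrite exprn_gt0.
have gj1 : g ^+ j <= 1 by rewrite exprn_ile1// ltW.
have -> : (12 + 6 * c ^+ 2) * K * r = (12 + 6 * c ^+ 2) * (K * r) by ring.
have -> : 1 - g ^+ j.+1 = 1 - (1 - (1 - g ^+ j)) * g by rewrite exprSr; ring.
apply: (locbound_improve mD Dfin HW c0 th0 th1 sobolev _ (wc j)) => //.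
- exact: resolvent_chain_sqint.
- by rewrite mulr_gt0.
- by rewrite subr_ge0.
- by rewrite ltrBlDr ltrDl.
Qed.

Theorem resolvent_chain_bounded : exists j K, 0 < K /\
  forall w : nat -> vfield, resolvent_chain w -> sqint m D (w 0%N ord0) ->
  forall r, 0 < r -> ip m D (w 0%N ord0) (w 0%N ord0) <= r ->
  forall E, measurable E -> E `<=` D ->
  ip m E (w j ord0) (w j ord0) <= K * r * msr E.
Proof.
have g0 : 0 < (1 - th) / (1 + th) by rewrite divr_gt0 ?subr_gt0// addr_gt0.
have g1 : (1 - th) / (1 + th) < 1.
  by rewrite ltr_pdivrMr ?addr_gt0// mul1r ltrD2l gtrN.
have : (fun j => ((1 - th) / (1 + th)) ^+ j) @ \oo --> (0 : R).
  by apply: cvg_expr; rewrite ger0_norm// ltW.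
(* Once the gap is below [2 * th], the exponent passes the threshold of [locbound_one], and one more
   resolvent reaches exponent 1. *)
move=> /cvgrPdist_lt/(_ (2 * th)); rewrite mulr_gt0// => /(_ isT)[j _ gj].
have {}gj : ((1 - th) / (1 + th)) ^+ j < 2 * th.
  have := gj j (leqnn j); rewrite sub0r normrN; apply: le_lt_trans; exact: ler_norm.
have [K K0 HK] := chain_locbound j.
set s := 1 - _ ^+ j in HK.
exists j.+1, (sup_const s * K); split; first by rewrite mulr_gt0// sup_const_gt0.
move=> w wc s0 r r0 wr E mE ED.
have := @locbound_one _ _ (K * r) s (resolvent_chain_sqint wc s0 j) (wc j).
rewrite mulr_gt0// => /(_ isT) H.
have := H _ _ (HK w wc s0 r r0 wr) E mE ED.
rewrite powRr1 ?fine_ge0// mulrA; apply.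
- by rewrite subr_ge0 exprn_ile1// ltW.
- by rewrite /s; lra.
Qed.

End Boundedness.

(** * Lebesgue measure on row vectors *)

Definition openRV (R : realType) (N : nat) : set (set 'rV[R]_N) := open.

(* Copy of ['rV[R]_N] carrying the Borel sigma-algebra of [borelN]. *)
Definition borelRV (R : realType) (N : nat) : Type :=
  g_sigma_algebraType (@openRV R N).
HB.instance Definition _ (R : realType) (N : nat) :=
  Measurable.on (borelRV R N).

Section BorelRV.
Context {R : realType}.

Lemma open_measurableRV N (U : set 'rV[R]_N) : open U ->
  measurable (U : set (borelRV R N)).
Proof. by move=> oU; exact: sub_sigma_algebra. Qed.

(** Open sets are countable unions of boxes with rational data; this makes measurability into
    [borelRV] a matter of coordinates. *)
Lemma open_ratr_ball N (U : set 'rV[R]_N) : open U ->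
  U = \bigcup_(qr in [set qr : 'rV[rat]_N * rat |
      (forall x : 'rV[R]_N, (forall i, `|ratr (qr.1 0 i) - x 0 i| < ratr qr.2) -> U x)])
    [set x | forall i, `|ratr (qr.1 0 i) - x 0 i| < ratr qr.2].
Proof.
move=> oU; apply/seteqP; split => [x Ux|x [qr /= qrU] xqr]; last exact: qrU.
have /nbhs_ballP[e /= e0 eU] : nbhs x U by exact: open_nbhs_nbhs.
have [r] := @rat_in_itvoo R 0 (e / 2) (divr_gt0 e0 (ltr0n R 2)).
rewrite in_itv/= => /andP[r0 re].
have /choice[q qP] : forall i, exists q : rat, `|ratr q - x 0 i| < ratr r :> R.
  move=> i; have [|q] := @rat_in_itvoo R (x 0 i - ratr r) (x 0 i + ratr r).
    by rewrite ltrBlDr -addrA ltrDl addr_gt0.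
  by rewrite in_itv/= => qr; exists q; rewrite ltr_distl.
exists (\row_i q i, r) => /=; last by move=> i; rewrite mxE.
move=> y yq; apply: eU; split => // i j; rewrite ord1 -ball_normE/=.
have := yq j; rewrite mxE => h1.
apply: le_lt_trans (ler_distD (ratr (q j)) _ _) _.
rewrite (splitr e) ltrD//; last exact: lt_trans h1 re.
by rewrite distrC; exact: lt_trans (qP j) re.
Qed.

Lemma measurable_funRV d (X : measurableType d) N (g : X -> 'rV[R]_N) :
  (forall i, measurable_fun setT (fun x => g x 0 i)) ->
  measurable_fun setT (g : X -> borelRV R N).
Proof.
move=> mg; apply: (@measurability _ _ X (borelRV R N) setT g (@openRV R N)) => //.
move=> _ [U oU <-]; rewrite setTI (open_ratr_ball oU) preimage_bigcup.
rewrite bigcup_mkcond; apply: countable_bigcupT_measurable => [|[q r]].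
  exact: countableP.
case: ifPn => // _.
rewrite (_ : _ @^-1` _ = ~` \bigcup_(i in [set: 'I_N])
    ~` [set x | `|ratr (q 0 i) - g x 0 i| < ratr r]).
  apply/measurableC/fin_bigcup_measurable => // i _; apply: measurableC.
  rewrite -[X in measurable X]setTI.
  apply: (measurable_fun_ltr _ (@measurable_cst _ _ _ _ setT (ratr r : R)) measurableT) => //.
  by apply: measurableT_comp => //; apply: measurable_funB.
apply/seteqP; split => x /= H; first by case=> i _; apply; exact: H.
by move=> i; apply: contrapT => nH; apply: H; exists i.
Qed.

Lemma continuous_measurableRV N (f : 'rV[R]_N -> R) : continuous f ->
  measurable_fun setT (f : borelRV R N -> R).
Proof.
move=> /continuousP cf; apply: (measurability _ (RGenOpens.measurableE R)).
move=> _ [_ [a [b ->] <-]]; rewrite setTI; apply: open_measurableRV.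
exact/cf/interval_open.
Qed.

Lemma measurable_borel_fun N (f : 'rV[R]_N -> R) :
  measurable_fun setT (f : borelRV R N -> R) <-> borel_fun f.
Proof.
split=> [mf U oU|bf].
  by rewrite -[X in borelN X]setTI; exact: (mf measurableT U (open_measurable oU)).
apply: (measurability _ (RGenOpens.measurableE R)).
move=> _ [_ [a [b ->] <-]]; rewrite setTI; apply: bf; exact: interval_open.
Qed.

Lemma measurable_coordRV N (i : 'I_N) :
  measurable_fun setT (fun x : borelRV R N => (x : 'rV[R]_N) 0 i).
Proof. by apply: continuous_measurableRV; exact: coord_continuous. Qed.

(** Written exactly as the argument in the recursive step of [iint], so that iterated integrals and
    product measures meet by conversion. *)
Definition consRV n (p : R * 'rV[R]_n) : 'rV[R]_n.+1 :=
  row_mx (\row_(j < 1) p.1) p.2.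

Definition unconsRV n (x : 'rV[R]_n.+1) : R * 'rV[R]_n :=
  (x 0 ord0, \row_i x 0 (lift ord0 i)).

Lemma consRV0 n (p : R * 'rV[R]_n) : consRV p 0 ord0 = p.1.
Proof.
rewrite /consRV (_ : ord0 = lshift n (ord0 : 'I_1)); last exact/val_inj.
by apply: (etrans (row_mxEl (\row_(j < 1) p.1) p.2 0 ord0)); rewrite mxE.
Qed.

Lemma consRV_lift n (p : R * 'rV[R]_n) i : consRV p 0 (lift ord0 i) = p.2 0 i.
Proof.
rewrite /consRV (_ : lift ord0 i = rshift 1 i); last exact/val_inj.
exact: (row_mxEr (\row_(j < 1) p.1) p.2 0 i).
Qed.

Lemma consRVK n : cancel (@consRV n) (@unconsRV n).
Proof.
move=> [a v]; rewrite /unconsRV consRV0; congr (_, _).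
by apply/rowP => i; rewrite mxE consRV_lift.
Qed.

Lemma measurable_consRV n :
  measurable_fun setT (@consRV n : measurableTypeR R * borelRV R n -> borelRV R n.+1).
Proof.
apply: measurable_funRV => i; have [j ->|->] := unliftP ord0 i.
  apply: (eq_measurable_fun (fun p : measurableTypeR R * borelRV R n => (p.2 : 'rV[R]_n) 0 j)).
    by move=> p _; rewrite consRV_lift.
  by apply: (measurableT_comp (measurable_coordRV j)); exact: measurable_snd.
apply: (eq_measurable_fun (fun p : measurableTypeR R * borelRV R n => p.1)).
  by move=> p _; rewrite consRV0.
exact: measurable_fst.
Qed.

Lemma measurable_unconsRV n :
  measurable_fun setT (@unconsRV n : borelRV R n.+1 -> measurableTypeR R * borelRV R n).
Proof.
apply/measurable_fun_pairP; split; first exact: measurable_coordRV.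
apply: measurable_funRV => i.
apply: (eq_measurable_fun (fun x : borelRV R n.+1 => (x : 'rV[R]_n.+1) 0 (lift ord0 i))).
  by move=> x _; rewrite /= mxE.
exact: measurable_coordRV.
Qed.

End BorelRV.

Section ConsMeasure.
Context {R : realType} (n : nat).
Variable m : {sigma_finite_measure set (borelRV R n) -> \bar R}.
Local Open Scope ereal_scope.

Let mprod := (@lebesgue_measure R \x m)%E.

(** The image of a product measure. Sigma-finiteness is carried along because Tonelli needs it again
    in the next dimension. *)
Definition cons_measure : set (borelRV R n.+1) -> \bar R :=
  fun A => mprod (@consRV R n @^-1` A).

Let measurable_preimage (A : set (borelRV R n.+1)) : measurable A ->
  measurable (@consRV R n @^-1` A : set (measurableTypeR R * borelRV R n)).
Proof.
by move=> mA; rewrite -[X in measurable X]setTI; exact: (@measurable_consRV R n measurableT A mA).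
Qed.

Let cons_measure0 : cons_measure set0 = 0.
Proof. by rewrite /cons_measure preimage_set0; exact: (measure0 (@lebesgue_measure R \x m)). Qed.

Let cons_measure_ge0 A : 0 <= cons_measure A.
Proof. exact: (measure_ge0 (@lebesgue_measure R \x m)). Qed.

Let cons_measure_sigma_additive : semi_sigma_additive cons_measure.
Proof.
move=> F mF tF mUF; rewrite /cons_measure preimage_bigcup.
apply: (@measure_semi_sigma_additive _ _ _ (@lebesgue_measure R \x m)).
- by move=> k; exact: measurable_preimage.
- apply/trivIsetP => /= i j _ _ ij; rewrite -preimage_setI.
  by move/trivIsetP : tF => /(_ _ _ _ _ ij) ->//; rewrite preimage_set0.
- by rewrite -preimage_bigcup; exact: measurable_preimage.
Qed.

HB.instance Definition _ := isMeasure.Build _ _ _ cons_measure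
  cons_measure0 cons_measure_ge0 cons_measure_sigma_additive.

Let cons_measure_sigma_finite : sigma_finite setT cons_measure.
Proof.
have /sigma_finiteP[F [TF ndF Foo]] := sigma_finiteT (@lebesgue_measure R).
have /sigma_finiteP[G [TG ndG Goo]] := sigma_finiteT m.
exists (fun k => @unconsRV R n @^-1` (F k `*` G k)).
  apply/seteqP; split => // x _.
  have : [set: R] (unconsRV x).1 by []; rewrite TF => -[i _ Fi].
  have : [set: 'rV[R]_n] (unconsRV x).2 by []; rewrite TG => -[j _ Gj].
  exists (maxn i j) => //; split => /=.
    by move: Fi; apply/subsetPset/ndF/leq_maxl.
  by move: Gj; apply/subsetPset/ndG/leq_maxr.
move=> k; have [mF oF] := Foo k; have [mG oG] := Goo k; split.
  rewrite -[X in measurable X]setTI.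
  by apply: (@measurable_unconsRV R n measurableT); exact: measurableX.
rewrite /cons_measure (_ : consRV (n:=n) @^-1` _ = F k `*` G k).
  by rewrite /mprod product_measure1E// lte_mul_pinfty// ge0_fin_numE.
by apply/funext => x; rewrite /preimage /mkset consRVK.
Qed.

HB.instance Definition _ := Measure_isSigmaFinite.Build _ _ _ cons_measure
  cons_measure_sigma_finite.

Lemma integral_cons_measure (f : borelRV R n.+1 -> \bar R) :
  measurable_fun setT f -> (forall x, 0 <= f x) ->
  \int[cons_measure]_x f x =
  \int[@lebesgue_measure R]_x \int[m]_v f (consRV (x, v)).
Proof.
move=> mf f0.
have := @ge0_integral_pushforward _ _ _ _ R _ (@measurable_consRV R n) mprod setT f
  measurableT mf (fun x _ => f0 x).
rewrite preimage_setT => e.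
transitivity (\int[mprod]_x (f \o @consRV R n) x).
  by rewrite -e; apply: eq_measure_integral => //; exact: measurable_consRV.
by rewrite fubini_tonelli1//=; exact: (measurableT_comp mf (@measurable_consRV R n)).
Qed.

End ConsMeasure.

Section LebesgueRV.
Context {R : realType}.
Local Open Scope ereal_scope.

Lemma iint_ge0 n (f : 'rV[R]_n -> \bar R) : (forall x, 0 <= f x) -> 0 <= iint f.
Proof.
elim: n f => [|n IH] f f0 /=; first exact: f0.
by apply: integral_ge0 => x _; exact: IH.
Qed.

(** Integrals of nonnegative functions are suprema over simple functions below them, hence monotone
    for arbitrary functions. This lets [lmeas] compare arbitrary sets, boundary strips included. *)
Lemma ge0_le_integralT d (T : measurableType d) (m : {measure set T -> \bar R})
    (f g : T -> \bar R) : (forall x, 0 <= f x) -> (forall x, f x <= g x) ->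
  \int[m]_x f x <= \int[m]_x g x.
Proof.
move=> f0 fg; have g0 x : 0 <= g x := le_trans (f0 x) (fg x).
rewrite !ge0_integralTE//; apply: le_ereal_sup => _ [h hf <-].
by exists h => // x; exact: le_trans (hf x) (fg x).
Qed.

Lemma le_iint n (f g : 'rV[R]_n -> \bar R) : (forall x, 0 <= f x) ->
  (forall x, f x <= g x) -> iint f <= iint g.
Proof.
elim: n f g => [|n IH] f g f0 fg /=; first exact: fg.
apply: ge0_le_integralT => x; first exact: iint_ge0.
exact: IH.
Qed.

Lemma exists_lebesgueRV n : exists m : {sigma_finite_measure set (borelRV R n) -> \bar R},
  forall f : borelRV R n -> \bar R, measurable_fun setT f -> (forall x, 0 <= f x) ->
  iint (f : 'rV[R]_n -> \bar R) = \int[m]_x f x.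
Proof.
elim: n => [|n [m mE]].
  pose z : borelRV R 0 := (0%R : 'rV[R]_0).
  exists (dirac z) => f mf f0 /=.
  by rewrite integral_dirac// diracT mul1e.
exists (cons_measure m) => f mf f0 /=.
rewrite integral_cons_measure//; apply: eq_integral => x _.
by rewrite mE// => v; exact: (measurableT_comp mf
  (measurableT_comp (@measurable_consRV R n) (pair1_measurable x))).
Qed.

(** Convertible to the measure in the statement. The measure axioms, which concern measurable sets,
    are imported from [exists_lebesgueRV]. *)
Definition lebesgueRV n : set (borelRV R n) -> \bar R := @lmeas R n.

Let lebesgueRV_ex n : exists m : {sigma_finite_measure set (borelRV R n) -> \bar R},
  forall A, measurable A -> lebesgueRV A = m A.
Proof.
have [m mE] := exists_lebesgueRV n; exists m => A mA.
rewrite /lebesgueRV /lmeas mE; last by move=> x; rewrite lee_fin.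
  by rewrite integral_indic// setIT.
by apply/measurable_EFinP; exact: measurable_indic.
Qed.

Let lebesgueRV0 n : @lebesgueRV n set0 = 0.
Proof. by have [m mE] := lebesgueRV_ex n; rewrite mE// measure0. Qed.

Let lebesgueRV_ge0 n A : 0 <= @lebesgueRV n A.
Proof. by apply: iint_ge0 => x; rewrite lee_fin. Qed.

Let lebesgueRV_sigma_additive n : semi_sigma_additive (@lebesgueRV n).
Proof.
have [m mE] := lebesgueRV_ex n => F mF tF mUF; rewrite mE//.
under eq_fun do (under eq_bigr do rewrite mE//).
exact: measure_semi_sigma_additive.
Qed.

HB.instance Definition _ n := isMeasure.Build _ _ _ (@lebesgueRV n)
  (@lebesgueRV0 n) (@lebesgueRV_ge0 n) (@lebesgueRV_sigma_additive n).

Let lebesgueRV_sigma_finite n : sigma_finite setT (@lebesgueRV n).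
Proof.
have [m mE] := lebesgueRV_ex n; have [F TF Foo] := sigma_finiteT m.
by exists F => // k; have [mFk Fk] := Foo k; rewrite mE.
Qed.

HB.instance Definition _ n := Measure_isSigmaFinite.Build _ _ _ (@lebesgueRV n)
  (@lebesgueRV_sigma_finite n).

Lemma iintE n (f : 'rV[R]_n -> \bar R) :
  measurable_fun setT (f : borelRV R n -> \bar R) -> (forall x, 0 <= f x) ->
  iint f = \int[@lebesgueRV n]_x f x.
Proof.
move=> mf f0; have [m mE] := exists_lebesgueRV n; rewrite mE//.
apply: eq_measure_integral => A mA _ /=.
rewrite /lebesgueRV /lmeas mE; last by move=> x; rewrite lee_fin.
  by rewrite integral_indic// setIT.
by apply/measurable_EFinP; exact: measurable_indic.
Qed.

Lemma intOnE n (Om : set 'rV[R]_n) (f : 'rV[R]_n -> \bar R) :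
  measurable (Om : set (borelRV R n)) ->
  measurable_fun setT (f : borelRV R n -> \bar R) -> (forall x, 0 <= f x) ->
  intOn Om f = \int[@lebesgueRV n]_(x in Om) f x.
Proof.
move=> mOm mf f0; rewrite integral_mkcond /intOn.
have E : (fun x => if `[< Om x >] then f x else 0) = (f \_ Om).
  by apply/funext => x; rewrite patchE; congr (if _ then _ else _); rewrite -in_setE.
rewrite E iintE//; last by move=> x; rewrite patchE; case: ifP.
by apply/(measurable_restrictT _ _).1 => //; exact: measurable_funTS.
Qed.

Lemma measurable_prodRV n (f : 'I_n -> R -> R) :
  (forall i, measurable_fun setT (f i)) ->
  measurable_fun setT (fun x : borelRV R n => (\prod_i f i ((x : 'rV[R]_n) ord0 i))%R).
Proof.
move=> mf; elim: (index_enum 'I_n) => [|i s IH].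
  apply: (@eq_measurable_fun _ _ (borelRV R n) R setT (fun=> 1%R)) => [x _|];
    last exact: measurable_cst.
  by rewrite big_nil.
apply: (eq_measurable_fun (fun x : borelRV R n =>
  f i ((x : 'rV[R]_n) ord0 i) * \prod_(j <- s) f j ((x : 'rV[R]_n) ord0 j))%R).
  by move=> x _; rewrite big_cons.
by apply: measurable_funM => //; apply: measurableT_comp => //; exact: measurable_coordRV.
Qed.

Lemma iint_prod n (f : 'I_n -> R -> R) : (forall i, measurable_fun setT (f i)) ->
  (forall i x, (0 <= f i x)%R) ->
  iint (fun x : 'rV[R]_n => (\prod_i f i (x ord0 i))%:E) =
  \prod_i \int[@lebesgue_measure R]_x (f i x)%:E.
Proof.
elim: n f => [|n IH] f mf f0 /=; first by rewrite !big_ord0.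
rewrite big_ord_recl.
have P0 : 0 <= \prod_(i < n) \int[@lebesgue_measure R]_x (f (lift ord0 i) x)%:E.
  by apply: prode_ge0 => i _; apply: integral_ge0 => x _; rewrite lee_fin.
rewrite -ge0_integralZr//; last 2 first.
  by apply/measurable_EFinP; exact: mf.
  by move=> x _; rewrite lee_fin.
apply: eq_integral => x _; rewrite -IH//.
have E v : (\prod_(i < n.+1) f i (row_mx (\row_(j < 1) x) v ord0 i))%R =
    (f ord0 x * \prod_(i < n) f (lift ord0 i) (v ord0 i))%R.
  rewrite big_ord_recl -[row_mx _ _]/(consRV (x, v)) consRV0; congr (_ * _)%R.
  by apply: eq_bigr => i _; rewrite consRV_lift.
have p0 (v : 'rV[R]_n) : 0 <= (\prod_(i < n) f (lift ord0 i) (v ord0 i))%:E.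
  by rewrite lee_fin prodr_ge0.
have mp : measurable_fun setT (fun v : borelRV R n =>
    (\prod_(i < n) f (lift ord0 i) ((v : 'rV[R]_n) ord0 i))%:E).
  by apply/measurable_EFinP; apply: (@measurable_prodRV n (fun i => f (lift ord0 i))).
transitivity (iint (fun v : 'rV[R]_n => (f ord0 x)%:E *
    (\prod_(i < n) f (lift ord0 i) (v ord0 i))%:E)).
  by congr iint; apply/funext => v; rewrite E EFinM.
rewrite !iintE//.
- by rewrite ge0_integralZl_EFin.
- exact: measurable_funeM.
- by move=> v; rewrite mule_ge0// lee_fin.
Qed.

Definition cubeRV n (r : R) : set 'rV[R]_n :=
  [set x | forall i, (`|x ord0 i| <= r)%R].

Arguments cubeRV : clear implicits.

Lemma measurable_cubeRV n r : measurable (cubeRV n r : set (borelRV R n)).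
Proof.
rewrite (_ : cubeRV n r = ~` \bigcup_(i in [set: 'I_n])
    ~` [set x : 'rV[R]_n | (`|x ord0 i| <= r)%R]).
  apply/measurableC/fin_bigcup_measurable => // i _; apply: measurableC.
  rewrite -[X in measurable X]setTI.
  apply: (measurable_fun_ler _ (@measurable_cst _ _ _ _ setT r) measurableT) => //.
  by apply: measurableT_comp => //; exact: measurable_coordRV.
apply/seteqP; split => x /= H; first by case=> i _; apply; exact: H.
by move=> i; apply: contrapT => nH; apply: H; exists i.
Qed.

Lemma lebesgueRV_cube n (r : R) : (0 < r)%R ->
  lebesgueRV (cubeRV n r) = ((2 * r) ^+ n)%:E.
Proof.
move=> r0; transitivity (iint (fun x : 'rV[R]_n =>
    (\prod_(i < n) \1_(`[- r, r]%classic) (x ord0 i))%:E) : \bar R).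
  rewrite /lebesgueRV /lmeas; congr iint; apply/funext => x; congr EFin.
  rewrite indicE; have [xc|nxc] := pselect (cubeRV n r x).
    rewrite mem_set//= big1// => i _; rewrite indicE mem_set//=.
    by rewrite in_itv/= -ler_norml; exact: xc.
  rewrite memNset//=; apply/esym/eqP/prodf_eq0.
  apply: contrapT => H; apply: nxc => i; apply: contrapT => xi; apply: H.
  exists i => //; rewrite indicE memNset//=.
  by rewrite in_itv/= -ler_norml.
rewrite (@iint_prod n (fun=> \1_(`[(- r)%R, r]%classic : set R))) => [|i|i x].
- have e : lebesgue_measure (`[(- r)%R, r]%classic : set R) = (2 * r)%:E.
    by rewrite lebesgue_measure_itv/= lte_fin gtrN// -EFinB; congr EFin; ring.
  transitivity (\prod_(i < n) (2 * r)%:E); last by rewrite prodEFin prodr_const card_ord.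
  by apply: eq_bigr => i _; rewrite integral_indic// setIT.
- by apply: measurable_indic; exact: measurable_itv.
- by [].
Qed.

End LebesgueRV.

Arguments cubeRV {R} n r.

(** * Translations and directional derivatives *)

Section Translation.
Context {R : realType}.

Lemma lebesgue_measure_shift (a : R) (A : set R) : measurable A ->
  pushforward (@lebesgue_measure R) ((fun x => x + a) : _ -> measurableTypeR R) A =
  lebesgue_measure A.
Proof.
move=> mA; apply/esym/lebesgue_measure_unique => //=.
  by apply: measurable_funD => //; exact: measurable_cst.
move=> mf _ [[x y]] _ <-.
rewrite /pushforward (_ : _ @^-1` _ = `]x - a, y - a]%classic).
  rewrite !lebesgue_measure_itv/= !lte_fin ltrD2r.
  by case: ifP => // _; rewrite -!EFinB; congr EFin; ring.
by apply/seteqP; split => z /=; rewrite !in_itv/= lerBrDr ltrBlDr.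
Qed.

Lemma ge0_integral_shift (a : R) (f : R -> \bar R) :
  measurable_fun setT f -> (forall x, 0 <= f x)%E ->
  (\int[@lebesgue_measure R]_x f (x + a)%R = \int[@lebesgue_measure R]_x f x)%E.
Proof.
move=> mf f0.
have ms : measurable_fun setT ((fun x => x + a) : measurableTypeR R -> measurableTypeR R).
  by apply: measurable_funD => //; exact: measurable_cst.
have := @ge0_integral_pushforward _ _ _ _ R _ ms (@lebesgue_measure R) setT f
  measurableT mf (fun x _ => f0 x).
rewrite preimage_setT => /= <-.
by apply: eq_measure_integral => //= A mA _; exact: lebesgue_measure_shift.
Qed.

Lemma measurable_shiftRV n (a : 'rV[R]_n) :
  measurable_fun setT ((fun x => x + a) : borelRV R n -> borelRV R n).
Proof.
apply: measurable_funRV => i.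
apply: (@eq_measurable_fun _ _ (borelRV R n) R setT
  (fun x : borelRV R n => (x : 'rV[R]_n) 0 i + a 0 i)) => [x _|].
  by rewrite mxE.
by apply: measurable_funD; [exact: measurable_coordRV|exact: measurable_cst].
Qed.

Lemma measurable_reflectRV n (a : 'rV[R]_n) :
  measurable_fun setT ((fun x => a - x) : borelRV R n -> borelRV R n).
Proof.
apply: measurable_funRV => i.
apply: (@eq_measurable_fun _ _ (borelRV R n) R setT
  (fun x : borelRV R n => a 0 i - (x : 'rV[R]_n) 0 i)) => [x _|].
  by rewrite !mxE.
by apply: measurable_funB; [exact: measurable_cst|exact: measurable_coordRV].
Qed.

Lemma iint_shift n (a : 'rV[R]_n) (f : 'rV[R]_n -> \bar R) :
  measurable_fun setT (f : borelRV R n -> \bar R) -> (forall x, 0 <= f x)%E ->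
  iint (fun x => f (x + a)) = iint f.
Proof.
elim: n a f => [|n IH] a f mf f0 /=; first by rewrite add0r (thinmx0 a).
have mfx (x : R) : measurable_fun setT
    ((fun v => f (consRV (x, v))) : borelRV R n -> \bar R).
  apply: (measurableT_comp mf).
  exact: (measurableT_comp (@measurable_consRV R n) (pair1_measurable x)).
pose g x := iint (fun v : 'rV[R]_n => f (consRV (x, v))).
have gE x : (g x = \int[@lebesgueRV R n]_v f (consRV (x, v)))%E by rewrite /g iintE.
transitivity (\int[@lebesgue_measure R]_x g (x + (unconsRV a).1)%R)%E.
  apply: eq_integral => x _; rewrite /g.
  transitivity (iint (fun v : 'rV[R]_n =>
      f (consRV (x + (unconsRV a).1, v + (unconsRV a).2)))); last first.
    exact: (IH _ (fun v => f (consRV (x + (unconsRV a).1, v)))).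
  congr iint; apply/funext => v; congr f.
  rewrite -[row_mx _ _]/(consRV (x, v)); apply/rowP => i.
  rewrite mxE; have [j ->|->] := unliftP ord0 i.
    by rewrite !consRV_lift !mxE.
  by rewrite !consRV0.
apply: ge0_integral_shift => [|x]; last exact: iint_ge0.
apply: (@eq_measurable_fun _ _ (measurableTypeR R) (\bar R) setT
  (fun x => \int[@lebesgueRV R n]_v f (consRV (x, v)))%E) => [x _|].
  by rewrite gE.
apply: (@measurable_fun_fubini_tonelli_F _ _ (measurableTypeR R) (borelRV R n) R
   (@lebesgueRV R n) (f \o @consRV R n)) => [|x]; last exact: f0.
exact: (measurableT_comp mf (@measurable_consRV R n)).
Qed.

Notation lebN n := (@lebesgueRV R n).

Lemma ge0_integralRV_shift n (a : 'rV[R]_n) (f : 'rV[R]_n -> \bar R) :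
  measurable_fun setT (f : borelRV R n -> \bar R) -> (forall x, 0 <= f x)%E ->
  (\int[lebN n]_x f (x + a)%R = \int[lebN n]_x f x)%E.
Proof.
move=> mf f0; rewrite -!iintE// ?iint_shift//.
exact: (measurableT_comp mf (measurable_shiftRV a)).
Qed.

Lemma integralRV_shift n (a : 'rV[R]_n) (f : 'rV[R]_n -> R) :
  measurable_fun setT (f : borelRV R n -> R) ->
  \int[lebN n]_x f (x + a) = \int[lebN n]_x f x.
Proof.
move=> mf; congr fine; rewrite integralE [RHS]integralE.
have mE : measurable_fun setT (EFin \o f : borelRV R n -> \bar R).
  exact/measurable_EFinP.
congr (_ - _)%E.
  rewrite -[RHS](ge0_integralRV_shift a (measurable_funepos mE) (fun x => funepos_ge0 _ x)).
  by apply: eq_integral => x _; rewrite funepos.unlock.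
rewrite -[RHS](ge0_integralRV_shift a (measurable_funeneg mE) (fun x => funeneg_ge0 _ x)).
by apply: eq_integral => x _; rewrite funeneg.unlock.
Qed.

Lemma integrableRV_shift n (a : 'rV[R]_n) (f : 'rV[R]_n -> R) :
  (lebN n).-integrable setT (EFin \o f) ->
  (lebN n).-integrable setT (fun x => (f (x + a))%:E).
Proof.
move=> /integrableP[mf f1]; apply/integrableP; split.
  exact: (measurableT_comp mf (measurable_shiftRV a)).
rewrite (@ge0_integralRV_shift n a (fun x => `|(f x)%:E|%E))//.
exact: measurableT_comp.
Qed.

End Translation.

Section LineDerivative.
Context {R : realType} {V : normedModType R}.

Lemma derivable_line (f : V -> R) (x v : V) (t : R) :
  derivable f (t *: v + x) v -> derivable (fun s : R => f (s *: v + x)) t 1.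
Proof.
rewrite /derivable => H.
suff -> : (fun h => h^-1 *: (((fun s : R => f (s *: v + x)) \o shift t) (h *: 1) -
    f (t *: v + x))) =
  (fun h => h^-1 *: ((f \o shift (t *: v + x)) (h *: v) - f (t *: v + x))) by [].
by apply/funext => h /=; rewrite [h *: 1]mulr1 scalerDl addrA.
Qed.

Lemma derive_line (f : V -> R) (x v : V) (t : R) :
  'D_1 (fun s : R => f (s *: v + x)) t = 'D_v f (t *: v + x).
Proof.
rewrite /derive.
suff -> : (fun h => h^-1 *: (((fun s : R => f (s *: v + x)) \o shift t) (h *: 1) -
    f (t *: v + x))) =
  (fun h => h^-1 *: ((f \o shift (t *: v + x)) (h *: v) - f (t *: v + x))) by [].
by apply/funext => h /=; rewrite [h *: 1]mulr1 scalerDl addrA.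
Qed.

Lemma line_derivable0 (f : V -> R) (x v : V) :
  derivable (fun s : R => f (s *: v + x)) 0 1 -> derivable f x v.
Proof.
rewrite /derivable => H.
suff -> : (fun h => h^-1 *: ((f \o shift x) (h *: v) - f x)) =
  (fun h => h^-1 *: (((fun s : R => f (s *: v + x)) \o shift 0) (h *: 1) -
    f (0 *: v + x))) by [].
by apply/funext => h /=; rewrite [h *: 1]mulr1 addr0 scale0r add0r.
Qed.

End LineDerivative.

Lemma integrable_indic_lty d (T : measurableType d) (R : realType)
    (m : {measure set T -> \bar R}) (A : set T) : measurable A ->
  (m A < +oo)%E -> m.-integrable setT (fun x => (\1_A x : R)%:E).
Proof.
move=> mA Afin; apply/integrableP; split.
  by apply/measurable_EFinP; exact: measurable_indic.
under eq_integral do rewrite gee0_abs ?lee_fin//.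
by rewrite integral_indic// setIT.
Qed.

Section DirectionalCalculus.
Context {R : realType} (n : nat).
Notation rV := ('rV[R]_n).
Notation leb := (@lebesgueRV R n).
Implicit Types (f psi : rV -> R) (v x : rV).

(** Differentiation under the integral along the line through [x] in direction [v], dominated by |f|
    times the bound [C] for the derivative of the kernel. *)
Lemma convolution_derive f psi v (C0 C : R) :
  leb.-integrable setT (EFin \o f) ->
  measurable_fun setT (psi : borelRV R n -> R) ->
  (forall x, `|psi x| <= C0) -> (forall x, derivable psi x v) ->
  (forall x, `|'D_v psi x| <= C) ->
  forall x, derivable (fun x => \int[leb]_y (f y * psi (x - y))) x v /\
    'D_v (fun x => \int[leb]_y (f y * psi (x - y))) x =
    \int[leb]_y (f y * 'D_v psi (x - y)).
Proof.
move=> If mpsi psiC0 dpsi dpsiC x.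
have C0_ge0 : 0 <= C0 by apply: le_trans (psiC0 0).
have C_ge0 : 0 <= C by apply: le_trans (dpsiC 0).
set F := fun x : rV => _.
pose h (s : R) (y : borelRV R n) := f y * psi (s *: v + (x - y)).
have FE s : F (s *: v + x) = \int[leb]_y h s y.
  by apply: eq_Rintegral => y _; rewrite /h addrA.
have I0 : (`]-1, 1[%classic : set R) 0 by rewrite /= in_itv/= ltrN10 ltr01.
have Ih s : (`]-1, 1[%classic : set R) s -> leb.-integrable setT (EFin \o h s).
  move=> _; rewrite /h /comp; under eq_fun do rewrite EFinM.
  apply: integrableMl => //.
    apply: (eq_measurable_fun (fun y : borelRV R n => psi ((s *: v + x) - y))).
      by move=> y _; rewrite addrA.
    exact: (measurableT_comp mpsi (measurable_reflectRV _)).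
  exists C0; split; first exact: num_real.
  by move=> M CM y _; apply: le_trans (ltW CM).
have dh s y : (`]-1, 1[%classic : set R) s -> [set: borelRV R n] y ->
    derivable (h ^~ y) s 1.
  move=> _ _; rewrite /h.
  apply: (@derivableZ _ _ _ (fun s : R => psi (s *: v + (x - y))) (f y)).
  exact: derivable_line.
have dhE s y : partial1of2 h s y = f y * 'D_v psi (s *: v + (x - y)).
  rewrite partial1of2E -derive_line.
  apply: (@deriveZ _ _ _ (fun s : R => psi (s *: v + (x - y))) (f y)).
  exact: derivable_line.
pose G (y : borelRV R n) := `|f y| * C.
have G0 y : 0 <= G y by rewrite mulr_ge0.
have IG : leb.-integrable setT (EFin \o G).
  rewrite /G /comp; under eq_fun do rewrite EFinM.
  by apply: integrableZr => //; exact: integrable_norm.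
have hG s y : (`]-1, 1[%classic : set R) s -> [set: borelRV R n] y ->
    `|partial1of2 h s y| <= G y.
  by move=> _ _; rewrite dhE normrM ler_wpM2l.
have FEf : (fun s : R => F (s *: v + x)) = (fun s => \int[leb]_y h s y).
  by apply/funext => s; exact: FE.
have D := derivable_under_integral measurableT I0 Ih dh G0 IG hG.
have E := differentiation_under_integral measurableT I0 Ih dh G0 IG hG.
rewrite -FEf in D E; split; first exact: line_derivable0.
have -> : 'D_v F x = 'D_1 (fun s : R => F (s *: v + x)) 0.
  by rewrite derive_line scale0r add0r.
rewrite -derive1E E; apply: eq_Rintegral => y _.
by rewrite dhE scale0r add0r.
Qed.

(** By translation invariance the integral of psi(x + s e_i) does not depend on [s]; its derivative
    at 0, taken under the integral, is the left-hand side. Enlarging the cube by 1 accommodates all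
    shifts with |s| < 1 and provides the dominating function. *)
Lemma integral_derive_eq0 psi (i : 'I_n) (r C : R) :
  measurable_fun setT (psi : borelRV R n -> R) ->
  (forall x, ~ cubeRV n r x -> psi x = 0) ->
  (forall x, `|psi x| <= C) ->
  (forall x, derivable psi x (evec R i)) ->
  (forall x, `|'D_(evec R i) psi x| <= C) -> 0 < r ->
  \int[leb]_x 'D_(evec R i) psi x = 0.
Proof.
move=> mpsi psi0 psiC dpsi dpsiC r0; set v := evec R i.
have C0 : 0 <= C by apply: le_trans (psiC 0).
have mcube s : measurable (cubeRV n s : set (borelRV R n)).
  exact: measurable_cubeRV.
have shift_out (s : R) x : (`]-1, 1[%classic : set R) s ->
    ~ cubeRV n (r + 1) x -> ~ cubeRV n r (s *: v + x).
  rewrite /= in_itv/= => /andP[s1 s2] nx H; apply: nx => j.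
  have := H j; rewrite !mxE eqxx/=.
  have : `|s * (j == i)%:R| <= 1.
    case: (j == i); rewrite ?mulr1 ?mulr0 ?normr0 ?ler01//.
    by rewrite ler_norml (ltW s1) (ltW s2).
  set a := s * _ => a1 ax.
  have -> : x ord0 j = (a + x ord0 j) - a by rewrite addrC addKr.
  by apply: le_trans (ler_normB _ _) _; exact: lerD.
have dpsi_out x : ~ cubeRV n (r + 1) x -> forall s : R, (`]-1, 1[%classic : set R) s ->
    'D_v psi (s *: v + x) = 0.
  move=> nx s sI; rewrite -derive_line.
  rewrite (_ : 0 = 'D_1 (cst 0 : R -> R) s); last by rewrite derive_cst.
  apply: near_eq_derive.
  have : \forall z \near s, `]-1, 1[%classic z by apply: near_in_itvoo.
  by apply: filterS => z zI; rewrite psi0//; exact: shift_out.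
have Icube (s : R) : leb.-integrable setT (fun x => (C * \1_(cubeRV n s) x)%:E).
  under eq_fun do rewrite EFinM.
  apply: integrableZl => //; apply: integrable_indic_lty; first exact: mcube.
  apply: (@le_lt_trans _ _ (leb (cubeRV n (`|s| + 1)))).
    apply: le_measure; rewrite ?inE//; [exact: mcube..|].
    by move=> x xs j; apply: le_trans (xs j) _; rewrite (le_trans (ler_norm _))// lerDl.
  by rewrite lebesgueRV_cube ?ltry// ltr_wpDl.
pose h (s : R) (x : borelRV R n) := psi (s *: v + x).
have mh s : measurable_fun setT (h s).
  apply: (eq_measurable_fun (fun x : borelRV R n => psi (x + s *: v))).
    by move=> y _; rewrite /h addrC.
  exact: (measurableT_comp mpsi (measurable_shiftRV _)).
have I0 : (`]-1, 1[%classic : set R) 0 by rewrite /= in_itv/= ltrN10 ltr01.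
have Ih s : (`]-1, 1[%classic : set R) s -> leb.-integrable setT (EFin \o h s).
  move=> sI; apply: (le_integrable measurableT _ _ (Icube (r + 1))).
    exact/measurable_EFinP.
  move=> x _; rewrite !abse_EFin lee_fin /h.
  have [xr|nxr] := pselect (cubeRV n (r + 1) x).
    by rewrite indicE mem_set//= mulr1 (le_trans (psiC _))// ler_norm.
  by rewrite psi0 ?normr0//; exact: shift_out.
have dh s y : (`]-1, 1[%classic : set R) s -> [set: borelRV R n] y ->
    derivable (h ^~ y) s 1.
  by move=> _ _; exact: derivable_line.
have dhE s y : partial1of2 h s y = 'D_v psi (s *: v + y).
  by rewrite partial1of2E -derive_line.
pose G (x : borelRV R n) := C * \1_(cubeRV n (r + 1)) x.
have G0 y : 0 <= G y by rewrite mulr_ge0.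
have hG s y : (`]-1, 1[%classic : set R) s -> [set: borelRV R n] y ->
    `|partial1of2 h s y| <= G y.
  move=> sI _; rewrite dhE /G.
  have [xr|nxr] := pselect (cubeRV n (r + 1) y).
    by rewrite indicE mem_set//= mulr1.
  by rewrite dpsi_out// normr0 mulr_ge0.
have E := differentiation_under_integral measurableT I0 Ih dh G0 (Icube (r + 1)) hG.
have hc : (fun s => \int[leb]_y h s y) = cst (\int[leb]_y psi y).
  apply/funext => s; rewrite -(integralRV_shift (s *: v) mpsi).
  by apply: eq_Rintegral => y _; rewrite /h addrC.
rewrite hc derive1_cst in E.
rewrite E; apply: eq_Rintegral => y _; by rewrite dhE scale0r add0r.
Qed.

End DirectionalCalculus.

(** * Smooth bumps *)

Lemma is_derive0_quadratic (R : realType) (f : R -> R) (x K : R) :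
  (forall h, `|f (h + x)| <= K * h ^+ 2) -> is_derive x 1 f 0.
Proof.
move=> fK; have K0 : 0 <= K.
  by apply: le_trans (normr_ge0 _) _; have := fK 1; rewrite expr1n mulr1; apply.
have fx : f x = 0.
  by apply/eqP; rewrite -normr_le0; have := fK 0; rewrite add0r expr0n mulr0.
have H : (fun h => h^-1 *: ((f \o shift x) (h *: 1) - f x)) @ 0^' --> (0 : R).
  apply/cvgrPdist_lt => e e0; near=> h.
  have h0 : h != 0 by near: h; exact: nbhs_dnbhs_neq.
  have hp : 0 < `|h| by rewrite normr_gt0.
  rewrite sub0r normrN fx subr0 normrZ normfV ltr_pdivrMl//= [h *: 1]mulr1.
  apply: (le_lt_trans (fK h)).
  rewrite -(real_normK (num_real h)) expr2 mulrCA ltr_pM2l//.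
  have hlt : `|h| < e / (K + 1) by near: h; apply: dnbhs0_lt; rewrite divr_gt0// ltr_wpDl.
  apply: (@le_lt_trans _ _ ((K + 1) * `|h|)); first by rewrite ler_wpM2r// lerDl.
  by rewrite mulrC -ltr_pdivlMr// ltr_wpDl.
by apply: DeriveDef; [apply/cvg_ex; exists 0|exact/cvg_lim].
Unshelve. all: by end_near. Qed.

Section FlatFunctions.
Context {R : realType}.
Implicit Types (t y : R) (n : nat).

(** The classical function exp(-1/t), flat at 0, multiplied by t^(-n): with all these powers the
    family is closed under derivation up to linear combinations. *)
Definition flat n t : R := if 0 < t then t^-1 ^+ n * expR (- t^-1) else 0.

Lemma flat_ge0 n t : 0 <= flat n t.
Proof.
rewrite /flat; case: ifPn => // t0.
by rewrite mulr_ge0 ?expR_ge0// exprn_ge0// invr_ge0 ltW.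
Qed.

Lemma flat_gt0 t : 0 < t -> 0 < flat 0 t.
Proof. by move=> t0; rewrite /flat t0 expr0 mul1r expR_gt0. Qed.

Lemma flat_eq0 n t : t <= 0 -> flat n t = 0.
Proof. by move=> t0; rewrite /flat ltNge t0. Qed.

(** For positive [n] this is the [n]-th power of y/n <= exp(y/n). *)
Lemma exprn_expRN_le n y : 0 <= y -> y ^+ n * expR (- y) <= n%:R ^+ n.
Proof.
move=> y0; case: n => [|n].
  by rewrite !expr0 mul1r -expR0 ler_expR oppr_le0.
rewrite expRN ler_pdivrMr ?expR_gt0//.
have n0 : n.+1%:R != 0 :> R by rewrite pnatr_eq0.
have -> : expR y = expR (y / n.+1%:R) ^+ n.+1.
  by rewrite -expRM_natl mulrC divfK.
rewrite -exprMn; apply: lerXn2r; rewrite ?nnegrE ?mulr_ge0 ?expR_ge0//.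
rewrite -ler_pdivrMl ?ltr0n// mulrC.
by apply: le_trans (expR_ge1Dx _); rewrite lerDr.
Qed.

Lemma flat_le n t : flat n t <= n%:R ^+ n.
Proof.
rewrite /flat; case: ifPn => t0; last by rewrite exprn_ge0.
by apply: exprn_expRN_le; rewrite invr_ge0 ltW.
Qed.

Lemma flatS n t : flat n t = t * flat n.+1 t.
Proof.
rewrite /flat; case: ifPn => t0; last by rewrite mulr0.
by rewrite exprS !mulrA divff ?mul1r// gt_eqF.
Qed.

Lemma flat_nondecreasing s t : s <= t -> flat 0 s <= flat 0 t.
Proof.
move=> st; have [s0|s0] := leP s 0; first by rewrite flat_eq0// flat_ge0.
have t0 := lt_le_trans s0 st.
by rewrite /flat s0 t0 !expr0 !mul1r ler_expR lerN2 lef_pV2.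
Qed.

Lemma flat_quadratic n t : `|flat n t| <= n.+2%:R ^+ n.+2 * t ^+ 2.
Proof.
rewrite ger0_norm ?flat_ge0// flatS flatS mulrA -expr2 mulrC.
by apply: ler_wpM2r; [exact: sqr_ge0|exact: flat_le].
Qed.

Lemma is_derive_flat n t :
  is_derive t 1 (flat n) (flat n.+2 t - n%:R * flat n.+1 t).
Proof.
have [t0|t0|<-] := ltgtP 0 t.
- pose g : R -> R := (fun s : R => s^-1) ^+ n * (expR \o (fun s : R => - s^-1)).
  have gE : \near t, g t = flat n t.
    have : \forall s \near t, 0 < s by exact: lt_nbhsr.
    apply: filterS => s s0; rewrite /flat s0 /g.
    by rewrite -[LHS]/(((fun s : R => s^-1) ^+ n) s * expR (- s^-1)) exprfctE.
  apply: (near_eq_is_derive gE).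
  have tn : t != 0 by rewrite gt_eqF.
  have d1 : is_derive t (1:R) (fun s : R => s^-1) (- t ^- 2 *: 1).
    exact: (@is_deriveV _ id).
  have d2 := is_deriveN d1.
  have d3 : is_derive t 1 (expR \o (fun s : R => - s^-1)) (expR (- t^-1) * - (- t ^- 2 *: 1)).
    exact: is_derive1_comp.
  have d4 := is_deriveM (is_deriveX n d1) d3.
  apply: (is_derive_eq d4).
  rewrite /flat t0 /= exprfctE.
  have sc (a b : R) : a *: b = a * b by [].
  rewrite !sc -exprVn.
  by case: n {gE d4 g} => [|n] /=; rewrite ?exprS; ring.
- have gE : \near t, cst 0 t = flat n t.
    have : \forall s \near t, s < 0 by exact: lt_nbhsl.
    by apply: filterS => s s0; rewrite flat_eq0// ltW.
  apply: (near_eq_is_derive gE).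
  by rewrite !flat_eq0 ?ltW// mulr0 subr0; exact: is_derive_cst.
- rewrite !flat_eq0// mulr0 subr0; apply: (@is_derive0_quadratic _ _ _ (n.+2%:R ^+ n.+2)) => h.
  by rewrite addr0; exact: flat_quadratic.
Qed.
End FlatFunctions.

Lemma is_derive_line (R : realType) (V : normedModType R) (f : V -> R)
    (x v : V) (d : R) :
  is_derive (0 : R) 1 (fun t : R => f (t *: v + x)) d -> is_derive x v f d.
Proof.
move=> [df fE]; apply: DeriveDef; first exact: line_derivable0.
by rewrite -fE derive_line scale0r add0r.
Qed.

Lemma is_derive_affine (R : realType) (a b t : R) :
  is_derive t 1 (fun s => a * s + b) a.
Proof.
have := is_deriveD (is_deriveZ a (is_derive_id t (1 : R))) (is_derive_cst b t (1 : R)).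
by rewrite [a *: 1]mulr1 addr0.
Qed.

Section Elementary.
Context {R : realType} {N : nat}.
Notation rV := ('rV[R]_N).

(* Closed under partial derivatives, so smoothness of its members needs only
   first derivatives. *)
Inductive elementary : (rV -> R) -> Prop :=
| elementary_cst c : elementary (cst c)
| elementary_flat n s c i : elementary (fun x => flat n (s * x 0 i + c))
| elementaryD f g : elementary f -> elementary g -> elementary (f + g)
| elementaryM f g : elementary f -> elementary g -> elementary (f * g).

Lemma elementary_prod n (F : 'I_n -> rV -> R) :
  (forall i, elementary (F i)) -> elementary (\prod_i F i).
Proof.
move=> eF; elim/big_ind: _ => //; first exact: (elementary_cst 1).
by move=> f g; exact: elementaryM.
Qed.

Lemma elementary_bounded f : elementary f -> exists M, forall x, `|f x| <= M.
Proof.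
elim=> [c|n s c i|g h _ [M1 H1] _ [M2 H2]|g h _ [M1 H1] _ [M2 H2]].
- by exists `|c|.
- by exists (n%:R ^+ n) => x; rewrite ger0_norm ?flat_ge0 ?flat_le.
- exists (M1 + M2) => x; apply: le_trans (ler_normD _ _) _; exact: lerD.
- by exists (M1 * M2) => x; rewrite normrM ler_pM.
Qed.

Lemma continuous_flat n : continuous (@flat R n).
Proof.
move=> t; apply/differentiable_continuous/derivable1_diffP.
by have [] := is_derive_flat n t.
Qed.

Lemma elementary_continuous f : elementary f -> continuous f.
Proof.
elim=> [c|n s c i|g h _ H1 _ H2|g h _ H1 _ H2] x.
- exact: cst_continuous.
- apply: (@continuous_comp _ _ _ (fun x : rV => s * x 0 i + c) (@flat R n)).
    have cx : (fun x : rV => x 0 i) @ x --> x 0 i by exact: coord_continuous.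
    have cs : (fun _ : rV => s) @ x --> s by exact: cst_continuous.
    have cc : (fun _ : rV => c) @ x --> c by exact: cst_continuous.
    exact: (cvgD (cvgM cs cx) cc).
  exact: continuous_flat.
- by apply: continuousD; [exact: H1|exact: H2].
- by apply: continuousM; [exact: H1|exact: H2].
Qed.

Lemma is_derive_flat_coord n s c (i j : 'I_N) (x : rV) :
  is_derive x (evec R j) (fun x => flat n (s * x 0 i + c))
   (s * (i == j)%:R * (flat n.+2 (s * x 0 i + c) - n%:R * flat n.+1 (s * x 0 i + c))).
Proof.
apply: is_derive_line.
have -> : (fun t : R => flat n (s * (t *: evec R j + x) 0 i + c)) =
  (@flat R n) \o (fun t : R => (s * (i == j)%:R) * t + (s * x 0 i + c)).
  apply/funext => t /=; congr flat; rewrite !mxE eqxx /=; ring.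
have d1 := is_derive_affine (s * (i == j)%:R) (s * x 0 i + c) 0.
have d2 := is_derive_flat n (s * (i == j)%:R * 0 + (s * x 0 i + c)).
have /is_derive_eq := @is_derive1_comp R (@flat R n)
  (fun t : R => s * (i == j)%:R * t + (s * x 0 i + c)) 0 _ _ d2 d1; apply.
by rewrite mulr0 add0r mulrC.
Qed.

Lemma elementary_derive f (j : 'I_N) : elementary f ->
  exists2 g, elementary g & forall x, is_derive x (evec R j) f (g x).
Proof.
elim=> [c|n s c i|g h eg [dg edg Hg] eh [dh edh Hh]|g h eg [dg edg Hg] eh [dh edh Hh]].
- by exists (cst 0); [exact: elementary_cst|move=> x; exact: is_derive_cst].
- exists (fun x => s * (i == j)%:R *
      (flat n.+2 (s * x 0 i + c) - n%:R * flat n.+1 (s * x 0 i + c))).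
    apply: (@elementaryM (cst _)); first exact: elementary_cst.
    apply: (@elementaryD (fun x => flat n.+2 _)); first exact: elementary_flat.
    rewrite (_ : (fun x : rV => _) = (cst (- n%:R) * (fun x : rV => flat n.+1 (s * x 0 i + c)))).
      by apply: elementaryM; [exact: elementary_cst|exact: elementary_flat].
    by apply/funext => x; rewrite mulrfctE mulNr.
  by move=> x; exact: is_derive_flat_coord.
- exists (dg + dh); first exact: elementaryD.
  by move=> x; exact: is_deriveD.
- exists (g * dh + h * dg); first by apply: elementaryD; exact: elementaryM.
  by move=> x; exact: is_deriveM.
Qed.

Lemma elementary_partial f (j : 'I_N) : elementary f -> elementary (partial j f).
Proof.
move=> /(elementary_derive j)[g eg H].
rewrite (_ : partial j f = g)//; apply/funext => x.
by have [_ <-] := H x.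
Qed.

Lemma elementary_smooth f : elementary f -> smooth f.
Proof.
move=> ef s.
have : elementary (iter_partial s f).
  by elim: s => //= j s IH; exact: elementary_partial.
move: (iter_partial s f) => g eg; split; first exact: elementary_continuous.
by move=> i x; have [h _ /(_ x)[]] := elementary_derive i eg.
Qed.

Lemma elementary_reflect f (a : rV) : elementary f -> elementary (fun x => f (a - x)).
Proof.
elim=> [c|n s c i|g h _ H1 _ H2|g h _ H1 _ H2].
- exact: elementary_cst.
- rewrite (_ : (fun x : rV => _) = (fun x : rV => flat n (- s * x 0 i + (s * a 0 i + c)))).
    exact: elementary_flat.
  by apply/funext => x; congr flat; rewrite !mxE; ring.
- exact: (@elementaryD (fun x => g (a - x)) (fun x => h (a - x))).
- exact: (@elementaryM (fun x => g (a - x)) (fun x => h (a - x))).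
Qed.

Lemma elementary_measurable f : elementary f ->
  measurable_fun setT (f : borelRV R N -> R).
Proof. by move=> ef; apply: continuous_measurableRV; exact: elementary_continuous. Qed.

(** The signs are written as coefficients 1 and -1 to fit the constructor [elementary_flat]. *)
Definition bump (r : R) : rV -> R :=
  \prod_(i < N) ((fun x : rV => flat 0 (1 * x 0 i + r)) *
    (fun x : rV => flat 0 (-1 * x 0 i + r))).

Lemma bumpE r x : bump r x = \prod_(i < N) (flat 0 (r + x 0 i) * flat 0 (r - x 0 i)).
Proof.
rewrite /bump; elim/big_ind2: _ => // [f1 y1 f2 y2 <- <-//|i _].
rewrite -[LHS]/(flat 0 (1 * x 0 i + r) * flat 0 (-1 * x 0 i + r)).
by rewrite mul1r mulN1r addrC [- _ + _]addrC.
Qed.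

Lemma elementary_bump r : elementary (bump r).
Proof. by apply: elementary_prod => i; apply: elementaryM; exact: elementary_flat. Qed.

Lemma bump_ge0 r x : 0 <= bump r x.
Proof. by rewrite bumpE; apply: prodr_ge0 => i _; rewrite mulr_ge0 ?flat_ge0. Qed.

Lemma bumpN r x : bump r (- x) = bump r x.
Proof.
by rewrite !bumpE; apply: eq_bigr => i _; rewrite !mxE opprK mulrC.
Qed.

Lemma bump_eq0 r x : ~ cubeRV N r x -> bump r x = 0.
Proof.
move=> nx; rewrite bumpE; apply/eqP/prodf_eq0.
apply: contrapT => H; apply: nx => i; apply: contrapT => xi; apply: H.
exists i => //; rewrite mulf_eq0.
have {xi} : r < `|x 0 i| by rewrite ltNge; apply/negP.
have [x0|x0] := lerP 0 (x 0 i) => xr; apply/orP; [right|left]; apply/eqP/flat_eq0.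
  by move: xr; rewrite ger0_norm//; lra.
by move: xr; rewrite ltr0_norm//; lra.
Qed.

Lemma bump_le1 r x : bump r x <= 1.
Proof.
rewrite bumpE; apply: prodr_ile1 => i _.
have H (t : R) : flat 0 t <= 1 by have := flat_le 0 t; rewrite expr0.
by rewrite mulr_ge0 ?flat_ge0//= -[1]mulr1 ler_pM ?flat_ge0.
Qed.

Lemma bump_lb r x : 0 < r -> cubeRV N (r / 2) x ->
  (flat 0 (r / 2) ^+ 2) ^+ N <= bump r x.
Proof.
move=> r0 xr; rewrite bumpE -[X in _ ^+ X]card_ord -prodr_const.
apply: ler_prod => i _; rewrite exprn_ge0 ?flat_ge0//= expr2.
have := xr i; rewrite ler_norml => /andP[h1 h2].
by apply: ler_pM; rewrite ?flat_ge0//; apply: flat_nondecreasing; lra.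
Qed.

End Elementary.

(** * Mollification *)

Section Mollification.
Context {R : realType} {N : nat}.
Notation rV := ('rV[R]_N).
Notation T := (borelRV R N).
Notation leb := (@lebesgueRV R N).
Implicit Types (f g : rV -> R) (r : R) (x : rV).

Lemma cubeRV_lty r : (leb (cubeRV N r) < +oo)%E.
Proof.
apply: (@le_lt_trans _ _ (leb (cubeRV N (`|r| + 1)))).
  apply: le_measure; rewrite ?inE//; [exact: measurable_cubeRV..|].
  by move=> x xs j; apply: le_trans (xs j) _; rewrite (le_trans (ler_norm _))// lerDl.
by rewrite lebesgueRV_cube ?ltry// ltr_wpDl.
Qed.

Lemma measurable_bump r : measurable_fun setT (bump r : T -> R).
Proof. exact: elementary_measurable (elementary_bump r). Qed.

Lemma bump_integrable r : leb.-integrable setT (fun x => (bump r x)%:E).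
Proof.
apply: (le_integrable measurableT _ _
  (integrable_indic_lty (@measurable_cubeRV R N r) (cubeRV_lty r))).
  by apply/measurable_EFinP; exact: measurable_bump.
move=> x _; rewrite !abse_EFin lee_fin ger0_norm ?bump_ge0//.
have [xr|nxr] := pselect (cubeRV N r x); last by rewrite bump_eq0.
by rewrite indicE mem_set//= normr1 bump_le1.
Qed.

Lemma bump_mass_gt0 r : 0 < r -> 0 < \int[leb]_x bump r x.
Proof.
move=> r0; have r20 : 0 < r / 2 by rewrite divr_gt0.
pose c := (flat 0 (r / 2) ^+ 2) ^+ N.
have c0 : 0 < c by rewrite !exprn_gt0// flat_gt0.
have I0 := integrable_indic_lty (@measurable_cubeRV R N (r / 2)) (cubeRV_lty (r / 2)).
have I1 := integrableZl measurableT c I0.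
apply: (@lt_le_trans _ _ (\int[leb]_x (c * \1_(cubeRV N (r / 2)) x))).
  rewrite RintegralZl//.
  rewrite mulr_gt0// /Rintegral integral_indic//; last exact: measurable_cubeRV.
  by rewrite setIT /= lebesgueRV_cube//= exprn_gt0// mulr_gt0.
apply: le_Rintegral => //; first exact: bump_integrable.
move=> x _; have [xr|nxr] := pselect (cubeRV N (r / 2) x).
  by rewrite indicE mem_set//= mulr1 bump_lb.
by rewrite indicE memNset//= mulr0 bump_ge0.
Qed.

Definition mollifier r : rV -> R := cst (\int[leb]_x bump r x)^-1 * bump r.

Lemma mollifierE r x : mollifier r x = (\int[leb]_x bump r x)^-1 * bump r x.
Proof. by []. Qed.

Lemma elementary_mollifier r : elementary (mollifier r).
Proof. by apply: elementaryM; [exact: elementary_cst|exact: elementary_bump]. Qed.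

Lemma measurable_mollifier r : measurable_fun setT (mollifier r : T -> R).
Proof. exact: elementary_measurable (elementary_mollifier r). Qed.

Lemma mollifier_ge0 r x : 0 <= mollifier r x.
Proof.
rewrite mollifierE mulr_ge0 ?bump_ge0// invr_ge0.
by apply: Rintegral_ge0 => y _; exact: bump_ge0.
Qed.

Lemma mollifierN r x : mollifier r (- x) = mollifier r x.
Proof. by rewrite !mollifierE bumpN. Qed.

Lemma mollifier_eq0 r x : ~ cubeRV N r x -> mollifier r x = 0.
Proof. by move=> nx; rewrite mollifierE bump_eq0// mulr0. Qed.

Lemma mollifier_integrable r : leb.-integrable setT (fun x => (mollifier r x)%:E).
Proof.
exact: (integrableZl measurableT (\int[leb]_x bump r x)^-1 (bump_integrable r)).
Qed.

Lemma integral_mollifier r : 0 < r -> \int[leb]_x mollifier r x = 1.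
Proof.
move=> r0; rewrite -[LHS]/(\int[leb]_x ((\int[leb]_x bump r x)^-1 * bump r x)).
rewrite RintegralZl//; last exact: bump_integrable.
by rewrite mulVf// gt_eqF// bump_mass_gt0.
Qed.

Lemma integral_mollifier_shift r x : 0 < r ->
  (\int[leb]_y (mollifier r (y - x))%:E = 1)%E.
Proof.
move=> r0; have mm := measurable_mollifier r.
rewrite (@ge0_integralRV_shift R N (- x) (fun y => (mollifier r y)%:E)).
- rewrite -(integral_mollifier r0) /Rintegral fineK//.
  by apply: integrable_fin_num => //; exact: mollifier_integrable.
- exact/measurable_EFinP.
- by move=> y; rewrite lee_fin mollifier_ge0.
Qed.

Lemma measurable_subRV : measurable_fun setT
  ((fun p => p.1 - p.2) : T * T -> T).
Proof.
apply: measurable_funRV => i.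
apply: (@eq_measurable_fun _ _ (T * T)%type R setT
   (fun p : T * T => (p.1 : rV) 0 i - (p.2 : rV) 0 i)) => [x _|].
  by rewrite !mxE.
apply: measurable_funB.
  exact: (measurableT_comp (measurable_coordRV i) measurable_fst).
exact: (measurableT_comp (measurable_coordRV i) measurable_snd).
Qed.

Definition mollify r f x : R := \int[leb]_y (f y * mollifier r (x - y)).

Let kernel r f (p : T * T) : \bar R := (f p.2 * mollifier r (p.1 - p.2))%:E.

Lemma measurable_kernel r f : measurable_fun setT (f : T -> R) ->
  measurable_fun setT (kernel r f).
Proof.
move=> mf; apply/measurable_EFinP; apply: measurable_funM.
  exact: (measurableT_comp mf measurable_snd).
exact: (measurableT_comp (measurable_mollifier r) measurable_subRV).
Qed.

Lemma mollifierBC r x y : mollifier r (x - y) = mollifier r (y - x).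
Proof. by rewrite -mollifierN opprB. Qed.

Lemma ge0_kernel_integral r f : 0 < r -> measurable_fun setT (f : T -> R) ->
  (\int[leb]_y \int[leb]_x `|kernel r f (x, y)| = \int[leb]_y `|f y|%:E)%E.
Proof.
move=> r0 mf; apply: eq_integral => y _; rewrite /kernel /=.
transitivity (\int[leb]_x (`|f y|%:E * (mollifier r (x - y))%:E))%E.
  by apply: eq_integral => x _; rewrite normrM (ger0_norm (mollifier_ge0 _ _)) EFinM.
rewrite ge0_integralZl_EFin//.
- by rewrite integral_mollifier_shift// mule1.
- by move=> x _; rewrite lee_fin mollifier_ge0.
- apply/measurable_EFinP.
  exact: (measurableT_comp (measurable_mollifier r) (measurable_shiftRV (- y))).
Qed.

Lemma kernel_integrable r f : 0 < r -> leb.-integrable setT (EFin \o f) ->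
  (leb \x leb)%E.-integrable setT (kernel r f).
Proof.
move=> r0 If; have mf : measurable_fun setT (f : T -> R).
  by apply/measurable_EFinP; exact: measurable_int If.
apply/(integrable21ltyP _ _ (measurable_kernel r mf)).
rewrite ge0_kernel_integral//.
by have /integrableP[_] := If.
Qed.

Lemma mollifier_bounded r : exists C, forall x, `|mollifier r x| <= C.
Proof. exact: elementary_bounded (elementary_mollifier r). Qed.

Lemma mollify_integrand r f x : leb.-integrable setT (EFin \o f) ->
  leb.-integrable setT (fun y => (f y * mollifier r (x - y))%:E).
Proof.
move=> If; have [C HC] := mollifier_bounded r.
under eq_fun do rewrite EFinM.
apply: integrableMl => //.
  exact: (measurableT_comp (measurable_mollifier r) (measurable_reflectRV x)).
exists C; split; first exact: num_real.
by move=> M CM y _; apply: le_trans (HC _) (ltW CM).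
Qed.

Lemma EFin_mollify r f x : leb.-integrable setT (EFin \o f) ->
  (mollify r f x)%:E = (\int[leb]_y (f y * mollifier r (x - y))%:E)%E.
Proof.
move=> If; rewrite /mollify /Rintegral fineK//.
by apply: integrable_fin_num => //; exact: mollify_integrand.
Qed.

Lemma mollify_integrable r f : 0 < r -> leb.-integrable setT (EFin \o f) ->
  leb.-integrable setT (fun x => (mollify r f x)%:E).
Proof.
move=> r0 If; under eq_fun do rewrite EFin_mollify//.
exact: (integrable_fubini_F (kernel_integrable r0 If)).
Qed.

Lemma integral_norm_mollify_le r f : 0 < r -> leb.-integrable setT (EFin \o f) ->
  \int[leb]_x `|mollify r f x| <= \int[leb]_x `|f x|.
Proof.
move=> r0 If; have mf : measurable_fun setT (f : T -> R).
  by apply/measurable_EFinP; exact: measurable_int If.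
have In := integrable_norm If.
have Im := integrable_norm (mollify_integrable r0 If).
rewrite -lee_fin /Rintegral !fineK; [|exact: integrable_fin_num..].
rewrite -(ge0_kernel_integral r0 mf).
have mk := measurable_kernel r mf.
have mka : measurable_fun setT (fun p : T * T => `|kernel r f p|%E).
  exact: measurableT_comp.
rewrite -(@fubini_tonelli _ _ T T R leb leb _ mka)//.
apply: ge0_le_integral => //.
- exact: measurable_int Im.
- apply: (@measurable_fun_fubini_tonelli_F _ _ T T R leb _ mka) => p.
  exact: abse_ge0.
- move=> x _; rewrite -[leLHS]abse_EFin EFin_mollify//.
  apply: le_abse_integral => //.
  exact: measurable_int (mollify_integrand r x If).
Qed.

Lemma integral_mollify r f : 0 < r -> leb.-integrable setT (EFin \o f) ->
  \int[leb]_x mollify r f x = \int[leb]_x f x.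
Proof.
move=> r0 If; congr fine.
transitivity (\int[leb]_x fubini_F leb (kernel r f) x)%E.
  by apply: eq_integral => x _; rewrite EFin_mollify.
rewrite (Fubini (kernel_integrable r0 If)).
apply: eq_integral => y _; rewrite /kernel /=.
under eq_integral do rewrite EFinM.
have Ir : leb.-integrable setT (fun x => (mollifier r (x - y))%:E).
  exact: (integrableRV_shift (- y) (mollifier_integrable r)).
by rewrite integralZl//= integral_mollifier_shift// mule1.
Qed.

End Mollification.

Section MollifyConvergence.
Context {R : realType} {N : nat}.
Notation rV := ('rV[R]_N).
Notation T := (borelRV R N).
Notation leb := (@lebesgueRV R N).
Implicit Types (f g : rV -> R) (r : R) (x : rV).

Definition mollify_radius (n : nat) : R := n.+1%:R^-1.
Notation rn := mollify_radius.

Lemma mollify_radius_gt0 n : 0 < rn n.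
Proof. by rewrite invr_gt0. Qed.

Lemma mollify_radius_cvg0 : rn @ \oo --> 0.
Proof. exact: cvg_harmonic. Qed.

Lemma mollify_lin r a f g x :
  leb.-integrable setT (EFin \o f) -> leb.-integrable setT (EFin \o g) ->
  mollify r (fun x => a * f x + g x) x = a * mollify r f x + mollify r g x.
Proof.
move=> If Ig; rewrite /mollify.
have I1 := mollify_integrand r x If; have I2 := mollify_integrand r x Ig.
rewrite -RintegralZl// -RintegralD//.
  by apply: eq_Rintegral => y _; rewrite mulrDl mulrA.
exact: (integrableZl measurableT a I1).
Qed.

(** L^1 convergence of mollifications, isolated as a property stable under linear combinations and
    L^1 limits, so that it spreads from indicators of open sets to integrable functions. *)
Definition mollifiable f := leb.-integrable setT (EFin \o f) /\
  (fun n => \int[leb]_x `|mollify (rn n) f x - f x|) @ \oo --> 0.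

Lemma integrable_lin a f g :
  leb.-integrable setT (EFin \o f) -> leb.-integrable setT (EFin \o g) ->
  leb.-integrable setT (EFin \o (fun x => a * f x + g x)).
Proof.
by move=> If Ig; exact: (integrableD measurableT (integrableZl measurableT a If) Ig).
Qed.

Lemma mollify_sub_integrable n f : leb.-integrable setT (EFin \o f) ->
  leb.-integrable setT (EFin \o (fun x => `|mollify (rn n) f x - f x|)).
Proof.
move=> If; have Im := mollify_integrable (mollify_radius_gt0 n) If.
exact: (integrable_norm (integrableB measurableT Im If)).
Qed.

Lemma mollifiable_lin a f g : mollifiable f -> mollifiable g ->
  mollifiable (fun x => a * f x + g x).
Proof.
move=> [If cf] [Ig cg]; split; first exact: integrable_lin.
apply: (@squeeze_cvgr _ _ _ _ (cst 0) (fun n =>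
  `|a| * \int[leb]_x `|mollify (rn n) f x - f x| +
  \int[leb]_x `|mollify (rn n) g x - g x|)).
- apply: nearW => n; rewrite Rintegral_ge0//=.
  have I1 := mollify_sub_integrable n If; have I2 := mollify_sub_integrable n Ig.
  rewrite -RintegralZl// -RintegralD//; last first.
    exact: (integrableZl measurableT `|a| I1).
  apply: le_Rintegral => //.
  + exact: mollify_sub_integrable (integrable_lin a If Ig).
  + exact: (integrableD measurableT (integrableZl measurableT `|a| I1) I2).
  move=> x _; rewrite mollify_lin// -normrM.
  by apply: le_trans (ler_normD _ _); rewrite mulrBr opprD addrACA.
- exact: cvg_cst.
- rewrite [X in _ --> X](_ : _ = `|a| * 0 + 0); last by rewrite mulr0 addr0.
  by apply: cvgD => //; apply: cvgM => //; exact: cvg_cst.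
Qed.

(** Mollification contracts L^1, so the approximation error [e / 4] enters twice and leaves [e / 2]
    for the convergence of [g]. *)
Lemma mollifiable_closed f : leb.-integrable setT (EFin \o f) ->
  (forall e, 0 < e -> exists2 g, mollifiable g & \int[leb]_x `|f x - g x| <= e) ->
  mollifiable f.
Proof.
move=> If H; split => //; apply/cvgrPdist_le => e e0.
have e40 : 0 < e / 4 by rewrite divr_gt0.
have [g [Ig cg] fg] := H _ e40.
have e20 : 0 < e / 2 by rewrite divr_gt0.
move/cvgrPdist_le : cg => /(_ _ e20); apply: filterS => n.
rewrite !sub0r !normrN => cg.
rewrite ger0_norm; last exact: Rintegral_ge0.
have Ifg := integrableB measurableT If Ig.
have Imfg := integrable_norm (mollify_integrable (mollify_radius_gt0 n) Ifg).
have I1 := mollify_sub_integrable n If; have I2 := mollify_sub_integrable n Ig.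
have I3 := integrable_norm Ifg.
apply: (@le_trans _ _ (\int[leb]_x (`|mollify (rn n) (f \- g) x| +
   (`|mollify (rn n) g x - g x| + `|f x - g x|)))).
  apply: le_Rintegral => //.
    exact: (integrableD measurableT Imfg (integrableD measurableT I2 I3)).
  move=> x _.
  have E : mollify (rn n) (f \- g) x = mollify (rn n) f x - mollify (rn n) g x.
    rewrite -mulN1r addrC -mollify_lin//; congr mollify.
    by apply/funext => y; rewrite /= mulN1r addrC.
  rewrite E.
  have -> : mollify (rn n) f x - f x = (mollify (rn n) f x - mollify (rn n) g x) +
     ((mollify (rn n) g x - g x) - (f x - g x)) by ring.
  apply: le_trans (ler_normD _ _) _; rewrite lerD2l.
  exact: ler_normB.
rewrite RintegralD//; last exact: (integrableD measurableT I2 I3).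
rewrite RintegralD//.
have h1 := integral_norm_mollify_le (mollify_radius_gt0 n) Ifg.
have h1' : \int[leb]_x `|mollify (rn n) (f \- g) x| <= e / 4 := le_trans h1 fg.
have h2 : \int[leb]_x `|mollify (rn n) g x - g x| <= e / 2.
  exact: le_trans (ler_norm _) cg.
lra.
Qed.

Lemma mollify_indic_bounds r (B : set T) x : 0 < r -> measurable B ->
  (leb B < +oo)%E -> 0 <= mollify r \1_B x <= 1.
Proof.
move=> r0 mB Bfin; have IB := integrable_indic_lty mB Bfin.
apply/andP; split.
  by apply: Rintegral_ge0 => y _; rewrite mulr_ge0 ?mollifier_ge0.
have E : \int[leb]_y mollifier r (y - x) = 1.
  by rewrite /Rintegral integral_mollifier_shift.
rewrite -E; apply: le_Rintegral => //; first exact: mollify_integrand.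
  exact: (integrableRV_shift (- x) (mollifier_integrable r)).
move=> y _; rewrite mollifierBC; apply: ler_piMl; first exact: mollifier_ge0.
by rewrite indicE; case: (_ \in _).
Qed.

Lemma mollify_indic_eq1 r (U : set T) x : 0 < r -> measurable U ->
  (leb U < +oo)%E -> (forall y, cubeRV N r (x - y) -> U y) -> mollify r \1_U x = 1.
Proof.
move=> r0 mU Ufin xU.
have E : \int[leb]_y mollifier r (y - x) = 1.
  by rewrite /Rintegral integral_mollifier_shift.
rewrite -E; apply: eq_Rintegral => y _.
rewrite (mollifierBC r y x); have [xy|xy] := pselect (cubeRV N r (x - y)).
  by rewrite indicE mem_set ?mul1r//; exact: xU.
by rewrite mollifier_eq0// mulr0.
Qed.

Lemma open_cube_near (U : set rV) x : open U -> U x ->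
  exists2 e : R, 0 < e & forall y, cubeRV N e (x - y) -> U y.
Proof.
move=> oU Ux; have /nbhs_ballP[e /= e0 eU] : nbhs x U by exact: open_nbhs_nbhs.
exists (e / 2); first by rewrite divr_gt0.
move=> y xy; apply: eU; split => // i j; rewrite ord1 -ball_normE/=.
have := xy j; rewrite !mxE => /le_lt_trans; apply.
by rewrite ltr_pdivrMr// ltr_pMr// ltr1n.
Qed.

Lemma cubeRV_sub r s x : r <= s -> cubeRV N r x -> cubeRV N s x.
Proof. by move=> rs xr i; exact: le_trans (xr i) rs. Qed.

(** At a point of [U] the mollification is eventually equal to 1. Boundary points escape such
    control, but mollification preserves total mass: the mass found outside [U] equals the mass
    missing inside, and the L^1 error is twice the latter. *)
Lemma mollifiable_open (U : set rV) : open U -> (leb U < +oo)%E ->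
  mollifiable \1_U.
Proof.
move=> oU Ufin; have mU := open_measurableRV oU.
have IU := integrable_indic_lty mU Ufin.
split; first exact: IU.
pose m n := mollify (rn n) \1_U.
have Im n := mollify_integrable (mollify_radius_gt0 n) IU.
have mb n x : 0 <= m n x <= 1 := mollify_indic_bounds x (mollify_radius_gt0 n) mU Ufin.
have mcvg x : U x -> (fun n => m n x) @ \oo --> (1 : R).
  move=> Ux; have [e e0 eU] := open_cube_near oU Ux.
  apply: cvg_near_cst.
  have := mollify_radius_cvg0; move/cvgrPdist_lt => /(_ _ e0).
  apply: filterS => n; rewrite sub0r normrN gtr0_norm ?mollify_radius_gt0// => rne.
  apply: mollify_indic_eq1 => //; first exact: mollify_radius_gt0.
  by move=> y /(cubeRV_sub (ltW rne)); exact: eU.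
pose h n x := \1_U x * (1 - m n x).
have Ih n : leb.-integrable setT (EFin \o h n).
  apply: (le_integrable measurableT _ _ IU).
    apply/measurable_EFinP; apply: measurable_funM; first exact: measurable_indic.
    apply: measurable_funB; first exact: measurable_cst.
    by apply/measurable_EFinP; exact: measurable_int (Im n).
  move=> x _; rewrite !abse_EFin lee_fin normrM ler_piMr//.
  by have /andP[m0 m1] := mb n x; rewrite ger0_norm ?subr_ge0// lerBlDr lerDl.
have hcvg : (fun n => \int[leb]_x h n x) @ \oo --> (0 : R).
  have hx x : (fun n => h n x) @ \oo --> (0 : R).
    rewrite /h indicE; have [Ux|nUx] := pselect (U x); last first.
      by rewrite memNset//; under eq_fun do rewrite mul0r; exact: cvg_cst.
    rewrite mem_set//; under eq_fun do rewrite mul1r.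
    suff : (fun n => 1 - m n x) @ \oo --> 1 - (1 : R) by rewrite subrr.
    by apply: cvgB; [exact: cvg_cst|exact: mcvg].
  have A1 : {ae leb, forall x, setT x -> (fun n => (h n x)%:E) @ \oo --> (cst 0%E) x}.
    by apply: aeW => x _; apply: cvg_EFin; [exact: nearW|exact: hx].
  have A2 : {ae leb, forall x n, setT x -> (`|(h n x)%:E| <= (\1_U x)%:E)%E}.
    apply: aeW => x n _; rewrite abse_EFin lee_fin normrM ger0_norm//.
    rewrite ler_piMr//.
    by have /andP[m0 m1] := mb n x; rewrite ger0_norm ?subr_ge0// lerBlDr lerDl.
  have [_ _] := @dominated_convergence _ _ _ leb setT measurableT
      (fun n x => (h n x)%:E) (cst 0%E) (fun x => (\1_U x)%:E)
      (fun n => measurable_int _ (Ih n)) (measurable_cst _) A1 IU A2.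
  by rewrite integral0 => /fine_cvg.
have key n : \int[leb]_x `|m n x - \1_U x| = 2 * \int[leb]_x h n x.
  transitivity (\int[leb]_x (m n x - \1_U x + 2 * h n x)).
    apply: eq_Rintegral => x _; rewrite /h indicE; have /andP[m0 m1] := mb n x.
    case: (x \in U) => /=; last by rewrite subr0 mul0r mulr0 addr0 ger0_norm.
    by rewrite mul1r ler0_norm ?subr_le0//; ring.
  have I1 := integrableB measurableT (Im n) IU.
  have I2 := integrableZl measurableT 2 (Ih n).
  have E : \int[leb]_x (2 * h n x) = 2 * \int[leb]_x h n x.
    exact: RintegralZl.
  rewrite RintegralD// RintegralB//; last exact: Im.
  rewrite E.
  by rewrite integral_mollify ?subrr ?add0r//; exact: mollify_radius_gt0.
under eq_fun do rewrite key.
suff : (fun n => 2 * \int[leb]_x h n x) @ \oo --> 2 * (0 : R) by rewrite mulr0.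
by apply: cvgM => //; exact: cvg_cst.
Qed.

Import HBSimple.

Section OpenDomain.
Variable Om : set rV.
Hypotheses (oOm : open Om) (Omfin : (leb Om < +oo)%E).
Let mOm : measurable (Om : set T) := open_measurableRV oOm.

Let sub_fin (B : set T) : measurable B -> (leb (B `&` Om) < +oo)%E.
Proof.
move=> mB; apply: le_lt_trans Omfin; apply: le_measure; rewrite ?inE//.
exact: measurableI.
Qed.

Let int_indic (B : set T) : measurable B ->
  leb.-integrable setT (EFin \o (\1_(B `&` Om) : T -> R)).
Proof.
by move=> mB; apply: integrable_indic_lty; [exact: measurableI|exact: sub_fin].
Qed.

(** A Dynkin-system argument from the open sets, which are stable under intersection. Intersecting
    with [Om] keeps measures finite, so dominated convergence handles increasing unions. *)
Lemma mollifiable_measurable (B : set T) : measurable B ->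
  mollifiable \1_(B `&` Om).
Proof.
pose H : set (set T) := [set B : set T | measurable B /\ mollifiable \1_(B `&` Om)].
suff h : <<s @openRV R N >> `<=` H by move=> mB; have [] := h _ mB.
clear B.
apply: lambda_system_subset => //.
- by move=> A B oA oB; exact: openI.
- split => //.
  + by split => //; rewrite setTI; exact: mollifiable_open.
  + move=> A B BA [mA hA] [mB hB]; split; first exact: measurableD.
    rewrite (_ : \1_((A `\` B) `&` Om) = fun x : rV =>
        -1 * \1_(B `&` Om) x + \1_(A `&` Om) x).
      exact: mollifiable_lin.
    apply/funext => x; rewrite !indicE (in_setI _ (_ `\` _)) in_setD !in_setI.
    have : x \in B -> x \in A by move=> /set_mem/BA/mem_set.
    by case: (x \in A) (x \in B) (x \in Om) => [] [] [] //= BAx;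
      rewrite ?mulr0 ?mulr1 ?addNr ?add0r//; have := BAx isT.
  + move=> F0 ndF0 hF0; pose F : nat -> set T := F0.
    have ndF : {homo F : n m / (n <= m)%N >-> (n <= m)%O} := ndF0.
    have hF i : H (F i) := hF0 i; change (H (\bigcup_i F i)).
    clearbody F; clear F0 ndF0 hF0.
    have mF i : measurable (F i) by case: (hF i).
    split; first exact: bigcupT_measurable.
    have mU : measurable (\bigcup_i F i) by exact: bigcupT_measurable.
    apply: mollifiable_closed => [|e e0]; first exact: int_indic.
    have A1 : {ae leb, forall x, setT x -> (fun n => (\1_(F n `&` Om) x : R)%:E) @ \oo -->
        (\1_((\bigcup_i F i) `&` Om) x)%:E}.
      apply: aeW => x _; apply: cvg_near_cst.
      have [[[i _ Fi] Ox]|nx] := pselect (((\bigcup_i F i) `&` Om) x).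
        exists i => // j /= ij; rewrite !indicE !mem_set//.
          by split => //; exists i.
        by split => //; move: Fi; apply/subsetPset/ndF.
      apply: nearW => j; rewrite !indicE !memNset// => -[Fj Ox]; apply: nx.
      by split => //; exists j.
    have A2 : {ae leb, forall x n, setT x ->
        (`|(\1_(F n `&` Om) x : R)%:E| <= (\1_(setT `&` Om) x)%:E)%E}.
      apply: aeW => x n _; rewrite abse_EFin lee_fin ger0_norm// !indicE !in_setI in_setT.
      by case: (x \in F n); case: (x \in Om).
    have [_ + _] := @dominated_convergence _ _ _ leb setT measurableT
      (fun n x => (\1_(F n `&` Om) x)%:E) (fun x => (\1_((\bigcup_i F i) `&` Om) x)%:E)
      (fun x => (\1_(setT `&` Om) x)%:E)
      (fun n => measurable_int _ (int_indic (mF n))) (measurable_int _ (int_indic mU))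
      A1 (int_indic measurableT) A2.
    move=> /fine_cvg /cvgrPdist_le/(_ _ e0)[n _ /(_ n (leqnn n))] hn.
    exists \1_(F n `&` Om); first by case: (hF n).
    move: hn; rewrite sub0r normrN => /(le_trans (ler_norm _)); apply: le_trans.
    rewrite le_eqVlt; apply/orP; left; apply/eqP; congr fine.
    by apply: eq_integral => x _; rewrite -EFinB abse_EFin distrC.
- by move=> A oA; split; [exact: open_measurableRV|apply: mollifiable_open;
    [exact: openI|apply: sub_fin; exact: open_measurableRV]].
Qed.

Lemma mollifiable0 : mollifiable (fun=> 0).
Proof.
have := mollifiable_measurable (@measurable0 _ T); rewrite set0I.
by rewrite indic0.
Qed.

Lemma mollifiable_sum I (s : seq I) (c : I -> R) (F : I -> rV -> R) :
  (forall i, mollifiable (F i)) -> mollifiable (fun x => \sum_(i <- s) c i * F i x).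
Proof.
move=> mF; elim: s => [|i s IH].
  rewrite (_ : (fun x : rV => _) = (fun=> 0)); first exact: mollifiable0.
  by apply/funext => x; rewrite big_nil.
rewrite (_ : (fun x : rV => _) = (fun x => c i * F i x + \sum_(i <- s) c i * F i x)).
  exact: mollifiable_lin.
by apply/funext => x; rewrite big_cons.
Qed.

Lemma mollify_cvg_L1 f : leb.-integrable setT (EFin \o f) ->
  (forall x, ~ Om x -> f x = 0) -> mollifiable f.
Proof.
move=> If f0; apply: mollifiable_closed => // e e0.
have IfO := integrableS measurableT mOm (@subsetT _ _) If.
have [g [Ig _ /fine_cvg]] := approximation_sfun_integrable mOm IfO.
move=> /cvgrPdist_le/(_ _ e0)[n _ /(_ n (leqnn n))] hn.
pose h x : R := g n x * \1_Om x.
have [k [c [B [mB gE]]]] : exists k (c : 'I_k -> R) (B : 'I_k -> set T),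
    (forall i, measurable (B i)) /\ forall x, g n x = \sum_i c i * \1_(B i) x.
  by do 3 eexists; split; [|move=> x; exact: fimfunEord].
exists h.
  rewrite (_ : h = fun x : rV => \sum_i c i * \1_(B i `&` Om) x).
    by apply: mollifiable_sum => i; exact: mollifiable_measurable.
  apply/funext => x; rewrite /h gE mulr_suml.
  by apply: eq_bigr => i _; rewrite -mulrA indicI.
have -> : \int[leb]_x `|f x - h x| =
    fine (\int[leb]_(z in Om) `|(f z)%:E - (g n z)%:E|)%E.
  congr fine; rewrite [RHS]integral_mkcond; apply: eq_integral => x _.
  rewrite patchE /h indicE.
  have [Ox|nOx] := pselect (Om x); first by rewrite !mem_set//= mulr1.
  by rewrite !memNset//= mulr0 f0// subr0 normr0.
by move: hn; rewrite sub0r normrN; apply: le_trans; exact: ler_norm.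
Qed.

End OpenDomain.

End MollifyConvergence.

(** * The chain rule for truncations in W^{1,2} *)

Section TruncationCalculus.
Context {R : realType}.
Variables (k e : R).
Hypothesis e0 : 0 < e.
Implicit Types s t : R.

Notation rt s := (Num.sqrt (pospart k s ^+ 2 + e ^+ 2)).

Lemma pospart_lip s t : `|pospart k s - pospart k t| <= `|s - t|.
Proof.
have H (a b : R) : a <= b -> `|pospart k a - pospart k b| <= `|a - b|.
  move=> ab; rewrite ler0_norm ?subr_le0; last first.
    by rewrite /pospart ge_max le_max lerD2r ab /= le_max lexx orbT.
  rewrite (ler0_norm (_ : a - b <= 0)) ?subr_le0// !opprB.
  have := pospart_ge k a; have := pospart_ge0 k a.
  by move=> p0 pa; rewrite lerBlDr {1}/pospart ge_max; apply/andP; split; lra.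
have [st|ts] := leP s t; first exact: H.
by rewrite distrC [leRHS]distrC; apply: H; exact: ltW.
Qed.

Lemma strunc_lip s t : `|strunc k e s - strunc k e t| <= `|s - t|.
Proof.
apply: le_trans (pospart_lip s t).
have -> : strunc k e s - strunc k e t = rt s - rt t by rewrite /strunc; ring.
have Ps := sqrt_strunc_gt0 k e0 s; have Pt := sqrt_strunc_gt0 k e0 t.
have P0 : 0 < rt s + rt t by exact: addr_gt0.
have sq x : rt x ^+ 2 = pospart k x ^+ 2 + e ^+ 2.
  by rewrite sqr_sqrtr// addr_ge0 ?sqr_ge0.
rewrite -(ler_pM2r P0) -{1}(gtr0_norm P0) -normrM.
have -> : (rt s - rt t) * (rt s + rt t) =
    (pospart k s - pospart k t) * (pospart k s + pospart k t).
  by have := sq s; have := sq t; move=> h1 h2; rewrite -!subr_sqr; lra.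
rewrite normrM; apply: ler_wpM2l => //.
rewrite ger0_norm ?addr_ge0 ?pospart_ge0//.
by apply: lerD; exact: pospart_le_sqrt.
Qed.

(** Over the denominator [Q >= e] the difference splits into the variation of the root and that of
    the positive part, each at most |s - t|. *)
Lemma dstrunc_lip s t : `|dstrunc k e s - dstrunc k e t| <= 2 / e * `|s - t|.
Proof.
have Ps := sqrt_strunc_gt0 k e0 s; have Pt := sqrt_strunc_gt0 k e0 t.
have h1 := strunc_lip s t; have h2 := pospart_lip s t.
have e1 : strunc k e s - strunc k e t = rt s - rt t by rewrite /strunc; ring.
rewrite e1 in h1.
rewrite /dstrunc; set p := pospart k s in Ps h1 h2 *; set q := pospart k t in Pt h1 h2 *.
set P := Num.sqrt (p ^+ 2 + e ^+ 2) in Ps h1 *.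
set Q := Num.sqrt (q ^+ 2 + e ^+ 2) in Pt h1 *.
have -> : p / P - q / Q = (p / P * (Q - P) + (p - q)) / Q.
  by field; rewrite !gt_eqF.
rewrite normrM normfV (gtr0_norm Pt) ler_pdivrMr//.
apply: (@le_trans _ _ (2 * `|s - t|)).
  apply: le_trans (ler_normD _ _) _; rewrite mulr_natl mulr2n lerD//.
  rewrite normrM -[leRHS]mul1r; apply: ler_pM => //; last by rewrite distrC.
  have := dstrunc_le1 k e0 s; have := dstrunc_ge0 k e s; rewrite /dstrunc -/p -/P.
  by move=> d0 d1; rewrite ger0_norm.
have eQ : e <= Q by exact: le_sqrt_strunc.
rewrite mulrAC; apply: ler_wpM2r => //.
by rewrite -[leLHS]mulr1 -mulrA ler_pM2l// mulrC ler_pdivlMr// mul1r.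
Qed.

Lemma is_derive_pospart_sqr s :
  is_derive s 1 (fun t => pospart k t ^+ 2) (2 * pospart k s).
Proof.
have [sk|sk|->] := ltgtP s k.
- rewrite pospart_eq0 ?ltW// mulr0.
  have nE : \near s, cst 0 s = pospart k s ^+ 2.
    have : \forall t \near s, t < k by exact: lt_nbhsl.
    by apply: filterS => t tk; rewrite pospart_eq0 ?ltW// expr0n.
  by apply: (near_eq_is_derive nE); exact: is_derive_cst.
- have nE : \near s, ((fun t : R => 1 * t + - k) ^+ 2) s = pospart k s ^+ 2.
    have : \forall t \near s, k < t by exact: lt_nbhsr.
    apply: filterS => t tk; rewrite exprfctE; congr (_ ^+ 2).
    by rewrite mul1r /pospart (max_idPl _)// subr_ge0 ltW.
  apply: (near_eq_is_derive nE).
  have := is_deriveX 2 (is_derive_affine 1 (- k) s).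
  move=> /is_derive_eq; apply.
  by rewrite /pospart (max_idPl _) ?subr_ge0 1?ltW// -[LHS]/(2 * _ * 1) mulr1 mul1r.
- rewrite [pospart k k]pospart_eq0// mulr0.
  apply: (@is_derive0_quadratic _ _ _ 1) => h.
  rewrite mul1r ger0_norm ?sqr_ge0// -(real_normK (num_real h)).
  have := pospart_lip (h + k) k.
  rewrite [pospart k k]pospart_eq0// subr0 addrK => H.
  by rewrite -(real_normK (num_real (pospart k (h + k)))); apply: lerXn2r.
Qed.

Lemma is_derive_strunc s : is_derive s 1 (strunc k e) (dstrunc k e s).
Proof.
have d1 : is_derive s 1 ((fun t => pospart k t ^+ 2) + cst (e ^+ 2)) (2 * pospart k s + 0).
  by apply: is_deriveD; exact: is_derive_pospart_sqr.
have pos : 0 < pospart k s ^+ 2 + e ^+ 2 by rewrite ltr_wpDl ?sqr_ge0// exprn_gt0.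
have d2 := @is_derive1_sqrt R _ pos.
have d3 := @is_derive1_comp R Num.sqrt ((fun t => pospart k t ^+ 2) + cst (e ^+ 2)) s _ _ d2 d1.
have := is_deriveB d3 (is_derive_cst e s 1).
rewrite /strunc => /is_derive_eq; apply.
have := sqrt_strunc_gt0 k e0 s => P0.
by rewrite subr0 addr0 /dstrunc; field; rewrite gt_eqF.
Qed.

Lemma continuous_strunc : continuous (strunc k e).
Proof.
move=> s; apply/differentiable_continuous/derivable1_diffP.
by have [] := is_derive_strunc s.
Qed.

Lemma continuous_dstrunc : continuous (dstrunc k e).
Proof.
move=> s; apply/cvgrPdist_lt => r r0; near=> t.
apply: le_lt_trans (dstrunc_lip _ _) _.
rewrite mulrC -ltr_pdivlMr ?divr_gt0//.
by near: t; apply: cvgr_dist_lt; rewrite ?divr_gt0//; exact: cvg_id.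
Unshelve. all: by end_near. Qed.

Lemma strunc_norm_le s : 0 <= k -> `|strunc k e s| <= `|s|.
Proof.
move=> k0; rewrite ger0_norm ?strunc_ge0//.
apply: le_trans (strunc_le_pospart _ e0 _) _.
by rewrite ge_max normr_ge0 andbT lerBlDr (le_trans (ler_norm _))// lerDl.
Qed.

(* Splits according to [`|g| <= M], which is what replaces the passage to an
   almost everywhere convergent subsequence in the chain rule. *)
Lemma dstrunc_sub_split s t g M : 0 < M ->
  `|dstrunc k e s - dstrunc k e t| * `|g| <= 2 / e * M * `|s - t| + g ^+ 2 / M.
Proof.
move=> M0; have [gM|gM] := leP `|g| M.
  apply: (@le_trans _ _ (2 / e * `|s - t| * M)).
    by apply: ler_pM => //; exact: dstrunc_lip.
  by rewrite mulrAC lerDl divr_ge0 ?sqr_ge0// ltW.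
have -> : `|dstrunc k e s - dstrunc k e t| <= 1 ->
    `|dstrunc k e s - dstrunc k e t| * `|g| <= 2 / e * M * `|s - t| + g ^+ 2 / M.
- move=> d1; apply: (@le_trans _ _ `|g|); first by rewrite ler_piMl.
  apply: (@le_trans _ _ (g ^+ 2 / M)).
    by rewrite ler_pdivlMr// -(real_normK (num_real g)) expr2 ler_wpM2l// ltW.
  by rewrite lerDr !mulr_ge0 ?invr_ge0 ?(ltW M0) ?(ltW e0).
- by [].
have := dstrunc_le1 k e0 s; have := dstrunc_ge0 k e s.
have := dstrunc_le1 k e0 t; have := dstrunc_ge0 k e t.
by move=> *; rewrite ler_norml; apply/andP; split; lra.
Qed.

End TruncationCalculus.

(** * Weak gradients as L^2 pairings *)

Section WeakGradient.
Context {R : realType} {N : nat}.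
Notation rV := ('rV[R]_N).
Notation T := (borelRV R N).
Notation leb := (@lebesgueRV R N).
Implicit Types (f g phi : rV -> R).

Lemma test_fun_bounded Om phi : test_fun Om phi -> forall s : seq 'I_N,
  exists C, forall x, `|iter_partial s phi x| <= C.
Proof.
move=> [smo [K [cK KO phi0]]] s.
have z0 x : ~ K x -> iter_partial s phi x = 0.
  elim: s x => [|j s IH] x nK /=; first exact: phi0.
  rewrite /partial (_ : 0 = 'D_(evec R j) (cst 0 : rV -> R) x); last by rewrite derive_cst.
  apply: near_eq_derive.
  have : \forall z \near x, (~` K) z.
    apply: open_nbhs_nbhs; split => //; apply: closed_openC.
    apply: compact_closed => //; exact: norm_hausdorff.
  by apply: filterS => z /IH.
have [cs _] := smo s.
have : compact (iter_partial s phi @` K).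
  by apply: continuous_compact => //; exact: continuous_subspaceT.
move=> /compact_bounded[M [_ HM]].
exists (`|M| + 1) => x; have [Kx|nKx] := pselect (K x); last first.
  by rewrite z0// normr0 addr_ge0.
apply: HM; last by exists x.
by rewrite ltr_pwDr// ler_norm.
Qed.

Lemma partial_eq0 phi (i : 'I_N) K :
  compact K -> (forall x, ~ K x -> phi x = 0) ->
  forall x, ~ K x -> partial i phi x = 0.
Proof.
move=> cK phi0 x nK.
rewrite /partial (_ : 0 = 'D_(evec R i) (cst 0 : rV -> R) x); last by rewrite derive_cst.
apply: near_eq_derive.
have : \forall z \near x, (~` K) z.
  apply: open_nbhs_nbhs; split => //; apply: closed_openC.
  by apply: compact_closed => //; exact: norm_hausdorff.
by apply: filterS => z /phi0.
Qed.

Lemma test_fun_measurable Om phi s : test_fun Om phi ->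
  measurable_fun setT (iter_partial s phi : T -> R).
Proof. by move=> [smo _]; apply: continuous_measurableRV; case: (smo s). Qed.

Lemma sub_test_fun Om1 Om2 phi : Om2 `<=` Om1 -> test_fun Om2 phi -> test_fun Om1 phi.
Proof.
move=> s12 [smo [K [cK KO phi0]]]; split => //; exists K; split => //.
exact: subset_trans s12.
Qed.

Section Domain.
Variable Om : set rV.
Hypothesis mOm : measurable (Om : set T).
Hypothesis Omfin : (leb Om < +oo)%E.

Lemma sqnorm2E f : measurable_fun setT (f : T -> R) ->
  sqnorm2 Om f = (\int[leb]_(x in Om) (f x ^+ 2)%:E)%E.
Proof.
move=> mf; apply: intOnE => // [|x]; last by rewrite lee_fin sqr_ge0.
by apply/measurable_EFinP; exact: measurable_funX.
Qed.

Lemma L2P f : L2 Om f <-> sqint leb Om f.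
Proof.
split=> [[/measurable_borel_fun mf f2]|[mf f2]]; split => //.
- by rewrite -sqnorm2E.
- exact/measurable_borel_fun.
- by rewrite sqnorm2E.
Qed.

Lemma sqnorm2_ip f : sqint leb Om f -> sqnorm2 Om f = (ip leb Om f f)%:E.
Proof. by move=> sf; rewrite sqnorm2E ?EFin_ip_sqr//; case: sf. Qed.

Lemma sintOnE f : measurable_fun setT (f : T -> R) ->
  sintOn Om f = (\int[leb]_(x in Om) (f x)%:E)%E.
Proof.
move=> mf; rewrite /sintOn [RHS]integralE.
have m1 : measurable_fun setT ((fun x => (Num.max (f x) 0)%:E) : T -> \bar R).
  by apply/measurable_EFinP; apply: measurable_maxr => //; exact: measurable_cst.
have m2 : measurable_fun setT ((fun x => (Num.max (- f x) 0)%:E) : T -> \bar R).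
  apply/measurable_EFinP; apply: measurable_maxr; last exact: measurable_cst.
  exact: measurable_funN.
rewrite (intOnE mOm m1) => [|x]; last by rewrite lee_fin le_max lexx orbT.
rewrite (intOnE mOm m2) => [|x]; last by rewrite lee_fin le_max lexx orbT.
congr (_ - _)%E; apply: eq_integral => x _.
  by rewrite funepos.unlock EFin_max.
by rewrite funeneg.unlock EFin_max.
Qed.

Lemma integrableOnE f : measurable_fun setT (f : T -> R) ->
  integrableOn Om f <-> leb.-integrable Om (EFin \o f).
Proof.
move=> mf; have mE : measurable_fun (Om : set T) (EFin \o f : T -> \bar R).
  by apply/measurable_EFinP; exact: measurable_funTS.
rewrite /integrableOn intOnE//; last first.
  by apply/measurable_EFinP; exact: measurableT_comp.
split=> [h|/integrableP[]//]; by apply/integrableP.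
Qed.

Lemma test_fun_sqint phi s : test_fun Om phi -> sqint leb Om (iter_partial s phi).
Proof.
move=> tphi; have [C HC] := test_fun_bounded tphi s.
by apply: (sqint_bounded mOm Omfin _ HC); exact: test_fun_measurable tphi.
Qed.

Lemma test_fun_sqint0 phi : test_fun Om phi -> sqint leb Om phi.
Proof. exact: (@test_fun_sqint phi [::]). Qed.

Lemma test_fun_sqint1 phi i : test_fun Om phi -> sqint leb Om (partial i phi).
Proof. exact: (@test_fun_sqint phi [:: i]). Qed.

(** For square integrable data all integrals in [weak_grad] are finite, so its extended real
    identity is one between real numbers. *)
Lemma weak_grad_ipP f (g : 'I_N -> rV -> R) :
  sqint leb Om f -> (forall i, sqint leb Om (g i)) ->
  weak_grad Om f g <-> forall i phi, test_fun Om phi ->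
    ip leb Om f (partial i phi) = - ip leb Om (g i) phi.
Proof.
move=> sf sg.
have key i phi : test_fun Om phi ->
    [/\ measurable_fun setT ((fun x => f x * partial i phi x) : T -> R),
        measurable_fun setT ((fun x => g i x * phi x) : T -> R),
        leb.-integrable Om (fun x => (f x * partial i phi x)%:E) &
        leb.-integrable Om (fun x => (g i x * phi x)%:E)].
  move=> tphi; have s0 := test_fun_sqint0 tphi; have s1 := test_fun_sqint1 i tphi.
  split; [| |exact: sqintM_integrable|exact: sqintM_integrable].
  - by apply: measurable_funM; [case: sf|case: s1].
  - by apply: measurable_funM; [case: (sg i)|case: s0].
split=> [[_ H] i phi tphi|H].
  have [m1 m2 I1 I2] := key i phi tphi; have [_ _] := H i phi tphi.
  rewrite !sintOnE// => E; apply: EFin_inj.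
  rewrite EFinN !EFin_ip//; [exact: test_fun_sqint0|exact: test_fun_sqint1].
split=> [i|i phi tphi]; first by apply/measurable_borel_fun; case: (sg i).
have [m1 m2 I1 I2] := key i phi tphi; split.
- exact/integrableOnE.
- exact/integrableOnE.
- rewrite !sintOnE// -(@EFin_ip _ _ _ leb Om)//; last exact: test_fun_sqint1.
  rewrite -(@EFin_ip _ _ _ leb Om mOm (g i) phi)//; last exact: test_fun_sqint0.
  by rewrite -EFinN; congr EFin; exact: H.
Qed.

Definition sobolev_fields : set ('I_N.+1 -> T -> R) := [set w |
  (forall i, sqint leb Om (w i)) /\
  forall (i : 'I_N) phi, test_fun Om phi ->
    ip leb Om (w ord0) (partial i phi) = - ip leb Om (w (lift ord0 i)) phi].

Lemma sobolev_fields0 : sobolev_fields 0.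
Proof.
have z phi : ip leb Om (0 : T -> R) phi = 0.
  by rewrite /ip; under eq_Rintegral do rewrite mul0r; rewrite /Rintegral integral0.
by split=> [i|i phi tphi]; [exact: sqint0|rewrite !z oppr0].
Qed.

Lemma sobolev_fields_lin a v w : sobolev_fields v -> sobolev_fields w ->
  sobolev_fields (a *: v + w).
Proof.
move=> [sv Hv] [sw Hw]; split=> [i|i phi tphi]; first exact: sqint_lin.
have s0 := test_fun_sqint0 tphi; have s1 := test_fun_sqint1 i tphi.
rewrite -[X in ip _ _ X _ = _]/(a *: v ord0 + w ord0).
rewrite -[X in _ = - ip _ _ X _]/(a *: v (lift ord0 i) + w (lift ord0 i)).
by rewrite !ip_linl// Hv// Hw//; ring.
Qed.

Lemma ip_cvg (f : nat -> T -> R) f' h : (forall n, sqint leb Om (f n)) ->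
  sqint leb Om f' -> sqint leb Om h ->
  (fun n => ip leb Om (f n - f') (f n - f')) @ \oo --> 0 ->
  (fun n => ip leb Om (f n) h) @ \oo --> ip leb Om f' h.
Proof.
move=> sf sf' sh cf.
have E n : ip leb Om (f n - f') h = ip leb Om (f n) h - ip leb Om f' h.
  rewrite (_ : f n - f' = (-1) *: f' + f n); last by rewrite scaleN1r addrC.
  by rewrite ip_linl//; ring.
apply/cvgrPdist_lt => e e0.
have c0 : (fun n => ip leb Om (f n - f') (f n - f') * ip leb Om h h) @ \oo --> (0 : R).
  by rewrite -[X in _ --> X](mul0r (ip leb Om h h)); apply: cvgM => //; exact: cvg_cst.
move/cvgrPdist_lt : c0 => /(_ (e ^+ 2)); rewrite exprn_gt0// => /(_ isT).
apply: filterS => n; rewrite sub0r normrN distrC -E => H.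
have H2 := ip_CauchySchwarz mOm (sqintB mOm (sf n) sf') sh.
rewrite -(@ltr_pXn2r _ 2%N)// ?nnegrE ?(ltW e0)//.
rewrite real_normK ?num_real//; apply: le_lt_trans H2 _.
by apply: le_lt_trans H; exact: ler_norm.
Qed.

Lemma sobolev_fields_closed (w : nat -> 'I_N.+1 -> T -> R) w' :
  (forall n, sobolev_fields (w n)) -> (forall i, sqint leb Om (w' i)) ->
  (forall i, (fun n => ip leb Om (w n i - w' i) (w n i - w' i)) @ \oo --> 0) ->
  sobolev_fields w'.
Proof.
move=> Ww sw' cw; split=> // i phi tphi.
have s0 := test_fun_sqint0 tphi; have s1 := test_fun_sqint1 i tphi.
have sw n j : sqint leb Om (w n j) by case: (Ww n).
have c1 := ip_cvg (fun n => sw n ord0) (sw' ord0) s1 (cw ord0).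
have c2 := ip_cvg (fun n => sw n (lift ord0 i)) (sw' _) s0 (cw _).
have c3 : (fun n => ip leb Om (w n ord0) (partial i phi)) @ \oo -->
    - ip leb Om (w' (lift ord0 i)) phi.
  rewrite (_ : (fun n => _) = (fun n => - ip leb Om (w n (lift ord0 i)) phi)).
    exact: cvgN.
  by apply/funext => n; case: (Ww n) => _; apply.
by rewrite -(cvg_lim (@Rhausdorff R) c1) -(cvg_lim (@Rhausdorff R) c3).
Qed.

End Domain.
End WeakGradient.

Lemma integrableM_bounded d (T : measurableType d) (R : realType)
    (m : {measure set T -> \bar R}) (f h : T -> R) (C : R) :
  m.-integrable setT (EFin \o f) -> measurable_fun setT h ->
  (forall x, `|h x| <= C) -> m.-integrable setT (EFin \o (fun x => f x * h x)).
Proof.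
move=> If mh hC; rewrite /comp; under eq_fun do rewrite EFinM.
apply: integrableMl => //.
by exists C; split=> [|M CM y _]; [exact: num_real|exact: le_trans (hC y) (ltW CM)].
Qed.

Section ChainRule.
Context {R : realType} {N : nat}.
Notation rV := ('rV[R]_N).
Notation T := (borelRV R N).
Notation leb := (@lebesgueRV R N).
Notation rn := (@mollify_radius R).
Implicit Types (f g u phi : rV -> R) (r : R) (x : rV).

Lemma is_derive_comp (F : R -> R) f x v (df dF : R) :
  is_derive x v f df -> is_derive (f x) 1 F dF -> is_derive x v (F \o f) (dF * df).
Proof.
move=> [f1 f2] dF'; apply: is_derive_line.
have d1 : is_derive (0 : R) 1 (fun t : R => f (t *: v + x)) df.
  apply: DeriveDef; last by rewrite derive_line scale0r add0r.
  by apply: derivable_line; rewrite scale0r add0r.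
have E0 : f x = f ((0 : R) *: v + x) by rewrite scale0r add0r.
rewrite E0 in dF'.
exact: (@is_derive1_comp R F (fun t : R => f (t *: v + x)) 0 _ _ dF' d1).
Qed.

Lemma partial_reflect f i x y : derivable f (x - y) (evec R i) ->
  partial i (fun z => f (x - z)) y = - partial i f (x - y).
Proof.
move=> df; rewrite /partial; set v := evec R i.
have dl : is_derive (0 : R) 1 (fun s : R => f (s *: v + (x - y))) ('D_v f (x - y)).
  apply: DeriveDef; last by rewrite derive_line scale0r add0r.
  by apply: derivable_line; rewrite scale0r add0r.
have dn : is_derive (0 : R) 1 (fun s : R => -1 * s + 0) (-1) by exact: is_derive_affine.
have E0 : -1 * 0 + 0 = 0 :> R by rewrite mulr0 addr0.
rewrite -{1}E0 in dl.
have [_ D] := @is_derive1_comp R (fun s => f (s *: v + (x - y))) (fun s => -1 * s + 0)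
  0 _ _ dl dn.
rewrite mulrN1 in D; rewrite -D -[in LHS](add0r y) -(scale0r v) -derive_line.
congr (derive _ _ _); apply/funext => s /=; congr f.
by rewrite addr0 mulN1r scaleNr opprD addrCA.
Qed.

Lemma mollify_bounded r f : leb.-integrable setT (EFin \o f) ->
  exists C, forall x, `|mollify r f x| <= C.
Proof.
move=> If; have [C HC] := mollifier_bounded (N := N) r.
exists (C * \int[leb]_y `|f y|) => x.
have In := integrable_norm If.
apply: le_trans (le_normr_Rintegral measurableT (mollify_integrand r x If)) _.
rewrite -RintegralZl//; apply: le_Rintegral => //.
- exact: (integrable_norm (mollify_integrand r x If)).
- exact: (integrableZl measurableT C In).
- by move=> y _; rewrite normrM mulrC ler_wpM2r.
Qed.

Lemma measurable_mollify r f : 0 < r -> leb.-integrable setT (EFin \o f) ->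
  measurable_fun setT (mollify r f : T -> R).
Proof.
move=> r0 If; have /integrableP[mE _] := mollify_integrable r0 If.
exact/measurable_EFinP.
Qed.

Lemma mollify_derive r f i x : leb.-integrable setT (EFin \o f) ->
  derivable (mollify r f) x (evec R i) /\
  partial i (mollify r f) x = \int[leb]_y (f y * partial i (mollifier r) (x - y)).
Proof.
move=> If; have [C0 H0] := mollifier_bounded (N := N) r.
have ep := elementary_partial i (elementary_mollifier (N := N) r).
have [C H] := elementary_bounded ep.
apply: (convolution_derive If (measurable_mollifier r) H0 _ H) => y.
by have [_ h] := elementary_smooth (elementary_mollifier (N := N) r) [::]; exact: h.
Qed.

Lemma partial_mollify_bounded r f i : leb.-integrable setT (EFin \o f) ->
  exists C, forall x, `|partial i (mollify r f) x| <= C.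
Proof.
move=> If; have ep := elementary_partial i (elementary_mollifier (N := N) r).
have [C HC] := elementary_bounded ep.
exists (C * \int[leb]_y `|f y|) => x; have [_ ->] := mollify_derive r i x If.
have In := integrable_norm If.
have mp : measurable_fun setT ((fun y => partial i (mollifier r) (x - y)) : T -> R).
  exact: (measurableT_comp (elementary_measurable ep) (measurable_reflectRV x)).
have I1 := integrableM_bounded If mp (fun y => HC (x - y)).
apply: le_trans (le_normr_Rintegral measurableT I1) _.
rewrite -RintegralZl//; apply: le_Rintegral => //.
- exact: (integrable_norm I1).
- exact: (integrableZl measurableT C In).
- by move=> y _; rewrite normrM mulrC ler_wpM2r.
Qed.

Lemma compact_cubeRV r x : compact [set y | cubeRV N r (x - y)].
Proof.
have -> : [set y | cubeRV N r (x - y)] =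
    [set y : rV | forall i, `[x ord0 i - r, x ord0 i + r]%classic (y ord0 i)].
  apply/seteqP; split => y /= H i; have := H i; rewrite !mxE/= in_itv/=.
    by rewrite ler_distlC.
  by rewrite ler_distlC.
apply: (@rV_compact R N (fun i => `[x ord0 i - r, x ord0 i + r]%classic)) => i.
exact: segment_compact.
Qed.

(** Compactness makes one radius serve all of [K]: half of the local margin absorbs the motion of
    the centre, the other half the cube. *)
Lemma compact_cube_near (U K : set rV) : open U -> compact K -> K `<=` U ->
  \forall n \near \oo, forall x, K x -> forall y, cubeRV N (rn n) (x - y) -> U y.
Proof.
move=> oU /compact_near_coveringP cK KU.
apply: (cK nat \oo (fun n x => forall y, cubeRV N (rn n) (x - y) -> U y)).
move=> x /KU Ux; have [s s0 sU] := open_cube_near oU Ux.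
have s20 : 0 < s / 2 by rewrite divr_gt0.
have nx : \forall z \near x, cubeRV N (s / 2) (x - z).
  apply/nbhs_ballP; exists (s / 2) => //= z [_ xz] i.
  by have := xz ord0 i; rewrite -ball_normE/= !mxE => /ltW.
have nn : \forall n \near \oo, rn n <= s / 2.
  apply: (cvgr_le (0 : R)) => //; exact: mollify_radius_cvg0.
exists ([set z | cubeRV N (s / 2) (x - z)], [set n | rn n <= s / 2]) => //.
move=> [z n] /= [xz rs] y zy; apply: sU => i.
have -> : (x - y) ord0 i = (x - z) ord0 i + (z - y) ord0 i by rewrite !mxE; ring.
apply: le_trans (ler_normD _ _) _; have := xz i; have := zy i; lra.
Qed.

Section WeakDerivative.
Variables (Om : set rV) (u g : rV -> R) (i : 'I_N).
Hypothesis Iu : leb.-integrable setT (EFin \o u).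
Hypothesis weak : forall phi, test_fun Om phi ->
  \int[leb]_x (u x * partial i phi x) = - \int[leb]_x (g x * phi x).

(** The weak equation is tested with the reflected mollifier around [x], supported in [Om] by
    assumption; the sign from the reflection cancels the sign of the weak equation. *)
Lemma partial_mollify r x : (forall y, cubeRV N r (x - y) -> Om y) ->
  partial i (mollify r u) x = mollify r g x.
Proof.
move=> xO; have [_ ->] := mollify_derive r i x Iu.
pose phi y := mollifier r (x - y).
have smo := elementary_smooth (elementary_mollifier (N := N) r).
have tphi : test_fun Om phi.
  split; first exact: elementary_smooth (elementary_reflect x (elementary_mollifier r)).
  exists [set y | cubeRV N r (x - y)]; split => //; first exact: compact_cubeRV.
  by move=> y /= nx; exact: mollifier_eq0.
rewrite /mollify -[RHS]opprK -(weak tphi) -(mulN1r (\int[leb]_y _)) -RintegralZl//.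
  apply: eq_Rintegral => y _; rewrite partial_reflect; first by ring.
  by have [_ h] := smo [::]; exact: h.
have [C HC] := test_fun_bounded tphi [:: i].
apply: (integrableM_bounded Iu _ HC).
exact: (test_fun_measurable [:: i] tphi).
Qed.

Variables (k e : R).
Hypotheses (k0 : 0 <= k) (e0 : 0 < e).

(** The integrand is the classical derivative of the truncated mollification times [phi]: the
    derivative of the mollified [u] equals the mollified [g] on [K], and off [K] its coefficient
    [phi] vanishes. *)
Lemma truncate_mollify_eq0 r phi K : 0 < r -> compact K ->
  (forall x, ~ K x -> phi x = 0) -> test_fun Om phi ->
  (forall x, K x -> forall y, cubeRV N r (x - y) -> Om y) ->
  \int[leb]_x (strunc k e (mollify r u x) * partial i phi x +
    dstrunc k e (mollify r u x) * mollify r g x * phi x) = 0.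
Proof.
move=> r0 cK phi0 tphi KO; have [smo _] := tphi; set ur := mollify r u.
have [Cu HCu] := mollify_bounded r Iu.
have [Cd HCd] := partial_mollify_bounded r i Iu.
have [C0 HC0] : exists C, forall x, `|phi x| <= C := test_fun_bounded tphi [::].
have [C1 HC1] : exists C, forall x, `|partial i phi x| <= C := test_fun_bounded tphi [:: i].
have Cu0 := le_trans (normr_ge0 _) (HCu 0).
have Cd0 := le_trans (normr_ge0 _) (HCd 0).
have C00 := le_trans (normr_ge0 _) (HC0 0).
have C10 := le_trans (normr_ge0 _) (HC1 0).
have HS x : `|strunc k e (ur x)| <= Cu by apply: le_trans (strunc_norm_le e0 _ k0) _.
have Hd x : `|dstrunc k e (ur x)| <= 1 by rewrite ger0_norm ?dstrunc_ge0 ?dstrunc_le1.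
pose psi : rV -> R := (strunc k e \o ur) * phi.
have dpsi x : is_derive x (evec R i) psi
    (strunc k e (ur x) * partial i phi x + dstrunc k e (ur x) * partial i ur x * phi x).
  have [du _] := mollify_derive r i x Iu.
  have d1 : is_derive x (evec R i) ur (partial i ur x) by apply: DeriveDef.
  have d2 : is_derive x (evec R i) phi (partial i phi x).
    by apply: DeriveDef => //; have [_ h] := smo [::]; exact: h.
  have d3 := is_derive_comp d1 (is_derive_strunc k e0 (ur x)).
  have := is_deriveM d3 d2.
  by rewrite /GRing.scale/= [phi x * _]mulrC.
have mu : measurable_fun setT (ur : T -> R) by exact: measurable_mollify.
have mphi : measurable_fun setT (phi : T -> R) := test_fun_measurable [::] tphi.
have mpsi : measurable_fun setT (psi : T -> R).
  apply: measurable_funM => //; apply: measurableT_comp => //.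
  by apply: continuous_measurable_fun; exact: continuous_strunc.
have [M [_ HM]] := compact_bounded cK.
have KM x : K x -> cubeRV N (`|M| + 1) x.
  move=> Kx j; have : `|x| <= `|M| + 1.
    by apply: HM => //; rewrite ltr_pwDr// ler_norm.
  apply: le_trans; rewrite /Num.norm/= mx_normrE.
  exact: (le_bigmax (0 : R) (fun ij => `|x ij.1 ij.2|) (ord0, j)).
(* A common bound for the product and for its derivative, since [integral_derive_eq0] has one
   constant for both. *)
pose C := Cu * C0 + (Cu * C1 + Cd * C0).
have E : \int[leb]_x 'D_(evec R i) psi x = 0.
  apply: (@integral_derive_eq0 _ _ psi i (`|M| + 1) C) => //.
  - by move=> x nx; rewrite -[psi x]/(_ * phi x) phi0 ?mulr0// => /KM.
  - move=> x; rewrite -[psi x]/(strunc k e (ur x) * phi x) normrM.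
    apply: (@le_trans _ _ (Cu * C0)); first by apply: ler_pM.
    by rewrite lerDl addr_ge0 ?mulr_ge0.
  - move=> x; have [_ ->] := dpsi x.
    apply: (@le_trans _ _ (Cu * C1 + Cd * C0)); last by rewrite lerDr mulr_ge0.
    apply: le_trans (ler_normD _ _) _; rewrite (normrM _ (partial i phi x)).
    rewrite (normrM _ (phi x)) (normrM (dstrunc k e (ur x))).
    apply: lerD; apply: ler_pM; rewrite ?mulr_ge0//.
    by rewrite -[leRHS]mul1r; apply: ler_pM.
rewrite -[RHS]E; apply: eq_Rintegral => x _; have [_ ->] := dpsi x; congr (_ + _).
have [Kx|nKx] := pselect (K x); last by rewrite phi0// !mulr0.
by congr (_ * _ * _); rewrite partial_mollify//; exact: KO.
Qed.

End WeakDerivative.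
End ChainRule.

Section Restriction.
Context {d : measure_display} {T : measurableType d} {R : realType}.
Variables (m : {measure set T -> \bar R}) (D : set T).
Hypothesis mD : measurable D.

Lemma Rintegral_mul_indic (f : T -> R) :
  \int[m]_(x in D) f x = \int[m]_x (f x * \1_D x).
Proof.
rewrite /Rintegral integral_mkcond; congr fine; apply: eq_integral => x _.
by rewrite patchE indicE; case: (x \in D); rewrite ?mulr1 ?mulr0.
Qed.

Lemma integrable_mul_indic (f : T -> R) : m.-integrable D (EFin \o f) ->
  m.-integrable setT (EFin \o (fun x => f x * \1_D x)).
Proof.
move=> /(integrable_mkcond _ mD); congr (_.-integrable _ _).
apply/funext => x; rewrite patchE /= indicE.
by case: (x \in D); rewrite ?mulr1 ?mulr0.
Qed.

Lemma sqint_integrable1 (f : T -> R) : (m D < +oo)%E -> sqint m D f ->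
  m.-integrable D (EFin \o f).
Proof.
move=> Dfin sf.
have s1 : sqint m D (cst 1).
  by apply: (@sqint_bounded _ _ _ _ _ mD _ 1) => // x; rewrite normr1.
have := sqintM_integrable mD sf s1.
by congr (_.-integrable _ _); apply/funext => x; rewrite /= mulr1.
Qed.

End Restriction.

Section TruncateLimit.
Context {R : realType} {N : nat}.
Notation rV := ('rV[R]_N).
Notation T := (borelRV R N).
Notation leb := (@lebesgueRV R N).
Notation rn := (@mollify_radius R).
Variables (Om : set rV) (u g : rV -> R) (i : 'I_N) (k e : R).
Hypotheses (oOm : open Om) (Omfin : (leb Om < +oo)%E).
Hypotheses (Iu : leb.-integrable setT (EFin \o u))
  (Ig : leb.-integrable setT (EFin \o g))
  (Ig2 : leb.-integrable setT (EFin \o (fun x => g x ^+ 2))).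
Hypotheses (u0 : forall x, ~ Om x -> u x = 0) (g0 : forall x, ~ Om x -> g x = 0).
Hypothesis weak : forall phi, test_fun Om phi ->
  \int[leb]_x (u x * partial i phi x) = - \int[leb]_x (g x * phi x).
Hypotheses (k0 : 0 <= k) (e0 : 0 < e).

Notation F v h phi := (fun x =>
  strunc k e (v x) * partial i phi x + dstrunc k e (v x) * h x * phi x).

Lemma truncate_integrable v h phi : test_fun Om phi ->
  leb.-integrable setT (EFin \o v) -> leb.-integrable setT (EFin \o h) ->
  leb.-integrable setT (EFin \o F v h phi).
Proof.
move=> tphi Iv Ih.
have mv : measurable_fun setT (v : T -> R).
  by have /integrableP[/measurable_EFinP] := Iv.
have mh : measurable_fun setT (h : T -> R).
  by have /integrableP[/measurable_EFinP] := Ih.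
have [C0 HC0] : exists C, forall x, `|phi x| <= C := test_fun_bounded tphi [::].
have [C1 HC1] : exists C, forall x, `|partial i phi x| <= C := test_fun_bounded tphi [:: i].
have mphi : measurable_fun setT (phi : T -> R) := test_fun_measurable [::] tphi.
have mdphi : measurable_fun setT (partial i phi : T -> R) :=
  test_fun_measurable [:: i] tphi.
have I1 : leb.-integrable setT (EFin \o (fun x => strunc k e (v x))).
  apply: (le_integrable measurableT _ _ (integrable_norm Iv)).
    apply/measurable_EFinP; apply: measurableT_comp => //.
    by apply: continuous_measurable_fun; exact: continuous_strunc.
  by move=> x _; rewrite !abse_EFin lee_fin normr_id strunc_norm_le.
have I2 : leb.-integrable setT (EFin \o (fun x => dstrunc k e (v x) * h x)).
  apply: (le_integrable measurableT _ _ (integrable_norm Ih)).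
    apply/measurable_EFinP; apply: measurable_funM => //; apply: measurableT_comp => //.
    by apply: continuous_measurable_fun; exact: continuous_dstrunc.
  move=> x _; rewrite !abse_EFin lee_fin normr_id (normrM (dstrunc _ _ _)).
  by rewrite -[leRHS]mul1r ler_wpM2r// ger0_norm ?dstrunc_ge0 ?dstrunc_le1.
have := integrableD measurableT (integrableM_bounded I1 mdphi HC1)
  (integrableM_bounded I2 mphi HC0).
by [].
Qed.

Lemma truncate_sub_le v h phi C0 C1 M x : 0 < M ->
  `|phi x| <= C0 -> `|partial i phi x| <= C1 ->
  `|F v h phi x - F u g phi x| <= (C1 + C0 * (2 / e * M)) * `|v x - u x| +
    C0 * `|h x - g x| + C0 / M * g x ^+ 2.
Proof.
move=> M0 p0 p1.
have C00 := le_trans (normr_ge0 _) p0; have C10 := le_trans (normr_ge0 _) p1.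
set a := strunc k e (v x); set b := strunc k e (u x).
set a' := dstrunc k e (v x); set b' := dstrunc k e (u x).
have -> : a * partial i phi x + a' * h x * phi x - (b * partial i phi x + b' * g x * phi x) =
  (a - b) * partial i phi x + (a' * (h x - g x) + (a' - b') * g x) * phi x by ring.
apply: le_trans (ler_normD _ _) _; rewrite !normrM.
have H1 : `|a - b| * `|partial i phi x| <= C1 * `|v x - u x|.
  by rewrite mulrC; apply: ler_pM => //; exact: strunc_lip.
have H2 : `|a' * (h x - g x) + (a' - b') * g x| * `|phi x| <=
    (`|h x - g x| + (2 / e * M * `|v x - u x| + g x ^+ 2 / M)) * C0.
  apply: ler_pM => //; apply: le_trans (ler_normD _ _) _; apply: lerD; last first.
    by rewrite normrM; exact: dstrunc_sub_split.
  rewrite (normrM a') -[leRHS]mul1r ler_wpM2r//.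
  by rewrite ger0_norm ?dstrunc_ge0 ?dstrunc_le1.
apply: le_trans (lerD H1 H2) _; rewrite le_eqVlt; apply/orP; left; apply/eqP.
by ring.
Qed.

(** For fixed [M] the L^1 convergence of both mollifications leaves only the contribution of |g| >
    M, at most C0 / M times the integral of g^2; then [M] is taken large. *)
Lemma integral_truncate_eq0 phi : test_fun Om phi ->
  \int[leb]_x F u g phi x = 0.
Proof.
move=> tphi; have [_ [K [cK KO phi0]]] := tphi.
have [C0 HC0] : exists C, forall x, `|phi x| <= C := test_fun_bounded tphi [::].
have [C1 HC1] : exists C, forall x, `|partial i phi x| <= C := test_fun_bounded tphi [:: i].
have C00 := le_trans (normr_ge0 _) (HC0 0).
have [_ cu] := mollify_cvg_L1 oOm Omfin Iu u0.
have [_ cg] := mollify_cvg_L1 oOm Omfin Ig g0.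
pose G : R := \int[leb]_x g x ^+ 2.
have G0 : 0 <= G by apply: Rintegral_ge0 => x _; exact: sqr_ge0.
set X := \int[leb]_x _.
have key M : 0 < M -> `|X| <= C0 / M * G.
  move=> M0; pose B := C1 + C0 * (2 / e * M).
  pose a n : R := \int[leb]_x `|mollify (rn n) u x - u x|.
  pose b n : R := \int[leb]_x `|mollify (rn n) g x - g x|.
  have cB : (fun n => B * a n + C0 * b n + C0 / M * G) @ \oo --> C0 / M * G.
    suff : (fun n => B * a n + C0 * b n + C0 / M * G) @ \oo -->
        B * 0 + C0 * 0 + C0 / M * G by rewrite !mulr0 !add0r.
    apply: cvgD; last exact: cvg_cst.
    by apply: cvgD; apply: cvgM => //; exact: cvg_cst.
  apply: (cvgr_to_ge cB); near=> n.
  have KOn : forall x, K x -> forall y, cubeRV N (rn n) (x - y) -> Om y.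
    by near: n; exact: compact_cube_near.
  have r0 : 0 < rn n by exact: mollify_radius_gt0.
  have E := truncate_mollify_eq0 Iu weak k0 e0 r0 cK phi0 tphi KOn.
  have Imu := mollify_integrable r0 Iu; have Img := mollify_integrable r0 Ig.
  have IF1 := truncate_integrable tphi Imu Img.
  have IF2 := truncate_integrable tphi Iu Ig.
  have IB := integrableB measurableT IF1 IF2.
  have -> : `|X| = `|\int[leb]_x (F (mollify (rn n) u) (mollify (rn n) g) phi x
      - F u g phi x)|.
    by rewrite RintegralB// E sub0r normrN.
  apply: le_trans (le_normr_Rintegral measurableT IB) _.
  have Ia := mollify_sub_integrable n Iu; have Ib := mollify_sub_integrable n Ig.
  have I1 := integrableZl measurableT B Ia.
  have I2 := integrableZl measurableT C0 Ib.
  have I3 := integrableZl measurableT (C0 / M) Ig2.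
  have I12 := integrableD measurableT I1 I2.
  have I123 := integrableD measurableT I12 I3.
  rewrite /a /b /G -!RintegralZl//.
  rewrite -[X in _ <= X + _]RintegralD//.
  rewrite -RintegralD//.
  apply: le_Rintegral => //; first exact: (integrable_norm IB).
  by move=> x _; exact: truncate_sub_le.
apply/eqP; rewrite -normr_le0; apply/ler_addgt0Pl => t t0; rewrite addr0.
(* With this value as [M] the remainder is below [t]; the added 1 keeps it positive. *)
have M0 : 0 < (C0 * G + 1) / t.
  by rewrite divr_gt0// ltr_wpDl// mulr_ge0.
apply: le_trans (key _ M0) _.
have D0 : 0 < C0 * G + 1 by rewrite ltr_wpDl// mulr_ge0.
have -> : C0 / ((C0 * G + 1) / t) * G = C0 * G / (C0 * G + 1) * t.
  by field; rewrite !gt_eqF.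
rewrite -[leRHS]mul1r ler_wpM2r ?(ltW t0)//.
by rewrite ler_pdivrMr// mul1r lerDl.
Unshelve. all: by end_near.
Qed.

End TruncateLimit.

Section SobolevDirichlet.
Context {R : realType} {N : nat}.
Notation rV := ('rV[R]_N).
Notation T := (borelRV R N).
Notation leb := (@lebesgueRV R N).
Variable Om : set rV.
Hypotheses (oOm : open Om) (Omfin : (leb Om < +oo)%E).
Let mOm : measurable (Om : set T) := open_measurableRV oOm.

(** The fields are extended by zero to the whole space, where mollification acts. The weak equation
    persists because it is tested only inside [Om]. *)
Lemma sobolev_fields_truncate (w : 'I_N.+1 -> T -> R) k e :
  sobolev_fields Om w -> 0 <= k -> 0 < e -> sobolev_fields Om (truncate k e w).
Proof.
move=> [sw Hw] k0 e0.
have mw i : measurable_fun setT (w i) by case: (sw i).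
have md : measurable_fun setT (dstrunc k e \o w ord0 : T -> R).
  apply: measurableT_comp => //.
  by apply: continuous_measurable_fun; exact: continuous_dstrunc.
have st i : sqint leb Om (truncate k e w i).
  rewrite /truncate; case: eqP => [_|_].
    apply: (le_sqint mOm _ (sw ord0)) => [|x _]; last exact: strunc_norm_le.
    apply: measurableT_comp => //.
    by apply: continuous_measurable_fun; exact: continuous_strunc.
  apply: (le_sqint mOm _ (sw i)) => [|x _]; first exact: measurable_funM.
  rewrite (normrM (dstrunc _ _ _)) -[leRHS]mul1r ler_wpM2r//.
  by rewrite ger0_norm ?dstrunc_ge0 ?dstrunc_le1.
split=> // i phi tphi.
have s0 := test_fun_sqint0 mOm Omfin tphi; have s1 := test_fun_sqint1 mOm Omfin i tphi.
pose u x := w ord0 x * \1_Om x; pose g x := w (lift ord0 i) x * \1_Om x.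
have Iu := integrable_mul_indic mOm (sqint_integrable1 mOm Omfin (sw ord0)).
have Ig := integrable_mul_indic mOm (sqint_integrable1 mOm Omfin (sw (lift ord0 i))).
have Ig2 : leb.-integrable setT (EFin \o (fun x => g x ^+ 2)).
  have := integrable_mul_indic mOm (sqint_integrable (sw (lift ord0 i))).
  congr (_.-integrable _ _); apply/funext => x /=; congr EFin.
  by rewrite /g indicE; case: (x \in Om); rewrite ?mulr1 ?mulr0 ?expr0n.
have u0 x : ~ Om x -> u x = 0 by move=> nx; rewrite /u indicE memNset// mulr0.
have g0 x : ~ Om x -> g x = 0 by move=> nx; rewrite /g indicE memNset// mulr0.
have weak psi : test_fun Om psi ->
    \int[leb]_x (u x * partial i psi x) = - \int[leb]_x (g x * psi x).
  move=> /(Hw i); rewrite /ip !(Rintegral_mul_indic leb Om) => H.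
  under eq_Rintegral do rewrite mulrAC.
  by rewrite H; congr (- _); apply: eq_Rintegral => x _; rewrite mulrAC.
have E := integral_truncate_eq0 oOm Omfin Iu Ig Ig2 u0 g0 weak k0 e0 tphi.
apply/eqP; rewrite -addr_eq0 -[X in _ == X]E /ip -RintegralD//; last 2 first.
- exact: sqintM_integrable.
- exact: sqintM_integrable.
rewrite (Rintegral_mul_indic leb Om); apply/eqP/eq_Rintegral => x _.
rewrite /truncate/= /u /g indicE; have [xO|nxO] := boolP (x \in Om).
  by rewrite !mulr1.
rewrite !mulr0 mul0r addr0.
by rewrite strunc_eq0// mul0r.
Qed.

Lemma sobolev_dirichlet : dirichlet_space leb Om (sobolev_fields Om).
Proof.
split.
- exact: sobolev_fields0.
- by move=> a v w; exact: sobolev_fields_lin.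
- by move=> w [].
- by move=> w w'; exact: sobolev_fields_closed.
- by move=> w k e; exact: sobolev_fields_truncate.
Qed.

End SobolevDirichlet.

(** * The Sobolev inequality on subsets *)

Section Interpolation.
Context {d : measure_display} {T : measurableType d} {R : realType}.
Variables (m : {measure set T -> \bar R}) (D : set T).
Hypothesis mD : measurable D.

(** Above the threshold, s^2 = |s|^(2 - q) |s|^q and the exponent 2 - q is negative. *)
Lemma threshold_sqr (l s q : R) : 0 < l -> 2 < q ->
  s ^+ 2 <= l ^+ 2 + l `^ (2 - q) * `|s| `^ q.
Proof.
move=> l0 q2; rewrite -[leLHS]real_normK ?num_real//.
have [sl|ls] := leP `|s| l.
  apply: (@le_trans _ _ (l ^+ 2)); first by rewrite lerXn2r ?nnegrE ?(ltW l0).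
  by rewrite lerDl mulr_ge0 ?powR_ge0.
have s0 : 0 < `|s| by exact: lt_trans ls.
have E : `|s| ^+ 2 = `|s| `^ (2 - q) * `|s| `^ q.
  rewrite -powRD; last by rewrite (gt_eqF s0) implybT.
  by rewrite subrK powR_mulrn.
rewrite {1}E; apply: (@le_trans _ _ (l `^ (2 - q) * `|s| `^ q)); last first.
  by rewrite lerDr sqr_ge0.
rewrite ler_wpM2r ?powR_ge0// -opprB !powRN lef_pV2 ?posrE ?powR_gt0//.
by rewrite ge0_ler_powR ?nnegrE ?(ltW l0) ?(ltW s0) ?(ltW ls) ?subr_ge0 ?ltW.
Qed.

(** Hoelder's bound up to the factor 2, by splitting at the threshold B |E|^(-1/q), which makes both
    parts equal to B^2 |E|^(1 - 2/q). *)
Lemma ip_le_Lq (v : T -> R) (q B : R) (E : set T) : sqint m D v -> 2 < q -> 0 < B ->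
  (\int[m]_(x in D) (`|v x| `^ q)%:E <= (B `^ q)%:E)%E ->
  measurable E -> E `<=` D -> (m E < +oo)%E -> 0 < fine (m E) ->
  ip m E v v <= 2 * B ^+ 2 * fine (m E) `^ (1 - 2 / q).
Proof.
move=> sv q2 B0 Hq mE ED Efin a0; set a := fine (m E) in a0 *.
have q0 : 0 < q by lra.
have mv : measurable_fun setT v by case: sv.
have mvq D' : measurable_fun D' (fun x => (`|v x| `^ q)%:E).
  apply/measurable_EFinP; apply: measurable_funTS.
  apply: (measurableT_comp (measurable_powR q)); exact: measurableT_comp.
have aE : m E = a%:E by rewrite fineK// ge0_fin_numE.
have apos : 0 < a `^ (- q^-1) by rewrite powR_gt0.
pose l := B * a `^ (- q^-1); have l0 : 0 < l by rewrite mulr_gt0.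
have -> : 2 * B ^+ 2 * a `^ (1 - 2 / q) = l ^+ 2 * a + l `^ (2 - q) * B `^ q.
  have e1 : l ^+ 2 * a = B ^+ 2 * a `^ (1 - 2 / q).
    rewrite /l exprMn -mulrA; congr (_ * _).
    rewrite -powR_mulrn ?(ltW apos)// -powRrM -{2}(powRr1 (ltW a0)) -powRD; last first.
      by rewrite (gt_eqF a0) implybT.
    by congr (_ `^ _); field; rewrite gt_eqF.
  have e2 : l `^ (2 - q) * B `^ q = B ^+ 2 * a `^ (1 - 2 / q).
    rewrite /l powRM ?(ltW B0) ?(ltW apos)// mulrAC -powRD; last first.
      by rewrite (gt_eqF B0) implybT.
    rewrite subrK powR_mulrn ?(ltW B0)// -powRrM; congr (_ * _ `^ _).
    by field; rewrite gt_eqF.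
  by rewrite e1 e2; ring.
rewrite -lee_fin EFin_ip_sqr; last exact: sub_sqint sv.
apply: (@le_trans _ _ (\int[m]_(x in E)
    ((l ^+ 2)%:E + (l `^ (2 - q))%:E * (`|v x| `^ q)%:E))%E).
  apply: ge0_le_integral => //.
  - by move=> x _; rewrite lee_fin sqr_ge0.
  - by apply/measurable_EFinP; apply: measurable_funTS; exact: measurable_funX.
  - by apply: emeasurable_funD => //; exact: measurable_funeM.
  - by move=> x _; rewrite -EFinM -EFinD lee_fin; exact: threshold_sqr.
have f0 (x : T) : E x -> (0 <= (l ^+ 2)%:E)%E by rewrite lee_fin sqr_ge0.
have g0 (x : T) : E x -> (0 <= (`|v x| `^ q)%:E)%E by rewrite lee_fin powR_ge0.
have h0 (x : T) : E x -> (0 <= (l `^ (2 - q))%:E * (`|v x| `^ q)%:E)%E.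
  by rewrite -EFinM lee_fin mulr_ge0 ?powR_ge0.
have mh : measurable_fun E (fun x => (l `^ (2 - q))%:E * (`|v x| `^ q)%:E)%E.
  exact: measurable_funeM.
rewrite (ge0_integralD _ mE f0 _ h0 mh)// integral_cst//.
rewrite (ge0_integralZl_EFin _ mE g0)// ?powR_ge0//.
rewrite EFinD !EFinM aE; apply: leeD => //; apply: lee_wpmul2l.
  by rewrite lee_fin powR_ge0.
apply: le_trans Hq;   exact: (ge0_subset_integral m mE mD).
exact: mE.
Qed.

End Interpolation.

Section SobolevInequality.
Context {R : realType} {N : nat}.
Notation rV := ('rV[R]_N).
Notation T := (borelRV R N).
Notation leb := (@lebesgueRV R N).
Variable Om : set rV.
Hypotheses (oOm : open Om) (Omfin : (leb Om < +oo)%E).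
Let mOm : measurable (Om : set T) := open_measurableRV oOm.
Variables (q c : R).
Hypotheses (q2 : 2 < q) (c0 : 0 < c).
Hypothesis embedding : forall f, W12 Om f -> (Lqnorm q Om f <= c%:E * W12norm Om f)%E.

Lemma sobolev_fields_weak_grad (w : 'I_N.+1 -> T -> R) : sobolev_fields Om w ->
  weak_grad Om (w ord0) (fun i => w (lift ord0 i)).
Proof. by move=> [sw Hw]; apply/weak_grad_ipP. Qed.

Lemma sum_sqr_ip (I : finType) (g : I -> T -> R) : (forall i, sqint leb Om (g i)) ->
  intOn Om (fun x => (\sum_i g i x ^+ 2)%:E) = (\sum_i ip leb Om (g i) (g i))%:E.
Proof.
move=> sg; rewrite intOnE//; last 2 first.
- apply/measurable_EFinP; apply: measurable_sum => i; apply: measurable_funX.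
  by case: (sg i).
- by move=> x; rewrite lee_fin sumr_ge0// => i _; exact: sqr_ge0.
under eq_integral do rewrite -sumEFin.
rewrite ge0_integral_sum//; last 2 first.
- move=> i; apply/measurable_EFinP; apply: measurable_funTS; apply: measurable_funX.
  by case: (sg i).
- by move=> i x _; rewrite lee_fin sqr_ge0.
by rewrite -sumEFin; apply: eq_bigr => i _; rewrite EFin_ip_sqr.
Qed.

Lemma Qform_le (w : 'I_N.+1 -> T -> R) : sobolev_fields Om w ->
  (Qform Om (w ord0) <= (energy leb Om w w - ip leb Om (w ord0) (w ord0))%:E)%E.
Proof.
move=> Ww; have [sw Hw] := Ww; rewrite /Qform asboolT; last exact/L2P.
apply: ereal_inf_lbound; exists (fun i => w (lift ord0 i)).
  exact: sobolev_fields_weak_grad.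
by rewrite sum_sqr_ip// /energy big_ord_recl addrAC subrr add0r.
Qed.

Lemma sobolev_W12 (w : 'I_N.+1 -> T -> R) : sobolev_fields Om w -> W12 Om (w ord0).
Proof.
move=> Ww; have [sw _] := Ww; split; first exact/L2P.
exists (fun i => w (lift ord0 i)); split; first exact: sobolev_fields_weak_grad.
by move=> i; exact/L2P.
Qed.

Lemma sobolev_Lq (w : 'I_N.+1 -> T -> R) : sobolev_fields Om w ->
  (\int[leb]_(x in Om) (`|w ord0 x| `^ q)%:E <=
    ((c * Num.sqrt (energy leb Om w w)) `^ q)%:E)%E.
Proof.
move=> Ww; have [sw _] := Ww.
have q0 : 0 < q by apply: lt_trans q2; rewrite ltr0n.
have mv : measurable_fun setT (w ord0) by case: (sw ord0).
have := embedding (sobolev_W12 Ww); rewrite /Lqnorm intOnE//; last first.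
  apply/measurable_EFinP.
  by apply: (measurableT_comp (measurable_powR q)); exact: measurableT_comp.
set I := integral _ _ _ => H.
have I0 : (0 <= I)%E by apply: integral_ge0 => x _; rewrite lee_fin powR_ge0.
have H2 : (I `^ q^-1 <= (c * Num.sqrt (energy leb Om w w))%:E)%E.
  apply: le_trans H _; rewrite EFinM; apply: lee_wpmul2l; first by rewrite lee_fin ltW.
  rewrite /W12norm (sqnorm2_ip mOm (sw ord0)) -powR12_sqrt ?energy_ge0//.
  rewrite -poweR_EFin; apply: gt0_ler_poweR.
  - by rewrite invr_ge0.
  - rewrite in_itv/= leey andbT adde_ge0//; first by rewrite lee_fin ip_ge0.
    rewrite /Qform asboolT; last exact/L2P.
    apply: le_ereal_inf_tmp => _ [g _ <-]; apply: iint_ge0 => x; case: asbool => //.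
    by rewrite lee_fin sumr_ge0// => i _; exact: sqr_ge0.
  - by rewrite in_itv/= leey andbT lee_fin energy_ge0.
  - have := leeD (lexx (ip leb Om (w ord0) (w ord0))%:E) (Qform_le Ww).
    by rewrite -EFinD addrCA subrr addr0.
have -> : I = (I `^ q^-1 `^ q)%E by rewrite -poweRrM mulVf ?gt_eqF// poweRe1.
rewrite -poweR_EFin; apply: gt0_ler_poweR => //; first exact: ltW.
- by rewrite in_itv/= leey andbT poweR_ge0.
- by rewrite in_itv/= leey andbT lee_fin mulr_ge0 ?(ltW c0) ?sqrtr_ge0.
Qed.

Lemma sobolev_inequality (w : 'I_N.+1 -> T -> R) (E : set T) : sobolev_fields Om w ->
  measurable E -> E `<=` Om ->
  ip leb E (w ord0) (w ord0) <=
    2 * c ^+ 2 * fine (leb E) `^ (1 - 2 / q) * energy leb Om w w.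
Proof.
move=> Ww mE EO; have [sw _] := Ww.
have Efin : (leb E < +oo)%E by exact: (sub_measure_lty mOm Omfin mE EO).
have R0 : 0 <= 2 * c ^+ 2 * fine (leb E) `^ (1 - 2 / q) * energy leb Om w w.
  apply: mulr_ge0; last exact: energy_ge0.
  by apply: mulr_ge0; [apply: mulr_ge0 => //; exact: sqr_ge0|exact: powR_ge0].
(* [ip_le_Lq] asks for a positive norm bound and a positive measure; in the degenerate cases the
   left-hand side vanishes. *)
have [En|E0] := eqVneq (energy leb Om w w) 0.
  apply: le_trans R0; rewrite -En; apply: le_trans (ip_le_energy _ _ _ ord0).
  exact: sub_ip_le.
have Epos : 0 < energy leb Om w w by rewrite lt_neqAle eq_sym E0 energy_ge0.
have [a0|a0] := eqVneq (fine (leb E)) 0.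
  apply: le_trans R0; have E00 : leb E = 0%E.
    by rewrite -[leb E]fineK ?a0// ge0_fin_numE.
  rewrite (ip_null mE E00)//; exact: (sub_sqint mOm mE EO).
have apos : 0 < fine (leb E) by rewrite lt_neqAle eq_sym a0 fine_ge0.
have B0 : 0 < c * Num.sqrt (energy leb Om w w) by rewrite mulr_gt0// sqrtr_gt0.
have := ip_le_Lq mOm (sw ord0) q2 B0 (sobolev_Lq Ww) mE EO Efin apos.
by rewrite exprMn sqr_sqrtr ?energy_ge0// mulrA mulrAC.
Qed.

End SobolevInequality.

(** * Comparison of the spectra *)

Section ResolventIteration.
Context {d : measure_display} {T : measurableType d} {R : realType}.
Variables (m : {measure set T -> \bar R}) (D : set T) (N : nat).
Hypothesis mD : measurable D.
Variable W : set ('I_N.+1 -> T -> R).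
Hypothesis HW : dirichlet_space m D W.

Lemma sum_scale_field (I : finType) (c : I -> R) (w : I -> 'I_N.+1 -> T -> R) j :
  (\sum_i c i *: w i) j = \sum_i c i *: w i j.
Proof. by rewrite fct_sumE. Qed.

Lemma resolvent_chain_exists h : sqint m D h ->
  exists2 w, resolvent_chain m D W w & w 0%N ord0 = h.
Proof.
move=> sh.
have /choice[A HA] : forall h, exists w, sqint m D h -> resolvent m D W h w.
  move=> f; have [sf|nf] := pselect (sqint m D f); last by exists 0.
  by have [w rw] := resolvent_exists mD HW sf; exists w.
(* The initial field repeats [h] in every component; a chain reads only [ord0] of it. *)
pose w := fix w j := if j is j'.+1 then A (w j' ord0) else (fun _ => h).
have sw j : sqint m D (w j ord0).
  elim: j => //= j IH; have [Ww _] := HA _ IH; exact: (ds_sqint HW Ww).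
by exists w => // j; exact: HA.
Qed.

Lemma resolvent_chain_sum n (c : 'I_n -> R) (w : 'I_n -> nat -> 'I_N.+1 -> T -> R) :
  (forall i, resolvent_chain m D W (w i)) -> (forall i, sqint m D (w i 0%N ord0)) ->
  resolvent_chain m D W (fun j => \sum_i c i *: w i j).
Proof.
move=> wc ws j; rewrite sum_scale_field.
apply: (resolvent_sum mD HW) => i; last exact: wc.
exact: (resolvent_chain_sqint HW (wc i)).
Qed.

(** The field [v] accompanies the chain because [w 0] need not lie in [W]; from index 1 on, [w j] is
    its own witness. The second conclusion limits the loss of norm over [j] steps. *)
Lemma resolvent_chain_rayleigh w v (L : R) j : resolvent_chain m D W w ->
  sqint m D (w 0%N ord0) -> W v -> v ord0 = w 0%N ord0 -> 0 <= L ->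
  energy m D v v <= L * ip m D (w 0%N ord0) (w 0%N ord0) ->
  (exists v', [/\ W v', v' ord0 = w j ord0 &
    energy m D v' v' <= L * ip m D (w j ord0) (w j ord0)]) /\
  ip m D (w 0%N ord0) (w 0%N ord0) <= (L ^+ 2) ^+ j * ip m D (w j ord0) (w j ord0).
Proof.
move=> wc s0 Wv v0 L0 vL; elim: j => [|j [[v' [Wv' v'j v'L]] IH]].
  by split; [exists v|rewrite expr0 mul1r].
have sj := resolvent_chain_sqint HW wc s0 j.
have [e1 e2] := resolvent_rayleigh mD HW sj (wc j) Wv' v'j L0 v'L.
split; first by exists (w j.+1); split => //; case: (wc j).
apply: le_trans IH _; rewrite (exprSr (L ^+ 2) j) -mulrA ler_wpM2l//.
by rewrite exprn_ge0// sqr_ge0.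
Qed.

End ResolventIteration.

Lemma eq0_of_le_half (R : realFieldType) (g x : R) :
  x <= 2^-1 -> 0 <= g -> g <= x * g -> g = 0.
Proof.
move=> x12 g0 gx; have : x * g <= 2^-1 * g by rewrite ler_wpM2r.
lra.
Qed.

(** In the application [a], [b], [e] are squared norms over the large domain, the small one and
    their difference, and [f] is the energy. As b >= (1 - x) a and (1 + 2 x)(1 - x) >= 1 for x <=
    1/2, it follows that a <= (1 + 2 x) b. *)
Lemma rayleigh_restrict_le (R : realFieldType) (L a b e x f : R) :
  0 <= L -> 0 <= a -> 0 <= x -> x <= 2^-1 -> f <= (1 + L) * a -> e <= x * a ->
  a = b + e -> f - a <= (1 + 2 * x) * L * b.
Proof.
move=> L0 a0 x0 x12 fa ea aE.
apply: (@le_trans _ _ (L * a)); first lra.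
rewrite [_ * L]mulrC -mulrA ler_wpM2l//.
have H : (1 + 2 * x) * ((1 - x) * a) <= (1 + 2 * x) * b by rewrite ler_wpM2l//; lra.
apply: le_trans H; rewrite mulrA -[leLHS]mul1r ler_wpM2r//; nra.
Qed.

Section Comparison.
Context {R : realType} {N : nat}.
Notation rV := ('rV[R]_N).
Notation T := (borelRV R N).
Notation leb := (@lebesgueRV R N).

Lemma lincombE n (c : 'I_n -> R) (F : 'I_n -> rV -> R) :
  lincomb c F = \sum_i c i *: F i.
Proof. by apply/funext => x; rewrite fct_sumE. Qed.

Section Domain.
Variable Om : set rV.
Hypotheses (oOm : open Om) (Omfin : (leb Om < +oo)%E).
Let mOm : measurable (Om : set T) := open_measurableRV oOm.

Lemma sqint_lincomb n (c : 'I_n -> R) (F : 'I_n -> T -> R) :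
  (forall i, sqint leb Om (F i)) -> sqint leb Om (lincomb c F).
Proof.
move=> sF; rewrite lincombE; apply: (sqint_sum mOm) => i.
exact: (sqintZ mOm).
Qed.

(** [Qform] is an infimum; a strict bound selects an actual weak gradient, whose finite integral
    makes every component square integrable. *)
Lemma Qform_lt_field (h : T -> R) (r : R) : sqint leb Om h -> (Qform Om h < r%:E)%E ->
  exists w, [/\ sobolev_fields Om w, w ord0 = h & energy leb Om w w <= ip leb Om h h + r].
Proof.
move=> sh; rewrite /Qform asboolT; last exact/L2P.
move=> /ereal_inf_lt[_ [g wg <-] gr].
have mg i : measurable_fun setT (g i : T -> R).
  by case: wg => bg _; exact/measurable_borel_fun.
have sg i : sqint leb Om (g i).
  split => //; rewrite -sqnorm2E//; apply: (@le_lt_trans _ _ r%:E); last exact: ltry.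
  apply: le_trans (ltW gr); rewrite /sqnorm2 /intOn; apply: le_iint => x.
    by case: asbool => //; rewrite lee_fin sqr_ge0.
  case: asbool => //; rewrite lee_fin (bigD1 i)//= lerDl sumr_ge0// => j _.
  exact: sqr_ge0.
pose w : 'I_N.+1 -> T -> R := fun k => if unlift ord0 k is Some i then g i else h.
have w0 : w ord0 = h by rewrite /w unlift_none.
have wl i : w (lift ord0 i) = g i by rewrite /w liftK.
exists w; split => //.
  split=> [k|i phi tphi]; first by rewrite /w; case: unliftP.
  rewrite w0 wl; move: tphi; move: i phi.
  by apply/weak_grad_ipP.
rewrite sum_sqr_ip// lte_fin in gr.
rewrite /energy big_ord_recl w0 lerD2l; under eq_bigr do rewrite wl.
exact: ltW.
Qed.

Lemma mu_span_field n (F : 'I_n -> T -> R) (l : R) (c : 'I_n -> R) :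
  (forall i, sqint leb Om (F i)) -> L2_indep Om F -> (mu_span Om F < l%:E)%E ->
  exists w, [/\ sobolev_fields Om w, w ord0 = lincomb c F &
    energy leb Om w w <= (1 + l) * ip leb Om (lincomb c F) (lincomb c F)].
Proof.
move=> sF iF Fl; have sh := sqint_lincomb c sF; set h := lincomb c F in sh *.
(* A combination of norm zero does not enter [mu_span]; independence makes its coefficients vanish,
   and the zero field serves. *)
have [h0|h0] := eqVneq (ip leb Om h h) 0.
  have c0 : forall i, c i = 0 by apply: iF; rewrite sqnorm2_ip// -/h h0.
  exists 0; split; first exact: sobolev_fields0.
    by rewrite /h lincombE big1// => i _; rewrite c0 scale0r.
  rewrite h0 mulr0 /energy big1// => i _.
  by rewrite /ip; under eq_Rintegral do rewrite mul0r; rewrite /Rintegral integral0.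
have hp : 0 < ip leb Om h h by rewrite lt_neqAle eq_sym h0 ip_ge0.
suff Q : (Qform Om h < (l * ip leb Om h h)%:E)%E.
  have [w [Ww w0 wE]] := Qform_lt_field sh Q.
  by exists w; split => //; rewrite mulrDl mul1r.
have : (Qform Om h * ((ip leb Om h h)^-1)%:E < l%:E)%E.
  apply: le_lt_trans Fl; apply: ereal_sup_ubound; exists c => /=.
    by rewrite sqnorm2_ip// => -[] /eqP; rewrite (negbTE h0).
  by rewrite sqnorm2_ip.
by rewrite lte_pdivrMr.
Qed.

End Domain.

Section Subdomain.
Variables (Om1 Om2 : set rV).
Hypotheses (oOm1 : open Om1) (Omfin1 : (leb Om1 < +oo)%E).
Hypotheses (oOm2 : open Om2) (s21 : Om2 `<=` Om1).
Let mOm1 : measurable (Om1 : set T) := open_measurableRV oOm1.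
Let mOm2 : measurable (Om2 : set T) := open_measurableRV oOm2.

Lemma subdomain_lty : (leb Om2 < +oo)%E.
Proof. exact: (sub_measure_lty mOm1 Omfin1 mOm2 s21). Qed.

(** A test function on [Om2] is one on [Om1], and it vanishes with its derivatives off [Om2], so
    restriction changes neither side of the weak equation. *)
Lemma sub_sobolev_fields (w : 'I_N.+1 -> T -> R) : sobolev_fields Om1 w ->
  sobolev_fields Om2 w.
Proof.
move=> [sw Hw]; split=> [i|i phi tphi]; first exact: (sub_sqint mOm1 mOm2 s21).
have := Hw i phi (sub_test_fun s21 tphi).
have [_ [K [cK KO phi0]]] := tphi.
have p1 x : Om1 x -> ~ Om2 x -> phi x = 0 by move=> _ nx; apply: phi0 => /KO.
have p2 x : Om1 x -> ~ Om2 x -> partial i phi x = 0.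
  by move=> _ nx; apply: (partial_eq0 i cK phi0) => /KO.
by rewrite (ip_restrict leb _ mOm2 s21 p1) (ip_restrict leb _ mOm2 s21 p2).
Qed.

Lemma ip_subdomain (f : T -> R) : sqint leb Om1 f ->
  ip leb Om1 f f = ip leb Om2 f f + ip leb (Om1 `\` Om2) f f.
Proof.
move=> sf; have mE : measurable (Om1 `\` Om2 : set T) by exact: measurableD.
apply: EFin_inj; rewrite EFinD !EFin_ip_sqr//; last 2 first.
- exact: (sub_sqint mOm1 mE _ sf).
- exact: (sub_sqint mOm1 mOm2 s21 sf).
rewrite -ge0_integral_setU//; first by rewrite setDUK.
- apply/measurable_EFinP; apply: measurable_funTS; apply: measurable_funX.
  by case: sf.
- by move=> x _; rewrite lee_fin sqr_ge0.
- by apply/disj_setPS => x [Ox [_ nx]].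
Qed.

Variables (j : nat) (K : R).
Hypothesis K0 : 0 < K.
Hypothesis bounded : forall w : nat -> 'I_N.+1 -> T -> R,
  resolvent_chain leb Om1 (sobolev_fields Om1) w -> sqint leb Om1 (w 0%N ord0) ->
  forall r, 0 < r -> ip leb Om1 (w 0%N ord0) (w 0%N ord0) <= r ->
  forall E : set T, measurable E -> E `<=` Om1 ->
  ip leb E (w j ord0) (w j ord0) <= K * r * fine (leb E).

(** The trial space on [Om2] is spanned by the iterates [G i] of the [F i]. On the removed set a
    combination has squared norm at most [K * r] times the measure, where [r] is the squared norm of
    the same combination of the [F i], and [r] is at most ((1 + L)^2)^j times that of the [G i].
    This product is the source of [x]. *)
Lemma mu_subdomain_le n (F : 'I_n.+1 -> T -> R) (L : R) :
  (forall i, sqint leb Om1 (F i)) -> L2_indep Om1 F -> 0 <= L ->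
  (mu_span Om1 F < L%:E)%E ->
  let x := K * ((1 + L) ^+ 2) ^+ j * fine (leb (Om1 `\` Om2)) in x <= 2^-1 ->
  (mu n Om2 <= ((1 + 2 * x) * L)%:E)%E.
Proof.
move=> sF iF L0 FL x x12.
have HW := sobolev_dirichlet oOm1 Omfin1.
have mE : measurable (Om1 `\` Om2 : set T) by exact: measurableD.
have L10 : 0 <= 1 + L by rewrite addr_ge0.
have x0 : 0 <= x.
  by rewrite !mulr_ge0 ?(ltW K0) ?fine_ge0// exprn_ge0// sqr_ge0.
have /choice[w Hw] : forall i, exists w,
    resolvent_chain leb Om1 (sobolev_fields Om1) w /\ w 0%N ord0 = F i.
  move=> i; have [w wc w0] := resolvent_chain_exists mOm1 HW (sF i).
  by exists w.
have wc i := (Hw i).1; have w0 i := (Hw i).2.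
have ws i : sqint leb Om1 (w i 0%N ord0) by rewrite w0.
pose G i := w i j ord0.
have sG i : sqint leb Om1 (G i) := resolvent_chain_sqint HW (wc i) (ws i) j.
have sG2 i : sqint leb Om2 (G i) by exact: (sub_sqint mOm1 mOm2 s21).
have key c : exists v, [/\ sobolev_fields Om1 v, v ord0 = lincomb c G,
    energy leb Om1 v v <= (1 + L) * ip leb Om1 (lincomb c G) (lincomb c G),
    ip leb Om1 (lincomb c F) (lincomb c F) <=
      ((1 + L) ^+ 2) ^+ j * ip leb Om1 (lincomb c G) (lincomb c G) &
    ip leb Om1 (lincomb c F) (lincomb c F) = 0 \/
    ip leb (Om1 `\` Om2) (lincomb c G) (lincomb c G) <=
      x * ip leb Om1 (lincomb c G) (lincomb c G)].
  pose wt k := \sum_i c i *: w i k.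
  have wtc : resolvent_chain leb Om1 (sobolev_fields Om1) wt.
    exact: (resolvent_chain_sum mOm1 HW).
  have wt0 : wt 0%N ord0 = lincomb c F.
    by rewrite /wt sum_scale_field lincombE; apply: eq_bigr => i _; rewrite w0.
  have wtj : wt j ord0 = lincomb c G by rewrite /wt sum_scale_field lincombE.
  have swt : sqint leb Om1 (wt 0%N ord0) by rewrite wt0; exact: sqint_lincomb.
  have [v [Wv v0 vL]] := mu_span_field oOm1 Omfin1 c sF iF FL.
  rewrite -wt0 in v0 vL.
  have [[v' [Wv' v'j v'L]] FG] :=
    resolvent_chain_rayleigh mOm1 HW j wtc swt Wv v0 L10 vL.
  rewrite -wt0 -wtj; exists v'; split => //.
  (* The hypothesis [bounded] asks for a positive [r], hence the alternative. *)
  have [|h0] := eqVneq (ip leb Om1 (wt 0%N ord0) (wt 0%N ord0)) 0; [by left|right].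
  have hp : 0 < ip leb Om1 (wt 0%N ord0) (wt 0%N ord0).
    by rewrite lt_neqAle eq_sym h0 ip_ge0.
  apply: le_trans (bounded wtc swt hp (lexx _) mE _) _ => //.
  rewrite (_ : x * _ = K * (((1 + L) ^+ 2) ^+ j * ip leb Om1 (wt j ord0) (wt j ord0)) *
    fine (leb (Om1 `\` Om2))); last by rewrite /x; ring.
  by rewrite ler_wpM2r ?fine_ge0// ler_wpM2l// ltW.
(* If a combination vanishes on [Om2], all its mass sits on the removed set, which carries at most
   half of it. So it vanishes on [Om1], and by the lower norm bound so does the combination of the
   [F i]. *)
have iG2 : L2_indep Om2 G.
  move=> c; rewrite sqnorm2_ip//; last exact: sqint_lincomb.
  move=> [G0]; have [v [_ _ _ FG [F0|Ex]]] := key c; apply: iF.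
    by rewrite sqnorm2_ip// ?F0//; exact: sqint_lincomb.
  rewrite sqnorm2_ip//; last exact: sqint_lincomb.
  have := ip_subdomain (sqint_lincomb oOm1 c sG); rewrite G0 add0r => E1.
  have g0 := ip_ge0 leb Om1 (lincomb c G).
  rewrite -E1 in Ex; have {}g0 := eq0_of_le_half x12 g0 Ex.
  congr EFin; apply/eqP; rewrite eq_le ip_ge0 andbT.
  by apply: le_trans FG _; rewrite g0 mulr0.
apply: (@le_trans _ _ (mu_span Om2 G)).
  apply: ereal_inf_lbound; exists G => //; split => // i.
  exact/(L2P mOm2).
apply: ge_ereal_sup => _ [c /= c0 <-].
have sc2 : sqint leb Om2 (lincomb c G) by exact: sqint_lincomb.
rewrite (sqnorm2_ip mOm2 sc2) /= in c0 *.
have [v [Wv v0 vL FG Ex]] := key c.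
have {}Ex : ip leb (Om1 `\` Om2) (lincomb c G) (lincomb c G) <=
    x * ip leb Om1 (lincomb c G) (lincomb c G).
  case: Ex => // F0; exfalso; apply: c0.
  have c0 : forall i, c i = 0.
    by apply: iF; rewrite sqnorm2_ip// ?F0//; exact: sqint_lincomb.
  rewrite (_ : lincomb c G = 0); last first.
    by rewrite lincombE big1// => i _; rewrite c0 scale0r.
  by rewrite /ip; under eq_Rintegral do rewrite mul0r; rewrite /Rintegral integral0.
have hp : 0 < ip leb Om2 (lincomb c G) (lincomb c G).
  by rewrite lt_neqAle ip_ge0 andbT eq_sym; apply/eqP => h; apply: c0; rewrite h.
rewrite lee_pdivrMr//.
have := Qform_le oOm2 subdomain_lty (sub_sobolev_fields Wv); rewrite v0 => /le_trans; apply.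
rewrite -EFinM lee_fin.
have sc1 : sqint leb Om1 (lincomb c G) by exact: sqint_lincomb.
have := ip_subdomain sc1.
have : energy leb Om2 v v - ip leb Om2 (lincomb c G) (lincomb c G) <=
    energy leb Om1 v v - ip leb Om1 (lincomb c G) (lincomb c G).
  rewrite -v0 /energy !big_ord_recl addrAC subrr add0r addrAC subrr add0r.
  apply: ler_sum => i _; apply: (sub_ip_le mOm1 mOm2 s21).
  by case: Wv.
move=> H1 H2; apply: le_trans H1 _.
exact: (rayleigh_restrict_le L0 (ip_ge0 _ _ _) x0 x12 vL Ex H2).
Qed.

End Subdomain.

End Comparison.

Section SpectralComparison.
Context {R : realType} {N : nat}.
Notation rV := ('rV[R]_N).
Notation T := (borelRV R N).
Notation leb := (@lebesgueRV R N).

Lemma Qform_ge0 (Om : set rV) f : (0 <= Qform Om f)%E.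
Proof.
rewrite /Qform; case: asboolP => // _; apply: le_ereal_inf_tmp => _ [g _ <-].
apply: iint_ge0 => x; case: asbool => //.
by rewrite lee_fin sumr_ge0// => i _; exact: sqr_ge0.
Qed.

Lemma mu_ge0 n (Om : set rV) : (0 <= mu n Om)%E.
Proof.
apply: le_ereal_inf_tmp => _ [F [_ iF] <-].
(* An empty supremum would be -oo; independence makes the first member of the family admissible. *)
pose c (i : 'I_n.+1) : R := (i == ord0)%:R.
apply: (@le_trans _ _ (Qform Om (lincomb c F) *
    ((fine (sqnorm2 Om (lincomb c F)))^-1)%:E)%E); last first.
  apply: ereal_sup_ubound; exists c => //= /iF/(_ ord0)/eqP.
  by rewrite /c eqxx oner_eq0.
apply: mule_ge0; first exact: Qform_ge0.
rewrite lee_fin invr_ge0 fine_ge0//; apply: iint_ge0 => x; case: asbool => //.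
by rewrite lee_fin sqr_ge0.
Qed.

Theorem mu_perturbation (Om1 : set rV) (q c : R) : open Om1 -> (leb Om1 < +oo)%E ->
  2 < q -> 0 < c ->
  (forall f, W12 Om1 f -> (Lqnorm q Om1 f <= c%:E * W12norm Om1 f)%E) ->
  forall n, exists b e : R, 0 < b /\ 0 < e /\
    forall Om2 : set rV, open Om2 -> Om2 `<=` Om1 -> (leb (Om1 `\` Om2) <= e%:E)%E ->
    (mu n Om2 <= (1%:E + b%:E * leb (Om1 `\` Om2)) * mu n Om1)%E.
Proof.
move=> oOm1 Omfin1 q2 c0 emb n.
have mOm1 := open_measurableRV oOm1.
have HW := sobolev_dirichlet oOm1 Omfin1.
have c20 : 0 < 2 * c ^+ 2 by rewrite mulr_gt0// exprn_gt0.
have q0 : 0 < q by apply: lt_trans q2.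
have th0 : 0 < 1 - 2 / q by rewrite subr_gt0 ltr_pdivrMr// mul1r.
have th1 : 1 - 2 / q < 1 by rewrite gtrBl divr_gt0.
have sob w : sobolev_fields Om1 w -> forall E : set T, measurable E -> E `<=` Om1 ->
    ip leb E (w ord0) (w ord0) <=
    2 * c ^+ 2 * fine (leb E) `^ (1 - 2 / q) * energy leb Om1 w w.
  by move=> Ww E mE EO; exact: (sobolev_inequality oOm1 Omfin1 q2 c0 emb).
have [j [K [K0 HK]]] := resolvent_chain_bounded mOm1 Omfin1 HW c20 th0 th1 sob.
(* An infinite right-hand side makes the inequality trivial with any constants. *)
have [muoo|mufin] := eqVneq (mu n Om1) +oo%E.
  exists 1, 1; do 2!split => //; move=> Om2 _ _ _.
  rewrite muoo gt0_muley ?leey//; apply: (lt_le_trans (@lte01 R)).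
  by rewrite leeDl// mule_ge0// lee01.
have : mu n Om1 \is a fin_num by rewrite ge0_fin_numE ?mu_ge0// lt_neqAle mufin leey.
move=> /fineK muE; set l := fine (mu n Om1) in muE.
have l0 : 0 <= l by rewrite fine_ge0// mu_ge0.
(* Near-optimal spans have quotients below [l + eta] with [eta <= 1], and the energy adds 1; [2 + l]
   covers them all, so [C] is fixed before [eta] and [Om2]. *)
pose C := K * ((2 + l) ^+ 2) ^+ j.
have l20 : 0 < 2 + l by rewrite ltr_wpDr.
have C0 : 0 < C by apply: mulr_gt0 => //; do 2!apply: exprn_gt0.
have C20 : 0 < 2 * C by apply: mulr_gt0.
(* The threshold keeps [C] times the removed measure at most 1/2; the factor 2 in the first constant
   is that of [rayleigh_restrict_le]. *)
exists (2 * C), (2 * C)^-1; split => //; split; first by rewrite invr_gt0.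
move=> Om2 oOm2 s21 aE.
have mOm2 := open_measurableRV oOm2.
have afin : leb (Om1 `\` Om2) \is a fin_num.
  by rewrite ge0_fin_numE//; apply: le_lt_trans aE _; exact: ltry.
rewrite -(fineK afin) in aE *; set a := fine (leb _) in aE *.
have a0 : 0 <= a by rewrite fine_ge0.
rewrite lee_fin in aE.
pose y := C * a; have y12 : y <= 2^-1.
  by rewrite /y mulrC -ler_pdivlMr// -invfM.
have y0 : 0 <= y by rewrite mulr_ge0// ltW.
rewrite -muE -EFinM; apply/lee_addgt0Pr => t t0.
(* The factor [1 + 2 * y] is at most 2, so the excess [eta <= t / 2] costs at most [t]. *)
pose eta := Num.min 1 (t / 2).
have eta0 : 0 < eta by rewrite lt_min ltr01 divr_gt0.
have eta1 : eta <= 1 by rewrite ge_min lexx.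
have etat : eta <= t / 2 by rewrite ge_min lexx orbT.
have : (mu n Om1 < (l + eta)%:E)%E by rewrite -muE lte_fin ltrDl.
move=> /ereal_inf_lt[_ [F [FL2 iF] <-] FL].
have sF i : sqint leb Om1 (F i) by apply/(L2P mOm1).
have L0 : 0 <= l + eta by rewrite addr_ge0// ltW.
have bnd : ((1 + (l + eta)) ^+ 2) ^+ j <= ((2 + l) ^+ 2) ^+ j.
  by rewrite !(lerXn2r, nnegrE)// ?exprn_ge0// ?addr_ge0//; lra.
have xy : K * ((1 + (l + eta)) ^+ 2) ^+ j * a <= y.
  by rewrite /y ler_wpM2r// ler_wpM2l// ltW.
apply: le_trans (mu_subdomain_le oOm1 Omfin1 oOm2 s21 K0 HK sF iF L0 FL _) _.
  exact: le_trans xy y12.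
rewrite -EFinD lee_fin (_ : 2 * C * a = 2 * y); last by rewrite /y mulrA.
apply: (@le_trans _ _ ((1 + 2 * y) * (l + eta))).
  by rewrite ler_wpM2r// lerD2l ler_wpM2l.
rewrite mulrDr lerD2l; apply: (@le_trans _ _ (2 * (t / 2))); last by rewrite mulrC divfK.
by apply: ler_pM; [rewrite addr_ge0// mulr_ge0|exact: ltW|lra|].
Qed.

End SpectralComparison.

(** * Boundary strips and the Minkowski dimension *)

Section MinkowskiContent.
Context {R : realType} {N : nat}.
Notation rV := ('rV[R]_N).
Implicit Types A B : set rV.

Lemma le_lmeas A B : A `<=` B -> (lmeas A <= lmeas B)%E.
Proof.
move=> AB; apply: le_iint => x; rewrite lee_fin !indicE//.
have [/set_mem/AB/mem_set ->|//] := boolP (x \in A).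
by rewrite lexx.
Qed.

(** The strict bound yields an admissible l < N - sigma, for which the strip measures at most B e^(N
    - l) near 0; for e < 1 the exponent N - l may be lowered to sigma. *)
Lemma lmeas_strip_le (Om : set rV) (sigma : R) :
  (minkowski_dim Om < (N%:R - sigma)%:E)%E ->
  exists B d : R, 0 < B /\ 0 < d /\ forall e : R, 0 < e -> e < d ->
    (lmeas (strip Om e) <= (B * e `^ sigma)%:E)%E.
Proof.
move=> /ereal_inf_lt[_ [l [l0 Hl] <-] lN]; rewrite lte_fin in lN.
move: Hl => /ereal_inf_lt[_ [V V0 <-] Vfin].
have [B B0 HB] : exists2 B : R, 0 < B & forall e, V e ->
    (lmeas (strip Om e) * ((e `^ (N%:R - l))^-1)%:E <= B%:E)%E.
  move: Vfin; set s := ereal_sup _ => sfin.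
  exists (Num.max 1 (fine s)); first by rewrite lt_max ltr01.
  move=> e Ve; apply: (@le_trans _ _ s); first by apply: ereal_sup_ubound; exists e.
  move: sfin; case: s => [r||]//= _; last by rewrite leNye.
  by rewrite lee_fin le_max lexx orbT.
move: V0 => /nbhs_ballP[d /= d0 dV].
have d1 : 0 < Num.min 1 d by rewrite lt_min ltr01.
exists B, (Num.min 1 d); do 2!split => //; move=> e e0; rewrite lt_min => /andP[e1 ed].
have Ve : V e by apply: dV => //; rewrite -ball_normE/= sub0r normrN gtr0_norm.
have p0 : 0 < e `^ (N%:R - l) by rewrite powR_gt0.
have := HB e Ve; rewrite lee_pdivrMr// => /le_trans; apply.
rewrite -EFinM lee_fin ler_wpM2l ?(ltW B0)// ger_powR ?e0 ?(ltW e1)//.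
by rewrite lerBrDr addrC -lerBrDr ltW.
Qed.

Lemma mu_minkowski (Om1 : set rV) (b e sigma : R) n : open Om1 ->
  0 < b -> 0 < e -> 0 < sigma -> (minkowski_dim Om1 < (N%:R - sigma)%:E)%E ->
  (forall Om2 : set rV, open Om2 -> Om2 `<=` Om1 -> (lmeas (Om1 `\` Om2) <= e%:E)%E ->
    (mu n Om2 <= (1%:E + b%:E * lmeas (Om1 `\` Om2)) * mu n Om1)%E) ->
  exists b2 e2 : R, 0 < b2 /\ 0 < e2 /\
    forall eps : R, 0 < eps -> eps <= e2 ->
    forall Om2 : set rV, open Om2 -> Om1 `\` strip Om1 eps `<=` Om2 -> Om2 `<=` Om1 ->
      (mu n Om2 <= (1%:E + (b2 * eps `^ sigma)%:E) * mu n Om1)%E.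
Proof.
move=> oOm1 b0 e0 s0 Mdim H.
have [B [d [B0 [d0 HB]]]] := lmeas_strip_le Mdim.
have r0 : 0 < (e / B) `^ sigma^-1 by apply: powR_gt0; exact: divr_gt0.
(* The second bound keeps B eps^sigma at most [e], so that the estimate in terms of measure applies;
   [d / 2] turns the weak inequality into the strict one of the strip bound. *)
exists (b * B), (Num.min (d / 2) ((e / B) `^ sigma^-1)).
split; first exact: mulr_gt0.
split; first by rewrite lt_min r0 divr_gt0.
move=> eps eps0; rewrite le_min => /andP[epsd epse] Om2 oOm2 sO s21.
have epsd' : eps < d by apply: le_lt_trans epsd _; rewrite ltr_pdivrMr// ltr_pMr// ltr1n.
have mE : (lmeas (Om1 `\` Om2) <= (B * eps `^ sigma)%:E)%E.
  apply: le_trans (HB eps eps0 epsd'); apply: le_lmeas => x [Ox nx].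
  by apply: contrapT => ns; apply: nx; apply: sO.
have small : B * eps `^ sigma <= e.
  rewrite mulrC -ler_pdivlMr//.
  have -> : e / B = ((e / B) `^ sigma^-1) `^ sigma.
    by rewrite -powRrM mulVf ?gt_eqF// powRr1// divr_ge0// ltW.
  by rewrite ge0_ler_powR ?nnegrE ?(ltW eps0) ?(ltW r0) ?(ltW s0).
apply: le_trans (H Om2 oOm2 s21 _) _; first by apply: le_trans mE _; rewrite lee_fin.
apply: lee_wpmul2r; first exact: mu_ge0.
rewrite leeD2l// -mulrA EFinM; apply: lee_wpmul2l => //.
by rewrite lee_fin ltW.
Qed.

End MinkowskiContent.

Theorem theorem13 (R : realType) (N : nat) (Om1 : set 'rV[R]_N) :
  region Om1 -> (lmeas Om1 < +oo)%E ->
  (exists q c13 : R, 2 < q /\ 0 < c13 /\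
     forall f, W12 Om1 f -> (Lqnorm q Om1 f <= c13%:E * W12norm Om1 f)%E) ->
  (forall n : nat, (1 <= n)%N ->
     exists b1 eps1 : R, 0 < b1 /\ 0 < eps1 /\
       forall Om2 : set 'rV[R]_N, region Om2 -> Om2 `<=` Om1 ->
         (lmeas (Om1 `\` Om2) <= eps1%:E)%E ->
         (mu n Om2 <= (1%:E + b1%:E * lmeas (Om1 `\` Om2)) * mu n Om1)%E)
  /\
  ((minkowski_dim Om1 < N%:R%:E)%E ->
   forall sigma : R, 0 < sigma -> (sigma%:E < N%:R%:E - minkowski_dim Om1)%E ->
   forall n : nat, (1 <= n)%N ->
     exists b2 eps2 : R, 0 < b2 /\ 0 < eps2 /\
       forall eps : R, 0 < eps -> eps <= eps2 ->
       forall Om2 : set 'rV[R]_N, region Om2 ->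
         Om1 `\` strip Om1 eps `<=` Om2 -> Om2 `<=` Om1 ->
         (mu n Om2 <= (1%:E + (b2 * eps `^ sigma)%:E) * mu n Om1)%E).
Proof.
move=> [oOm1 _ _] Omfin1 [q [c [q2 [c0 emb]]]].
have part1 := mu_perturbation oOm1 Omfin1 q2 c0 emb.
split=> [n _|Mdim sigma s0 sM n _]; have [b [e [b0 [e0 H]]]] := part1 n.
  by exists b, e; do 2!split => //; move=> Om2 [oOm2 _ _]; exact: H.
have Ms : (minkowski_dim Om1 < (N%:R - sigma)%:E)%E.
  move: Mdim sM; case: minkowski_dim => [M||]//=; last by rewrite !ltNyr.
  by rewrite -EFinB !lte_fin => _; rewrite ltrBrDr addrC -ltrBrDr.
have [b2 [e2 [b20 [e20 H2]]]] := mu_minkowski oOm1 b0 e0 s0 Ms H.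
by exists b2, e2; do 2!split => //; move=> eps ? ? Om2 [oOm2 _ _]; exact: H2.
Qed.
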